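(* Let $n\ge1$ and $\mathbf{r}\in D_n$. The isometry classes of left invariant (bracket generating) sub-Riemannian metrics of corank $0$ or $1$ on $\Gamma_{\mathbf{r}}\backslash\mathbb{H}_n$ are in one-to-one correspondence with the double coset space $$\mathcal{M}(\Gamma_{\mathbf{r}}\backslash\mathbb{H}_n):=\Pi_{\mathbf{r}}\backslash\left(\mathrm{GL}_{2n}(\mathbb{R})\times\mathbb{R}\right)/\left(\mathrm{O}(2n)\times\{\pm1\}\right),$$ the class of $(\tilde{\mathbf{A}},\rho_{\mathbf{A}})$ corresponding to the isometry class of the metric defined by $\mathbf{A}=\begin{pmatrix}\tilde{\mathbf{A}}&0\\0&\rho_{\mathbf{A}}\end{pmatrix}$. Under this correspondence, Riemannian metrics correspond to $$\mathcal{M}_0(\Gamma_{\mathbf{r}}\backslash\mathbb{H}_n):=\Pi_{\mathbf{r}}\backslash\left(\mathrm{GL}_{2n}(\mathbb{R})\times\mathbb{R}^*\right)/\left(\mathrm{O}(2n)\times\{\pm1\}\right),$$ and sub-Riemannian metrics of corank $1$ correspond to $$\mathcal{M}_1(\Gamma_{\mathbf{r}}\backslash\mathbb{H}_n):=\Pi_{\mathbf{r}}\backslash\left(\mathrm{GL}_{2n}(\mathbb{R})\times\{0\}\right)/\left(\mathrm{O}(2n)\times\{\pm1\}\right).$$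
   Context: $\mathbb{H}_n$ is the Heisenberg group of dimension $2n+1$: its Lie algebra $\mathfrak{h}_n$ has basis $X_1,\dots,X_n,Y_1,\dots,Y_n,Z$ with $[X_i,Y_i]=Z$ and all other brackets of basis elements zero; $\mathbb{H}_n$ is identified with $\mathfrak{h}_n$ via $\exp$. Endomorphisms of $\mathfrak{h}_n$ are written as matrices in this basis, and $\langle\cdot,\cdot\rangle_0$ is the scalar product making it orthonormal. A left invariant sub-Riemannian metric on $\mathbb{H}_n$ is given by a subspace of $\mathfrak{h}_n$ with a scalar product on it, extended by left translation; its corank is the codimension of the subspace (corank $0$ is Riemannian); it is bracket generating if iterated brackets of the subspace span $\mathfrak{h}_n$. The distance is the infimum of lengths of absolutely continuous paths tangent a.e. to the distribution. A sub-Riemannian metric on a quotient $\Gamma\backslash\mathbb{H}_n$ is left invariant if its pullback to $\mathbb{H}_n$ is; isometries are isometries of the resulting distances. A matrix $\mathbf{A}\in\mathrm{End}_{\mathbb{R}}(\mathfrak{h}_n)$ defines the sub-Riemannian metric $(\mathrm{Im}(\mathbf{A}),\langle\cdot,\cdot\rangle_{\mathbf{A}})$, where $\langle\cdot,\cdot\rangle_{\mathbf{A}}$ is induced from the norm $\|U\|_{\mathbf{A}}=\min\{\|V\|_0:U=\mathbf{A}V\}$. $D_n$ is the set of $n$-tuples of positive integers $\mathbf{r}=(r_1,\dots,r_n)$ with $r_i\mid r_{i+1}$ for all $i$, and $\Gamma_{\mathbf{r}}<\mathbb{H}_n$ is the lattice generated by $\exp(r_1X_1),\dots,\exp(r_nX_n),\exp(Y_1),\dots,\exp(Y_n),\exp(Z)$.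 Let $\mathbf{J}_n=\begin{pmatrix}0&\mathbf{I}_n\\-\mathbf{I}_n&0\end{pmatrix}$, $\widetilde{\mathrm{Sp}}(2n,\mathbb{R})=\{\mathbf{S}\in \mathrm{GL}_{2n}(\mathbb{R}):{}^t\mathbf{S}\mathbf{J}_n\mathbf{S}=\epsilon(\mathbf{S})\mathbf{J}_n,\ \epsilon(\mathbf{S})=\pm1\}$, $G_{\mathbf{r}}=\mathbf{diag}(\mathbf{r})\,\mathrm{GL}_{2n}(\mathbb{Z})\,\mathbf{diag}(\mathbf{r})^{-1}$ with $\mathbf{diag}(\mathbf{r})=\mathrm{diag}(r_1,\dots,r_n,1,\dots,1)$, and $\Pi_{\mathbf{r}}=\left\{\begin{pmatrix}\mathbf{S}&0\\0&\epsilon(\mathbf{S})\end{pmatrix}:\mathbf{S}\in G_{\mathbf{r}}\cap\widetilde{\mathrm{Sp}}(2n,\mathbb{R})\right\}$. Pairs $(\tilde{\mathbf{A}},\rho_{\mathbf{A}})\in \mathrm{GL}_{2n}(\mathbb{R})\times\mathbb{R}$ are regarded as block matrices; $\Pi_{\mathbf{r}}$ acts by left and $\mathrm{O}(2n)\times\{\pm1\}$ (block diagonal) by right matrix multiplication. *)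

(* Defs.v *)
From HB Require Import structures.
From mathcomp Require Import all_boot all_order all_algebra.
From mathcomp Require Import all_classical all_reals all_analysis.
From mathcomp Require Import zify ring lra.

Set Implicit Arguments.
Unset Strict Implicit.
Unset Printing Implicit Defensive.

Import Order.TTheory GRing.Theory Num.Theory.
Import numFieldNormedType.Exports.

Local Open Scope classical_set_scope.
Local Open Scope ring_scope.

(* Both the Lie algebra h_n and, through exp, the group H_n: coordinates are
   listed in the order X_1, ..., X_n, Y_1, ..., Y_n, Z. *)
Notation heis R n := ('cV[R]_(n + n + 1)).

Section Heisenberg.
Variables (R : realType) (n : nat).
Local Notation H := (heis R n).

Definition iX (i : 'I_n) : 'I_(n + n + 1) := lshift 1 (lshift n i).
Definition iY (i : 'I_n) : 'I_(n + n + 1) := lshift 1 (rshift n i).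
Definition iZ : 'I_(n + n + 1) := rshift (n + n) ord0.

Definition hX i : H := delta_mx (iX i) ord0.
Definition hY i : H := delta_mx (iY i) ord0.
Definition hZ : H := delta_mx iZ ord0.

Definition bracket (v w : H) : H :=
  (\sum_(i < n) (v (iX i) ord0 * w (iY i) ord0
                 - v (iY i) ord0 * w (iX i) ord0)) *: hZ.

(* Baker-Campbell-Hausdorff in step two; exp is the identity map. *)
Definition hmul (g h : H) : H := g + h + 2^-1 *: bracket g h.
Definition hinv (g : H) : H := - g.

(* Differential at the identity of left translation by g:
   the derivative at s = 0 of hmul g (s *: u). *)
Definition dleft (g u : H) : H := u + 2^-1 *: bracket g u.

Definition is_subgroup (S : set H) : Prop :=
  [/\ S 0, forall g h, S g -> S h -> S (hmul g h) & forall g, S g -> S (hinv g)].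

Definition norm0 (v : H) : R := Num.sqrt (\sum_i v i ord0 ^+ 2).

(* Values of sr_prod outside of sr_dist are irrelevant. *)
Record sr_metric := SRMetric {
  sr_dist : {vspace H};
  sr_prod : H -> H -> R;
  sr_sym : {in sr_dist &, forall u v, sr_prod u v = sr_prod v u};
  sr_linear : forall a : R, {in sr_dist & &, forall u v w,
    sr_prod (a *: u + v) w = a * sr_prod u w + sr_prod v w};
  sr_pos : {in sr_dist, forall u, u != 0 -> 0 < sr_prod u u} }.

Definition sr_norm (m : sr_metric) (u : H) : R := Num.sqrt (sr_prod m u u).

Definition corank (m : sr_metric) : nat :=
  (\dim (fullv : {vspace H}) - \dim (sr_dist m))%N.

Inductive iterated_bracket (V : {vspace H}) : H -> Prop :=
| iterated_base v : v \in V -> iterated_bracket V v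
| iterated_step v w : iterated_bracket V v -> iterated_bracket V w ->
    iterated_bracket V (bracket v w).

Definition bracket_generating (m : sr_metric) : Prop :=
  exists s : seq H, (forall v, v \in s -> iterated_bracket (sr_dist m) v) /\
                    span s = fullv.

Definition admissible (m : sr_metric) : Prop :=
  bracket_generating m /\ (corank m <= 1)%N.
Definition admissible_corank (k : nat) (m : sr_metric) : Prop :=
  bracket_generating m /\ corank m = k.

Section MetricOfMatrix.
Variable A : 'M[R]_(n + n + 1).

Definition mx_image : {vspace H} := limg (linfun (fun v : H => A *m v)).

(* The infimum is a minimum when u is in the image, see mx_norm_min. *)
Definition mx_norm (u : H) : R := inf [set norm0 v | v in [set v | u = A *m v]].

(* Polarization of mx_norm. *)
Definition mx_prod (u v : H) : R :=
  (mx_norm (u + v) ^+ 2 - mx_norm (u - v) ^+ 2) / 4.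

Lemma mem_mx_image u : reflect (exists v, u = A *m v) (u \in mx_image).
Proof.
apply: (iffP memv_imgP) => [[v _ ->]|[v ->]].
  by exists v; rewrite lfunE.
by exists v; rewrite ?memvf // lfunE.
Qed.

Definition dot0 (u v : H) : R := \sum_i u i ord0 * v i ord0.

Lemma dot0E u v : dot0 u v = (u^T *m v) ord0 ord0.
Proof. by rewrite mxE; apply: eq_bigr => i _; rewrite mxE. Qed.

Lemma norm0_sq u : norm0 u ^+ 2 = dot0 u u.
Proof.
rewrite sqr_sqrtr; last by apply: sumr_ge0 => i _; rewrite sqr_ge0.
by apply: eq_bigr => i _; rewrite expr2.
Qed.

Lemma dot0C u v : dot0 u v = dot0 v u.
Proof. by apply: eq_bigr => i _; rewrite mulrC. Qed.

Lemma dot0_linear a u v w : dot0 (a *: u + v) w = a * dot0 u w + dot0 v w.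
Proof.
by rewrite /dot0 mulr_sumr -big_split; apply: eq_bigr => i _ /=;
  rewrite !mxE mulrDl mulrA.
Qed.

Lemma dot0_ge0 u : 0 <= dot0 u u.
Proof. by apply: sumr_ge0 => i _; rewrite -expr2 sqr_ge0. Qed.

Lemma dot0_eq0 u : dot0 u u = 0 -> u = 0.
Proof.
move=> /eqP; rewrite psumr_eq0; last by move=> i _; rewrite -expr2 sqr_ge0.
move=> /allP u0; apply/matrixP => i j; rewrite ord1 mxE.
by have := u0 i (mem_index_enum _); rewrite -expr2 sqrf_eq0 => /eqP.
Qed.

(* A linear choice of the preimage orthogonal to the kernel. *)
Lemma mx_lift : exists B : 'M[R]_(n + n + 1), forall u, u \in mx_image ->
  A *m (B *m u) = u /\ (forall k, A *m k = 0 -> dot0 (B *m u) k = 0).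
Proof.
have kerE (x : 'rV[R]_(n + n + 1)) : x *m (A *m A^T) = 0 -> x *m A = 0.
  move=> x0; apply: trmx_inj; rewrite trmx0; apply: dot0_eq0.
  by rewrite dot0E trmxK trmx_mul !mulmxA -(mulmxA x) x0 mul0mx mxE.
have sub : (A^T <= A *m A^T)%MS.
  have sk : (kermx (A *m A^T) <= kermx A)%MS.
    apply/rV_subP => x /sub_kermxP/kerE x0; exact/sub_kermxP.
  have rk : (\rank A <= \rank (A *m A^T))%N.
    have := mxrankS sk; rewrite !mxrank_ker => h.
    have := rank_leq_row A; have := rank_leq_row (A *m A^T); lia.
  have rs : (A *m A^T <= A^T)%MS by exact: submxMl.
  have := mxrank_leqif_sup rs; rewrite mxrank_tr => h.
  by rewrite -(geq_leqif h).
have [P PE] : exists P : 'M[R]_(n + n + 1), A^T *m P *m (A *m A^T) = A^T.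
  by exists (pinvmx (A *m A^T)); rewrite mulmxKpV.
exists (A^T *m P^T) => u /mem_mx_image[v ->].
split.
  apply: trmx_inj; rewrite !trmx_mul !trmxK -[in RHS]PE.
  by rewrite !mulmxA.
by move=> k k0; rewrite dot0E !trmx_mul !trmxK -!mulmxA k0 !mulmx0 mxE.
Qed.

Lemma mx_norm_lift (B : 'M[R]_(n + n + 1)) u :
    A *m (B *m u) = u -> (forall k, A *m k = 0 -> dot0 (B *m u) k = 0) ->
  (forall v, u = A *m v -> norm0 (B *m u) <= norm0 v) /\
  mx_norm u = norm0 (B *m u).
Proof.
move=> ABu orth.
have minB v : u = A *m v -> norm0 (B *m u) <= norm0 v.
  move=> uv; rewrite -(@ler_pXn2r _ 2) // ?nnegrE ?sqrtr_ge0 // !norm0_sq.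
  have k0 : A *m (v - B *m u) = 0 by rewrite mulmxBr ABu -uv subrr.
  have -> : v = 1 *: (v - B *m u) + B *m u by rewrite scale1r subrK.
  move: (orth _ k0); move: (v - B *m u) => k; move: (B *m u) => b o.
  have kx x : dot0 (1 *: k + b) x = dot0 k x + dot0 b x.
    by rewrite dot0_linear mul1r.
  rewrite kx (dot0C k (_ + _)) kx (dot0C b (_ + _)) kx o (dot0C k b) o.
  have := dot0_ge0 k; lra.
split=> //; apply/eqP; rewrite eq_le; apply/andP; split.
  apply: ge_inf; last by exists (B *m u).
  by exists (norm0 (B *m u)) => _ [v /= uv <-]; exact: minB.
apply: lb_le_inf; first by exists (norm0 (B *m u)), (B *m u).
by move=> _ [v /= uv <-]; exact: minB.
Qed.

Lemma mx_norm_min u : u \in mx_image ->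
  exists2 v, u = A *m v & mx_norm u = norm0 v /\
    (forall w, u = A *m w -> norm0 v <= norm0 w).
Proof.
have [B hB] := mx_lift; move=> /hB[h1 h2].
by have [h3 h4] := mx_norm_lift h1 h2; exists (B *m u).
Qed.

Lemma mx_prod_lift : exists B : 'M[R]_(n + n + 1),
  (forall u, u \in mx_image -> A *m (B *m u) = u) /\
  {in mx_image &, forall u v, mx_prod u v = dot0 (B *m u) (B *m v)}.
Proof.
have [B hB] := mx_lift; exists B; split=> [u /hB[]//|u v uV vV].
have normE w : w \in mx_image -> mx_norm w ^+ 2 = dot0 (B *m w) (B *m w).
  by move=> /hB[h1 h2]; have [_ ->] := mx_norm_lift h1 h2; rewrite norm0_sq.
have -> : mx_prod u v = (dot0 (B *m (u + v)) (B *m (u + v))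
                        - dot0 (B *m (u - v)) (B *m (u - v))) / 4.
  by rewrite /mx_prod (normE _ (rpredD uV vV)) (normE _ (rpredB uV vV)).
rewrite mulmxDr mulmxBr.
rewrite /dot0 -sumrB mulr_suml; apply: eq_bigr => i _.
by rewrite !mxE; field.
Qed.

Lemma mx_prod_sym : {in mx_image &, forall u v, mx_prod u v = mx_prod v u}.
Proof.
have [B [_ hB]] := mx_prod_lift => u v uV vV.
by rewrite !hB // dot0C.
Qed.

Lemma mx_prod_linear (a : R) : {in mx_image & &, forall u v w,
  mx_prod (a *: u + v) w = a * mx_prod u w + mx_prod v w}.
Proof.
have [B [_ hB]] := mx_prod_lift => u v w uV vV wV.
have auV : a *: u + v \in mx_image by rewrite rpredD ?rpredZ.
by rewrite !hB // mulmxDr -scalemxAr dot0_linear.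
Qed.

Lemma mx_prod_pos : {in mx_image, forall u, u != 0 -> 0 < mx_prod u u}.
Proof.
have [B [h1 hB]] := mx_prod_lift => u uV u0.
rewrite hB // lt_neqAle dot0_ge0 andbT; apply: contra u0 => /eqP e.
by rewrite -(h1 u uV) (dot0_eq0 (esym e)) mulmx0.
Qed.

Definition metric_of : sr_metric :=
  SRMetric mx_prod_sym mx_prod_linear mx_prod_pos.

End MetricOfMatrix.

Definition abs_continuous (a b : R) (f : R -> R) : Prop :=
  forall e : R, 0 < e -> exists2 d : R, 0 < d &
    forall s : seq (R * R),
      all (fun p => [&& a <= p.1, p.1 <= p.2 & p.2 <= b]) s ->
      pairwise (fun p q => p.2 <= q.1) s ->
      \sum_(p <- s) (p.2 - p.1) < d ->
      \sum_(p <- s) `|f p.2 - f p.1| < e.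

Definition hcoset (G : set H) (h : H) : set H := [set hmul g h | g in G].
Definition hquotient (G : set H) : set (set H) := range (hcoset G).

(* c is an absolutely continuous path on [a, b] with c'(t) = dL_{c(t)} u(t)
   and u(t) in the subspace, for almost every t. *)
Definition horizontal (m : sr_metric) (a b : R) (c u : R -> H) : Prop :=
  (forall i, abs_continuous a b (fun t => c t i ord0)) /\
  {ae (@lebesgue_measure R), forall t, t \in `[a, b] ->
    u t \in sr_dist m /\
    forall i, is_derive (t : R) (1 : R) (fun s : R => c s i ord0)
                        (dleft (c t) (u t) i ord0)}.

(* The local charts of the quotient are the local sections of the projection,
   so a path on [0, 1] in the quotient is absolutely continuous and horizontal
   when it locally has a lift with this property.  Left invariant fields
   descend to the quotient: u(t) is the velocity in a left invariant frame. *)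
Definition quotient_horizontal (G : set H) (m : sr_metric)
    (c : R -> set H) (u : R -> H) : Prop :=
  forall t0 : R, 0 <= t0 <= 1 -> exists2 d : R, 0 < d &
    exists c' : R -> H,
      let a := Num.max 0 (t0 - d) in
      let b := Num.min 1 (t0 + d) in
      (forall t, a <= t <= b -> c t = hcoset G (c' t)) /\
      horizontal m a b c' u.

Definition path_length (m : sr_metric) (u : R -> H) : \bar R :=
  (\int[@lebesgue_measure R]_(t in `[0%R, 1%R]) (sr_norm m (u t))%:E)%E.

Definition quotient_dist (G : set H) (m : sr_metric) (x y : set H) : \bar R :=
  ereal_inf [set l | exists c u,
    [/\ quotient_horizontal G m c u, c 0 = x, c 1 = y & l = path_length m u]].

Definition isometric (G : set H) (m m' : sr_metric) : Prop :=
  exists f : set H -> set H, set_bij (hquotient G) (hquotient G) f /\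
    forall x y, hquotient G x -> hquotient G y ->
      quotient_dist G m' (f x) (f y) = quotient_dist G m x y.

Definition isometry_class (G : set H) (m : sr_metric) : set sr_metric :=
  [set m' | admissible m' /\ isometric G m m'].

Definition isometry_classes (G : set H) (P : set sr_metric) :
  set (set sr_metric) := [set isometry_class G m | m in P].

Definition in_D (r : 'I_n -> nat) : Prop :=
  (forall i, (0 < r i)%N) /\
  (forall i j : 'I_n, j = i.+1 :> nat -> (r i %| r j)%N).

Definition lattice_gens (r : 'I_n -> nat) : set H :=
  [set g | (exists i, g = (r i)%:R *: hX i) \/ (exists i, g = hY i) \/ g = hZ].

Definition lattice (r : 'I_n -> nat) : set H :=
  smallest is_subgroup (lattice_gens r).

Definition Jmx : 'M[R]_(n + n) := block_mx 0 1%:M (- 1%:M) 0.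

Definition diag_r (r : 'I_n -> nat) : 'M[R]_(n + n) :=
  diag_mx (row_mx (\row_i (r i)%:R) (const_mx 1)).

Definition G_r (r : 'I_n -> nat) : set 'M[R]_(n + n) :=
  [set diag_r r *m map_mx intr P *m invmx (diag_r r)
    | P in [set P : 'M[int]_(n + n) | P \in unitmx]].

(* S is in the extended symplectic group, with sign e. *)
Definition symplectic_sign (S : 'M[R]_(n + n)) (e : R) : Prop :=
  [/\ S \in unitmx, e = 1 \/ e = -1 & S^T *m Jmx *m S = e *: Jmx].

Definition pair_mx (A : 'M[R]_(n + n)) (rho : R) : 'M[R]_(n + n + 1) :=
  block_mx A 0 0 rho%:M.

Definition Pi_r (r : 'I_n -> nat) : set 'M[R]_(n + n + 1) :=
  [set M | exists S e, [/\ G_r r S, symplectic_sign S e & M = pair_mx S e]].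

Definition O_pm : set 'M[R]_(n + n + 1) :=
  [set M | exists Q e, [/\ Q^T *m Q = 1%:M, e = 1 \/ e = -1 & M = pair_mx Q e]].

(* The block matrices of GL_2n(R) x I, for I a set of real numbers. *)
Definition GL_times (I : set R) : set 'M[R]_(n + n + 1) :=
  [set M | exists A rho, [/\ A \in unitmx, I rho & M = pair_mx A rho]].

Definition dcoset (r : 'I_n -> nat) (M : 'M[R]_(n + n + 1)) :
    set 'M[R]_(n + n + 1) :=
  [set P *m M *m Q | P in Pi_r r & Q in O_pm].

Definition dcosets (r : 'I_n -> nat) (I : set R) :
  set (set 'M[R]_(n + n + 1)) := [set dcoset r M | M in GL_times I].

End Heisenberg.

Arguments lattice R {n} r.
Arguments dcosets {R n} r I.

(* Main.v *)
Require Import Defs.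
From HB Require Import structures.
From mathcomp Require Import all_boot all_order all_algebra.
From mathcomp Require Import all_classical all_reals all_analysis.
From mathcomp Require Import measurable_realfun zify ring lra.

Set Implicit Arguments.
Unset Strict Implicit.
Unset Printing Implicit Defensive.

Import Order.TTheory GRing.Theory Num.Theory.
Import numFieldNormedType.Exports.

Local Open Scope classical_set_scope.
Local Open Scope ring_scope.

(* An isometry of the quotients lifts to an isometry F of the group: along the
   dilations s |-> dil s h the lift is unique in short steps, because the lattice
   moves points by a distance bounded below.  F conjugates the lattice action to
   itself, and so induces an automorphism of the lattice, given on the horizontal
   part by an integral matrix S in the coordinates of diag(r) and on the center
   by a sign e; commutators show that S multiplies the symplectic form by e.
   The growth of distances along powers of a lattice element gives the norm of
   its horizontal part, so S is isometric for these norms and A' = S A Q with Q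
   orthogonal.  The square of the distance from 0 to k Z is
   kap^2 k - kap^4 rho^2 / 4 for k large, with kap independent of rho, and
   determines |rho|.
   Conversely, an element of Pi_r followed by an inner automorphism preserves the
   lattice and gives an isometry; and every admissible metric is brought to block
   form by a Cholesky factorization and an inner automorphism. *)

(** * Absolutely continuous functions *)

(** An isometry is here a mere bijection of cosets preserving an infimum in the extended reals:
    neither its smoothness nor the existence of minimizing curves is at hand. Distances are
    therefore handled through the open condition [reach]: some curve has a length majorant [l] that
    grows by less than [e]. Such a curve carries absolutely continuous primitives of its controls,
    so every length estimate reduces to one fact, that an absolutely continuous function with
    nonpositive derivative almost everywhere does not increase. Integrals and measurability matter
    only where [reach] is compared with [quotient_dist]. Nor is the lifted map F shown to be affine.
    After the lifting, its values at lattice points suffice: the linear growth of distances along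
    powers is insensitive to the base point F 0 and gives the norm on enough vectors to polarize.
    The constant kap belongs to rho = 0 and depends on A alone; so, once A' has been transported to
    A, distances of central elements compare rho with rho'. Coranks 0 and 1 are treated together:
    for rho = 0 the quotient z / rho is 0, and the vanishing of the vertical control is a separate
    clause. *)

Section AbsoluteContinuity.
Variable R : realType.
Implicit Types (f g : R -> R) (a b : R).
Local Notation mu := (@lebesgue_measure R).

(** Real induction: at the supremum of the points where P holds, the local step first reaches the
    supremum from the left and then passes beyond it. This is why the step straddles x. It replaces
    compactness in the gluing and subdivision arguments. *)
Lemma interval_induction (P : R -> Prop) a b : a <= b -> P a ->
  (forall x, a <= x <= b -> exists2 d, 0 < d & forall t t',
     a <= t -> t <= x -> x <= t' -> t' <= b -> x - d < t -> t' < x + d ->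
     P t -> P t') -> P b.
Proof.
move=> ab Pa loc; pose S := [set t | a <= t <= b /\ P t].
have Sa : S a by split=> //; rewrite lexx.
have hS : has_sup S.
  by split; [exists a | exists b => t [/andP[]]].
have ubS := sup_upper_bound hS.
have as_ : a <= sup S by exact: ubS.
have sb : sup S <= b by apply: ge_sup; [exists a | move=> t [/andP[]]].
have [d d0 dP] := loc (sup S) (introT andP (conj as_ sb)).
have [t [/andP[at_ tb] Pt] tsup] := sup_adherent d0 hS.
have ts : t <= sup S by apply: ubS; split=> //; rewrite at_.
have step t' : sup S <= t' -> t' <= b -> t' < sup S + d -> P t'.
  by move=> h1 h2 h3; apply: (dP t t').
have [sb'|] := ltP (sup S) b; last first.
  by move=> bs; apply: step => //; rewrite (le_lt_trans bs)// ltrDl.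
pose t' := Num.min b (sup S + d / 2).
have st' : sup S < t' by rewrite lt_min sb' ltrDl divr_gt0.
have : P t'.
  apply: step; [exact: ltW | by rewrite ge_min lexx |].
  rewrite gt_min; apply/orP; right; rewrite ltrD2l; lra.
move=> Pt'; have : t' <= sup S.
  apply: ubS; split=> //; rewrite (le_trans as_ (ltW st')) /=.
  by rewrite ge_min lexx.
by rewrite leNgt st'.
Qed.

Lemma ac_lip a b f (K : R) :
  (forall x y, a <= x -> x <= y -> y <= b -> `|f y - f x| <= K * (y - x)) ->
  abs_continuous a b f.
Proof.
move=> fK e e0; pose K' := `|K| + 1; have K0 : 0 < K' by rewrite ltr_wpDl.
exists (e / K'); first by rewrite divr_gt0.
move=> s sab _ sd; apply: (@le_lt_trans _ _ (\sum_(p <- s) K' * (p.2 - p.1))).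
  rewrite !big_seq; apply: ler_sum => p ps.
  have /and3P[h1 h2 h3] := allP sab _ ps.
  apply: (le_trans (fK _ _ h1 h2 h3)); rewrite ler_wpM2r ?subr_ge0//.
  by rewrite (le_trans (ler_norm K))// lerDl.
by rewrite -mulr_sumr mulrC -ltr_pdivlMr.
Qed.

Lemma ac_cst a b (k : R) : abs_continuous a b (fun=> k).
Proof. by apply: (@ac_lip _ _ _ 0) => x y *; rewrite subrr normr0 mul0r. Qed.

Lemma acD a b f g : abs_continuous a b f -> abs_continuous a b g ->
  abs_continuous a b (fun t => f t + g t).
Proof.
move=> hf hg e e0; have e20 : 0 < e / 2 by lra.
have [d1 d10 h1] := hf _ e20; have [d2 d20 h2] := hg _ e20.
exists (Num.min d1 d2); first by rewrite lt_min d10.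
move=> s sab sp; rewrite lt_min => /andP[l1 l2].
have := h1 _ sab sp l1; have := h2 _ sab sp l2 => l3 l4.
apply: (@le_lt_trans _ _ (\sum_(p <- s) `|f p.2 - f p.1| +
                          \sum_(p <- s) `|g p.2 - g p.1|)); last by lra.
rewrite -big_split /=; apply: ler_sum => p _.
by rewrite opprD addrACA ler_normD.
Qed.

Lemma acZ a b (k : R) f : abs_continuous a b f ->
  abs_continuous a b (fun t => k * f t).
Proof.
move=> hf e e0; pose K := `|k| + 1; have K0 : 0 < K by rewrite ltr_wpDl.
have eK : 0 < e / K by rewrite divr_gt0.
have [d d0 h] := hf _ eK; exists d => // s sab sp sd.
have := h _ sab sp sd; rewrite ltr_pdivlMr// => l.
apply: le_lt_trans l; rewrite mulr_suml; apply: ler_sum => p _.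
by rewrite -mulrBr normrM mulrC ler_wpM2l// /K lerDl.
Qed.

Lemma acN a b f : abs_continuous a b f -> abs_continuous a b (fun t => - f t).
Proof.
move=> /(acZ (-1)); congr abs_continuous.
by apply/funext => t; rewrite mulN1r.
Qed.

Lemma acB a b f g : abs_continuous a b f -> abs_continuous a b g ->
  abs_continuous a b (fun t => f t - g t).
Proof. by move=> hf hg; apply: acD => //; apply: acN. Qed.

Lemma ac_sum (I : Type) (r : seq I) a b (F : I -> R -> R) :
  (forall i, abs_continuous a b (F i)) ->
  abs_continuous a b (fun t => \sum_(i <- r) F i t).
Proof.
move=> hF; elim: r => [|i r IH].
  rewrite (_ : (fun _ => _) = fun=> 0); first exact: ac_cst.
  by apply/funext => t; rewrite big_nil.
rewrite (_ : (fun _ => _) = fun t => F i t + \sum_(j <- r) F j t).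
  exact: acD.
by apply/funext => t; rewrite big_cons.
Qed.

Lemma ac_eq a b f g : (forall t, a <= t <= b -> f t = g t) ->
  abs_continuous a b f -> abs_continuous a b g.
Proof.
move=> fg hf e e0; have [d d0 h] := hf _ e0; exists d => // s sab sp sd.
apply: le_lt_trans (h _ sab sp sd); rewrite !big_seq; apply: ler_sum => p ps.
have /and3P[h1 h2 h3] := allP sab _ ps.
by rewrite !fg // ?(le_trans h1 h2) ?(le_trans h2 h3) ?h1 ?h3.
Qed.

Lemma ac_comp a b a' b' f (phi : R -> R) (K : R) :
  (forall x y, a <= x -> x <= y -> y <= b ->
     [/\ a' <= phi x, phi x <= phi y, phi y <= b' &
         phi y - phi x <= K * (y - x)]) ->
  abs_continuous a' b' f -> abs_continuous a b (f \o phi).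
Proof.
move=> hphi hf e e0; have [d d0 h] := hf _ e0.
pose K' := `|K| + 1; have K0 : 0 < K' by rewrite ltr_wpDl.
exists (d / K'); first by rewrite divr_gt0.
move=> s sab sp sd.
have ha p : p \in s -> [/\ a' <= phi p.1, phi p.1 <= phi p.2, phi p.2 <= b' &
         phi p.2 - phi p.1 <= K * (p.2 - p.1)].
  by move=> ps; have /and3P[h1 h2 h3] := allP sab _ ps; exact: hphi.
have := h [seq (phi p.1, phi p.2) | p <- s].
rewrite !big_map /=; apply.
- by apply/allP => _ /mapP[p ps ->]/=; have [-> -> ->] := ha _ ps.
- have sa : all (fun p => p \in s) s by exact/allP.
  rewrite pairwise_map; apply: sub_in_pairwise sa sp => p q ps qs /= pq.
  have /and3P[h1 h2 h3] := allP sab _ ps.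
  have /and3P[h4 h5 h6] := allP sab _ qs.
  by have [] := hphi _ _ (le_trans h1 h2) pq (le_trans h5 h6).
- apply: (@le_lt_trans _ _ (\sum_(p <- s) K' * (p.2 - p.1))); last first.
    by rewrite -mulr_sumr mulrC -ltr_pdivlMr.
  rewrite !big_seq; apply: ler_sum => p ps.
  have [_ _ _ /le_trans->//] := ha _ ps.
  have /and3P[h1 h2 h3] := allP sab _ ps.
  by rewrite ler_wpM2r ?subr_ge0// (le_trans (ler_norm K))// lerDl.
Qed.

Lemma ac_sub a b a' b' f : a' <= a -> b <= b' ->
  abs_continuous a' b' f -> abs_continuous a b f.
Proof.
move=> aa bb; apply: (@ac_comp _ _ _ _ f id 1) => x y ax xy yb.
by split; [exact: le_trans ax | | exact: le_trans bb | rewrite mul1r].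
Qed.

Lemma ac_opp a b f : abs_continuous (- b) (- a) f ->
  abs_continuous a b (fun t => f (- t)).
Proof.
move=> hf e e0; have [d d0 h] := hf _ e0; exists d => // s sab sp sd.
have := h (rev [seq (- p.2, - p.1) | p <- s]); rewrite -map_rev !big_map /=.
have pr : perm_eq (rev s) s by rewrite perm_rev.
rewrite !(perm_big s pr) /= => hs.
rewrite (eq_bigr (fun p => `|f (- p.1) - f (- p.2)|)); last first.
  by move=> p _; rewrite distrC.
apply: hs.
- apply/allP => z /mapP[p]; rewrite mem_rev => ps -> /=.
  by have /and3P[h1 h2 h3] := allP sab _ ps; rewrite !lerN2 h1 h2 h3.
- rewrite pairwise_map; elim: s sp {h sab sd pr} => //= p s IH /andP[ps sp].
  rewrite rev_cons pairwise_rcons IH// andbT all_rev.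
  by apply/allP => q qs /=; rewrite lerN2; exact: (allP ps).
- by rewrite (eq_bigr (fun p => p.2 - p.1))// => p _; rewrite opprK addrC.
Qed.

Lemma ac_concat a m b f g : a <= m -> m <= b -> f m = g m ->
  abs_continuous a m f -> abs_continuous m b g ->
  abs_continuous a b (fun t => if t <= m then f t else g t).
Proof.
move=> am mb fg hf hg.
(* The glued function is the sum of both pieces with their argument clamped at m, minus the common
   value there. *)
have h : abs_continuous a b
  (fun t => (f \o Num.min m) t + ((g \o Num.max m) t + (- f m))).
  apply: acD; last apply: acD; last exact: ac_cst.
    apply: (@ac_comp _ _ _ _ f _ 1 _ hf) => x y ax xy yb; rewrite mul1r.
    by case: (leP m x) => ?; case: (leP m y) => ?; split; lra.
  apply: (@ac_comp _ _ _ _ g _ 1 _ hg) => x y ax xy yb; rewrite mul1r.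
  by case: (leP m x) => ?; case: (leP m y) => ?; split; lra.
apply: ac_eq h => t _ /=; case: (leP t m) => tm; rewrite ?fg; ring.
Qed.

Lemma ac_cont a b f : abs_continuous a b f -> forall x, a <= x <= b ->
  forall e, 0 < e -> exists2 d, 0 < d & forall y, a <= y <= b ->
    `|x - y| < d -> `|f x - f y| < e.
Proof.
move=> hf x /andP[ax xb] e /hf [d d0 h]; exists d => // y /andP[ay yb] xy.
have [yx|yx] := leP y x.
  have := h [:: (y, x)]; rewrite !big_seq1 /= ay yx xb; apply=> //.
  by rewrite (le_lt_trans (ler_norm _)).
have := h [:: (x, y)]; rewrite !big_seq1 /= ax (ltW yx) yb distrC; apply=> //.
by rewrite distrC in xy; rewrite (le_lt_trans (ler_norm _)).
Qed.

Lemma is_derive_eps f (x f' : R) : is_derive x (1 : R) f f' ->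
  forall e, 0 < e -> exists2 d, 0 < d & forall y, `|y - x| < d ->
    `|f y - f x - f' * (y - x)| <= e * `|y - x|.
Proof.
move=> [df Df] e e0; move: df; rewrite /derivable => /cvg_ex[l fl].
have lf' : l = f' by rewrite -Df; apply/esym/cvg_lim.
move: fl; rewrite {}lf' => /cvgrPdist_le /(_ _ e0); rewrite near_withinE.
move=> -[d /= d0 dP]; exists d => // y yx.
have [->|ynx] := eqVneq y x; first by rewrite !subrr mulr0 subr0 normr0 mulr0.
have y0 : y - x != 0 by rewrite subr_eq0.
have := dP (y - x); rewrite /ball /= sub0r normrN => /(_ yx y0).
rewrite scaler1 subrK => h.
have -> : f y - f x - f' * (y - x) =
  - (y - x) * (f' - (y - x)^-1 *: (f y - f x)).
  by rewrite /GRing.scale /=; field.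
by rewrite normrM normrN mulrC ler_wpM2r.
Qed.

(** Induction from the last interval: the half line is cut at its left end x, and replacing it by
    the half-open []x, y]] keeps the pieces disjoint even when consecutive intervals touch. *)
Lemma sum_itv_le_measure (O : set R) (s : seq (R * R)) (c : R) : open O ->
  all (fun p => p.1 <= p.2) s -> pairwise (fun p q => p.2 <= q.1) s ->
  (forall p, p \in s -> `[p.1, p.2] `<=` O) ->
  (forall p, p \in s -> p.2 <= c) ->
  ((\sum_(p <- s) (p.2 - p.1))%:E <= mu (O `&` `]-oo, c]))%E.
Proof.
move=> oO; elim/last_ind: s c => [|s [x y] IH] c.
  by rewrite big_nil => *; exact: measure_ge0.
rewrite all_rcons pairwise_rcons /= => /andP[xy sle] /andP[sx sp] sO sc.
rewrite -cats1 big_cat big_seq1 /= EFinD.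
have mO : measurable O by exact: open_measurable.
apply: (@le_trans _ _ (mu (O `&` `]-oo, x]) + mu `]x, y])%E).
  apply: leeD; last by rewrite lebesgue_measure_itv /= lte_fin; case: ltP;
    rewrite ?EFinB// lee_fin; lra.
  apply: IH => // p ps; first by apply: sO; rewrite mem_rcons inE ps orbT.
  exact: (allP sx).
rewrite -measureU//; last 2 first.
- exact: measurableI.
- rewrite -subset0 => z [[_ /=]]; rewrite ?in_itv /= => zx /andP[]; lra.
apply: le_measure; rewrite ?inE.
- by apply: measurableU => //; exact: measurableI.
- exact: measurableI.
have yc : y <= c by have := sc (x, y); rewrite mem_rcons inE eqxx => /(_ isT).
move=> z [[Oz]|] /=; rewrite ?in_itv /=.
  by move=> zx; split=> //=; rewrite ?in_itv /=; lra.
move=> /andP[xz zy]; split; last by rewrite ?in_itv /=; lra.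
by apply: (sO (x, y)); rewrite ?mem_rcons ?inE ?eqxx//= in_itv /= zy ltW.
Qed.

(* Off a null set the derivative controls increments, and the intervals that
   meet the null set lie in an open set of small measure, where absolute
   continuity bounds the total variation. *)
Lemma ac_nonincreasing a b f : abs_continuous a b f -> a <= b ->
  {ae mu, forall t, t \in `[a, b] ->
     exists2 f' : R, is_derive t (1 : R) f f' & f' <= 0} ->
  f b <= f a.
Proof.
move=> acf ab [N [mN N0 Nsub]].
suff key e : 0 < e -> f b - f a <= e * (b - a) + e.
  rewrite leNgt; apply/negP => fab; pose e := (f b - f a) / (2 * (b - a + 1)).
  have e0 : 0 < e by rewrite divr_gt0; lra.
  have := key _ e0; have : e * (b - a + 1) = (f b - f a) / 2.
    by rewrite /e; field; lra.
  by rewrite mulrDr mulr1; lra.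
move=> e0; have [d d0 dP] := acf _ e0.
have Nfin : (@lebesgue_measure R N < +oo)%E by rewrite N0 ltry.
have [U [oU NU Ud]] := lebesgue_regularity_outer mN Nfin d0.
have muU : (mu U < d%:E)%E.
  apply: le_lt_trans Ud; rewrite -{1}(setDUK NU).
  apply: (le_trans (measureU2 _ _ _)) => //.
    by apply: measurableD => //; exact: open_measurable.
  by rewrite [X in (X + _)%E](_ : _ = 0%E) ?add0e.
(* The invariant allows growth at rate e, except on finitely many intervals inside U; their total
   variation is estimated only once, at t = b. *)
pose P t := exists s : seq (R * R),
  [/\ all (fun p => [&& a <= p.1, p.1 <= p.2 & p.2 <= t]) s,
      pairwise (fun p q => p.2 <= q.1) s,
      (forall p, p \in s -> `[p.1, p.2] `<=` U) &
      f t - f a <= e * (t - a) + \sum_(p <- s) `|f p.2 - f p.1|].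
suff [s [s1 s2 s3 s4]] : P b.
  apply: (le_trans s4); rewrite lerD2l; apply/ltW/dP => //.
  rewrite -lte_fin; apply: le_lt_trans muU.
  apply: (le_trans (@sum_itv_le_measure U s b oU _ s2 s3 _)).
  - by apply/allP => p /(allP s1)/and3P[].
  - by move=> p /(allP s1)/and3P[].
  by apply: le_measure; rewrite ?inE//;
    [apply: measurableI => //|]; exact: open_measurable.
apply: (interval_induction ab).
  by exists [::]; split=> //; rewrite big_nil !subrr mulr0 addr0.
move=> x /andP[ax xb]; have [xU|xnU] := pselect (U x).
  move: oU; rewrite openE => /(_ _ xU)[/= r r0 rU].
  exists r => // t t' at_ tx xt' t'b xrt t'xr [s [s1 s2 s3 s4]].
  exists (rcons s (t, t')); split.
  - rewrite all_rcons /= at_ (le_trans tx xt') lexx /=.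
    by apply: sub_all s1 => p /and3P[-> ->/=]; lra.
  - rewrite pairwise_rcons s2 andbT /=.
    by apply: sub_all s1 => p /and3P[].
  - move=> p; rewrite mem_rcons inE => /orP[/eqP->/=|/s3//].
    move=> z /=; rewrite in_itv /= => /andP[tz zt']; apply: rU.
    by rewrite /ball /= ltr_distlC; lra.
  - rewrite -cats1 big_cat big_seq1 /=.
    have := ler_norm (f t' - f t).
    have : e * (t - a) <= e * (t' - a) by rewrite ler_wpM2l; lra.
    by move: s4; lra.
have [f' dx f'0] : exists2 f' : R, is_derive x (1 : R) f f' & f' <= 0.
  have : ~ N x by move=> /NU.
  move=> Nx; have : ~ ~ (x \in `[a, b] ->
     exists2 f' : R, is_derive x (1 : R) f f' & f' <= 0) by move=> /Nsub.
  by move=> /contrapT; apply; rewrite in_itv /= ax.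
have [r r0 rP] := is_derive_eps dx e0; exists r => //.
move=> t t' at_ tx xt' t'b xrt t'xr [s [s1 s2 s3 s4]].
exists s; split=> //.
  by apply: sub_all s1 => p /and3P[-> ->/=]; lra.
apply: le_trans (_ : e * (t' - a) - e * (t - a) + (f t - f a) <= _); last first.
  by move: s4; lra.
have h1 : f t' - f x <= e * (t' - x).
  have := rP t'; rewrite ger0_norm ?subr_ge0// => /(_ ltac:(lra)).
  rewrite ler_norml => /andP[_].
  have : f' * (t' - x) <= 0 by rewrite mulr_le0_ge0// subr_ge0.
  lra.
have h2 : f x - f t <= e * (x - t).
  have := rP t; rewrite distrC ger0_norm ?subr_ge0// => /(_ ltac:(lra)).
  rewrite ler_norml => /andP[+ _].
  have : 0 <= f' * (t - x) by rewrite mulr_le0// subr_le0.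
  lra.
by move: h1 h2; rewrite -mulrBr; lra.
Qed.

End AbsoluteContinuity.

(** * Primitives and integral bounds *)

Section Primitives.
Import HBNNSimple.
Variable R : realType.
Implicit Types (f g : R -> R) (a b : R).
Local Notation mu := (@lebesgue_measure R).

Lemma ae_imp (P Q : R -> Prop) : (forall t, P t -> Q t) ->
  {ae mu, forall t, P t} -> {ae mu, forall t, Q t}.
Proof.
move=> PQ; apply: filterS; first exact: (ae_filter_ringOfSetsType mu).
exact: PQ.
Qed.

Lemma ae_and (P Q : R -> Prop) : {ae mu, forall t, P t} ->
  {ae mu, forall t, Q t} -> {ae mu, forall t, P t /\ Q t}.
Proof. by apply: filterI; exact: (ae_filter_ringOfSetsType mu). Qed.

Lemma ae_neq (x : R) : {ae mu, forall t, t != x}.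
Proof.
exists [set x]; split; [exact: measurable_set1 | exact: lebesgue_measure_set1 |].
by move=> t /= /negP; rewrite negbK => /eqP.
Qed.

(** For be > 0, be times the pushforward of Lebesgue measure under the affine map agrees with
    Lebesgue measure on half-open intervals, hence on all measurable sets. A reflection reduces be <
    0 to this case. *)
Lemma preimage_affine_null (N : set R) (al be : R) : be != 0 ->
  measurable N -> mu N = 0%E ->
  exists N', [/\ measurable N', mu N' = 0%E & (fun t => al + be * t) @^-1` N `<=` N'].
Proof.
move=> be0 mN N0.
wlog bep : N al be be0 mN N0 / 0 < be.
  move=> H; have [|bn] := ltP 0 be; first exact: H.
  have bnp : 0 < - be by rewrite oppr_gt0 lt_neqAle be0.
  have mN' : measurable (-%R @^-1` N : set R).
    by rewrite -[X in measurable X]setTI; exact: (@oppr_measurable R setT).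
  have N'0 : mu (-%R @^-1` N) = 0%E.
    by rewrite -[LHS](lebesgue_measureN mN) in N0 *; exact: N0.
  have [M [mM M0 NM]] := H (-%R @^-1` N) (- al) (- be) (lt0r_neq0 bnp) mN' N'0 bnp.
  exists M; split=> // t /= Nt; apply: NM => /=.
  by rewrite mulNr -opprD opprK.
pose phi : measurableTypeR R -> measurableTypeR R := fun t => al + be * (t : R).
have mphi : measurable_fun [set: measurableTypeR R] phi.
  by apply: measurable_funD => //; exact: mulrl_measurable.
pose pm0 := [the {measure set (measurableTypeR R) -> \bar R} of pushforward mu phi].
have : mu N = mscale (NngNum (ltW bep)) (pm0 mphi) N.
  apply: lebesgue_measure_unique => //= _ [[x y] /= xy <-].
  rewrite /mscale /pushforward /=.
  have pE : phi @^-1` `]x, y]%classic = `](x - al) / be, (y - al) / be]%classic.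
    apply/seteqP; split => t /=;
      rewrite !in_itv /= /phi ltr_pdivrMr// ler_pdivlMr//; lra.
  transitivity (be%:E * mu `]((x - al) / be)%R, ((y - al) / be)%R]%classic)%E; last first.
    by rewrite -pE.
  rewrite !lebesgue_measure_itv /= !lte_fin ltr_pM2r ?invr_gt0// ltrD2r.
  case: ifP => _; last by rewrite mule0.
  by rewrite -!EFinD -EFinM; congr (_%:E); field.
rewrite N0 /mscale /= => /esym/eqP.
rewrite mule_eq0 => /orP[/eqP[] b0|/eqP h]; first by rewrite b0 eqxx in be0.
exists (phi @^-1` N); split=> //.
by rewrite -[X in measurable X]setTI; exact: mphi.
Qed.

Lemma ae_affine (P : R -> Prop) (al be : R) : be != 0 ->
  {ae mu, forall t, P t} -> {ae mu, forall t, P (al + be * t)}.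
Proof.
move=> be0 [N [mN N0 NP]].
have [N' [mN' N'0 NN']] := preimage_affine_null al be0 mN N0.
by exists N'; split=> // t h; apply: NN'; exact: NP.
Qed.

Lemma primitive_exists f : mu.-integrable setT (EFin \o f) -> exists F,
  [/\ forall a b, abs_continuous a b F,
      {ae mu, forall t : R, is_derive t (1 : R) F (f t)} &
      forall a b, a <= b -> F b - F a = (\int[mu]_(t in `]a, b]) f t)%R].
Proof.
move=> intf; pose F x := (\int[mu]_(t in `]-oo, x]) f t)%R.
have intS A : measurable A -> mu.-integrable A (EFin \o f).
  by move=> mA; exact: integrableS intf.
have FB a b : a <= b -> F b - F a = (\int[mu]_(t in `]a, b]) f t)%R.
  by move=> ab; rewrite /F Rintegral_itvB//; exact: intS.
exists F; split=> //; last first.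
  have locf : locally_integrable setT f.
    by apply: open_integrable_locally => //; exact: openT.
  have := FTC1Ny (fun y => intS _ (measurable_itv `]-oo, y])) locf.
  apply: ae_imp => x /= [dF Ff]; rewrite -Ff derive1E; exact: derivableP.
move=> a b e e0; have [d [d0 dP]] := integral_normr_continuous intf e0.
exists d => // s sab sp sd.
(* A is the union of the half-open intervals. The clause on c keeps the part already built to the
   right of the next interval, which gives disjointness in the induction. *)
have [A [mA muA _ sA]] : exists A : set R, [/\ measurable A,
    (mu A <= (\sum_(p <- s) (p.2 - p.1))%:E)%E,
    (forall c, (forall p, p \in s -> c <= p.1) -> A `<=` `]c, +oo[) &
    \sum_(p <- s) `|F p.2 - F p.1| <= (\int[mu]_(t in A) `|f t|)%R].
  elim: s sab sp {sd} => [_ _|[x y] s IH /= /andP[/and3P[_ xy _] sab] /andP[sx sp]].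
    by exists set0; split; rewrite ?big_nil ?measure0 ?Rintegral_set0// => c _; exact: sub0set.
  have [A [mA muA Ac sA]] := IH sab sp.
  have yA : A `<=` `]y, +oo[ by apply: Ac => p /(allP sx).
  exists (`]x, y] `|` A); split.
  - exact: measurableU.
  - rewrite big_cons /= EFinD; apply: (le_trans (measureU2 _ _ _)) => //.
    have mxy : (mu `]x, y]%classic <= (y - x)%:E)%E.
      rewrite lebesgue_measure_itv /= lte_fin.
      by case: ltP; rewrite ?EFinB// lee_fin; lra.
    exact: leeD mxy muA.
  - move=> c cs t []; last first.
      by apply: Ac => p ps; apply: cs; rewrite inE ps orbT.
    have := cs (x, y); rewrite inE eqxx => /(_ isT) /= cx.
    by rewrite /= !in_itv /=; lra.
  - rewrite big_cons /= Rintegral_setU//.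
    + apply: lerD => //; rewrite FB//; apply: le_normr_Rintegral => //.
      exact: intS.
    + by apply: integrable_norm; apply: intS; exact: measurableU.
    + apply/disj_set2P; rewrite -subset0 => t [/= + /yA].
      by rewrite /= !in_itv /=; lra.
apply: (le_lt_trans sA); apply: dP => //.
by apply: (le_lt_trans muA); rewrite lte_fin.
Qed.

(** The integral of the possibly nonmeasurable f is the supremum of the integrals of simple
    functions h below it. Each such h has a primitive H, and H - g has derivative h - g' <= 0 almost
    everywhere, so it does not increase. *)
Lemma integral_le_ac a b f g : a <= b -> (forall t, 0 <= f t) ->
  abs_continuous a b g ->
  {ae mu, forall t, t \in `[a, b] ->
     exists2 g' : R, is_derive t (1 : R) g g' & f t <= g'} ->
  (\int[mu]_(t in `[a, b]) (f t)%:E <= (g b - g a)%:E)%E.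
Proof.
move=> ab f0 acg aeg.
rewrite ge0_integralE; last by move=> t _; rewrite lee_fin.
apply: ge_ereal_sup => _ [h /= hf <-].
have h0 t : ~ t \in `[a, b] -> h t = 0.
  move=> tab; apply/eqP; rewrite eq_le fun_ge0 andbT -lee_fin.
  by apply: (le_trans (hf t)); rewrite patchE ifF//; apply/negP; rewrite inE.
have hle t : t \in `[a, b] -> h t <= f t.
  by move=> tab; rewrite -lee_fin; apply: (le_trans (hf t)); rewrite patchE ifT// inE.
have inth : mu.-integrable setT (EFin \o h).
  have -> : EFin \o h = (EFin \o h) \_ `[a, b].
    apply/funext => t; rewrite patchE; case: ifPn => // tab /=.
    by rewrite h0//; move/negP: tab; rewrite inE.
  rewrite -integrable_mkcond//.
  apply: measurable_bounded_integrable => //.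
  - by rewrite /= lebesgue_measure_itv /=; case: ifP => _; rewrite ?ltry// -EFinB ltry.
  - exact: measurable_funTS.
  - have [M [Mr hM]] := simple_bounded h; exists M; split=> // x Mx t _.
    exact: hM.
have [H [acH aeH HB]] := primitive_exists inth.
have : H b - g b <= H a - g a.
  apply: (ac_nonincreasing (acB (acH a b) acg) ab).
  apply: ae_imp (ae_and aeH aeg) => t [Ht gt] tab.
  have [g' gg' fg'] := gt tab; exists (h t - g'); last first.
    by rewrite subr_le0; apply: le_trans fg'; exact: hle.
  exact: is_deriveB.
rewrite -integralT_nnsfun.
have -> : (\int[mu]_x (h x)%:E = (H b - H a)%:E)%E.
  rewrite HB// Rintegral_itv_obnd_cbnd; last exact: integrableS inth.
  rewrite /Rintegral fineK; last first.
    by apply: integrable_fin_num => //; exact: integrableS inth.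
  rewrite [RHS]integral_mkcond; apply: eq_integral => t _.
  rewrite patchE; case: ifPn => // tab; rewrite h0//.
  by move/negP: tab; rewrite inE.
by move=> ?; rewrite lee_fin; lra.
Qed.

End Primitives.

Section MeasurableDerivative.
Variable R : realType.
Implicit Types (f g : R -> R) (a b : R).
Local Notation mu := (@lebesgue_measure R).

(** A comparison of suprema over simple functions, so that it applies to the arbitrary controls in
    [path_length]. *)
Lemma le_integral_ge0 (D : set R) (f g : R -> \bar R) :
  (forall t, D t -> 0 <= f t)%E -> (forall t, D t -> f t <= g t)%E ->
  (\int[mu]_(t in D) f t <= \int[mu]_(t in D) g t)%E.
Proof.
move=> f0 fg; rewrite !ge0_integralE//; last first.
  by move=> t Dt; apply: le_trans (f0 _ Dt) (fg _ Dt).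
apply: ge_ereal_sup => _ [h /= hf <-]; apply: ereal_sup_ubound; exists h => //= t.
apply: (le_trans (hf t)); rewrite !patchE; case: ifPn => // tD.
by apply: fg; rewrite inE in tD.
Qed.

Lemma ac_clamp_continuous a b f : a <= b -> abs_continuous a b f ->
  continuous (fun t => f (Num.max a (Num.min t b))).
Proof.
move=> ab acf x; apply/cvgrPdist_lt => e e0.
have cl t : a <= Num.max a (Num.min t b) <= b.
  by case: (leP t b) => ?; case: (leP a t) => ?; case: (leP a b) => ?; lra.
have [d d0 dP] := ac_cont acf (cl x) e0.
near=> y; apply: dP => //; apply: (@le_lt_trans _ _ `|x - y|).
  have := ler_norm (x - y); have := ler_norm (y - x); rewrite (distrC y x).
  move: `|x - y| => D h1 h2; rewrite ler_norml.
  by case: (leP x b) => ?; case: (leP y b) => ?; case: (leP a x) => ?;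
    case: (leP a y) => ?; case: (leP a b) => ?; lra.
near: y; exists d => //= y; rewrite /ball /=.
Unshelve. all: by end_near. Qed.

(** On E the derivative is the limit of difference quotients with step 1 / (k + 1). The function is
    clamped to [a, b] to be continuous on the whole line; since E lies in the open interval, the
    clamping has no effect at t + 1 / (k + 1) for k large. *)
Lemma measurable_derivative a b f f' (E : set R) : abs_continuous a b f ->
  measurable E -> E `<=` `]a, b[ ->
  (forall t, E t -> is_derive t (1 : R) f (f' t)) ->
  measurable_fun [set: R] (f' \_ E).
Proof.
move=> acf mE Eab df.
have [ba|ab] := leP b a.
  have -> : f' \_ E = cst 0.
    apply/funext => t; rewrite patchE; case: ifPn => //; rewrite inE => /Eab /=.
    by rewrite in_itv /=; lra.
  exact: measurable_cst.
pose F t := f (Num.max a (Num.min t b)).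
have mF : measurable_fun [set: R] F.
  by apply: continuous_measurable_fun; apply: ac_clamp_continuous (ltW ab) acf.
pose g (k : nat) t := k.+1%:R * (F (t + k.+1%:R^-1) - F t) * \1_E t.
apply: (@measurable_fun_cvg _ _ _ _ g) => //.
  move=> k; apply: measurable_funM; last exact: measurable_indic.
  apply: measurable_funM => //; apply: measurable_funB => //.
  apply: measurableT_comp => //.
  exact: measurable_funD.
move=> t _; rewrite patchE; case: ifPn => tE; last first.
  rewrite /g; under eq_fun do rewrite indicE (negbTE tE) mulr0.
  exact: cvg_cst.
rewrite inE in tE; have /= := Eab _ tE; rewrite in_itv /= => /andP[at_ tb].
apply/cvgrPdist_le => e e0; have [d d0 dP] := is_derive_eps (df _ tE) e0.
near=> k; rewrite /g indicE mem_set// mulr1.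
have k0 : 0 < k.+1%:R^-1 :> R by rewrite invr_gt0.
have kd : k.+1%:R^-1 < Num.min d (b - t).
  by near: k; apply: (near_infty_natSinv_lt (PosNum _)); rewrite lt_min d0 subr_gt0.
move: kd; rewrite lt_min => /andP[kd kb].
have := dP (t + k.+1%:R^-1); rewrite addrC addKr gtr0_norm// addrC => /(_ kd).
have Ft s : a < s < b -> F s = f s.
  by move=> /andP[as_ sb]; rewrite /F min_l ?max_r//; apply: ltW.
have -> : F t = f t by apply: Ft; rewrite at_.
have -> : F (t + k.+1%:R^-1) = f (t + k.+1%:R^-1).
  by apply: Ft; move: k0 kb; move: (k.+1%:R^-1) => q *; lra.
move=> h.
have kn0 : k.+1%:R != 0 :> R by rewrite pnatr_eq0.
have -> : f' t - k.+1%:R * (f (t + k.+1%:R^-1) - f t) =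
  - k.+1%:R * (f (t + k.+1%:R^-1) - f t - f' t * k.+1%:R^-1) by field.
rewrite normrM normrN normr_nat [leLHS]mulrC -ler_pdivlMr// addrC.
Unshelve. all: by end_near. Qed.

End MeasurableDerivative.

(** * The Heisenberg group *)

Section HeisenbergAlgebra.
Variables (R : realType) (n : nat).
Local Notation H := (heis R n).
Local Notation V := ('cV[R]_(n + n)).
Implicit Types (g h k u : H) (v w : V) (z : R).

Definition hp h : V := usubmx h.
Definition zp h : R := h (iZ n) ord0.
Definition hmk v z : H := col_mx v z%:M.
(** The standard symplectic form, with matrix [Jmx]; the bracket is omega times Z. *)
Definition omega v w : R :=
  \sum_(i < n) (v (lshift n i) ord0 * w (rshift n i) ord0
                - v (rshift n i) ord0 * w (lshift n i) ord0).

Lemma hpE h j : hp h j ord0 = h (lshift 1 j) ord0. Proof. by rewrite mxE. Qed.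
Lemma hpK v z : hp (hmk v z) = v. Proof. exact: col_mxKu. Qed.
Lemma zpK v z : zp (hmk v z) = z.
Proof. by rewrite /zp /hmk /iZ col_mxEd mxE eqxx. Qed.
Lemma hmkK h : hmk (hp h) (zp h) = h.
Proof.
rewrite -[RHS]vsubmxK /hmk; congr col_mx; apply/matrixP => i j.
by rewrite !ord1 /zp !mxE eqxx.
Qed.

Lemma heisP g h : hp g = hp h -> zp g = zp h -> g = h.
Proof. by move=> e1 e2; rewrite -(hmkK g) -(hmkK h) e1 e2. Qed.

Lemma hp_is_linear : linear hp. Proof. exact: linearP. Qed.
HB.instance Definition _ := GRing.isLinear.Build R H V _ hp hp_is_linear.
Lemma zp_is_linear : linear_for *%R zp.
Proof. by move=> a g h; rewrite /zp !mxE. Qed.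
HB.instance Definition _ := GRing.isLinear.Build R H R _ zp zp_is_linear.

Lemma hp_hZ : hp (hZ R n) = 0.
Proof.
apply/matrixP => i j; rewrite ord1 hpE !mxE andbT.
by case: eqP => // /eqP; rewrite /iZ eq_lrshift.
Qed.

Lemma zp_hZ : zp (hZ R n) = 1.
Proof. by rewrite /zp /hZ mxE !eqxx. Qed.

Lemma bracketE g h : bracket g h = omega (hp g) (hp h) *: hZ R n.
Proof. by congr (_ *: _); apply: eq_bigr => i _; rewrite !hpE. Qed.

Lemma omega_antisym v w : omega v w = - omega w v.
Proof. by rewrite /omega -sumrN; apply: eq_bigr => i _; ring. Qed.

Lemma omega_linear w : linear_for *%R (omega ^~ w).
Proof.
move=> a v1 v2; rewrite /omega mulr_sumr -big_split; apply: eq_bigr => i _ /=.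
by rewrite !mxE; ring.
Qed.

Lemma omegaDl v1 v2 w : omega (v1 + v2) w = omega v1 w + omega v2 w.
Proof. by have := omega_linear w 1 v1 v2; rewrite /= scale1r mul1r. Qed.
Lemma omega0l w : omega 0 w = 0.
Proof. by rewrite /omega big1// => i _; rewrite !mxE; ring. Qed.
Lemma omegaZl a v w : omega (a *: v) w = a * omega v w.
Proof. by have := omega_linear w a v 0; rewrite /= addr0 omega0l addr0. Qed.
Lemma omegaNl v w : omega (- v) w = - omega v w.
Proof. by rewrite -scaleN1r omegaZl mulN1r. Qed.
Lemma omegaDr v w1 w2 : omega v (w1 + w2) = omega v w1 + omega v w2.
Proof. by rewrite omega_antisym omegaDl opprD -!omega_antisym. Qed.
Lemma omega0r w : omega w 0 = 0.
Proof. by rewrite omega_antisym omega0l oppr0. Qed.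
Lemma omegaZr a v w : omega v (a *: w) = a * omega v w.
Proof. by rewrite omega_antisym omegaZl -mulrN -omega_antisym. Qed.
Lemma omegaNr v w : omega v (- w) = - omega v w.
Proof. by rewrite omega_antisym omegaNl opprK omega_antisym. Qed.
Lemma omegavv v : omega v v = 0.
Proof. by rewrite /omega big1// => i _; ring. Qed.

Lemma hp_mul g h : hp (hmul g h) = hp g + hp h.
Proof. by rewrite /hmul bracketE !linearD !linearZ /= hp_hZ !scaler0 addr0. Qed.
Lemma zp_mul g h : zp (hmul g h) = zp g + zp h + omega (hp g) (hp h) / 2.
Proof.
by rewrite /hmul bracketE !linearD !linearZ /= zp_hZ mulr1 [in RHS]mulrC.
Qed.
Lemma hp_dleft g u : hp (dleft g u) = hp u.
Proof. by rewrite /dleft bracketE !linearD !linearZ /= hp_hZ !scaler0 addr0. Qed.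
Lemma zp_dleft g u : zp (dleft g u) = zp u + omega (hp g) (hp u) / 2.
Proof.
by rewrite /dleft bracketE !linearD !linearZ /= zp_hZ mulr1 [in RHS]mulrC.
Qed.
Lemma hp_inv g : hp (hinv g) = - hp g. Proof. exact: linearN. Qed.
Lemma zp_inv g : zp (hinv g) = - zp g. Proof. exact: linearN. Qed.
Lemma hp0 : hp 0 = 0. Proof. exact: linear0. Qed.
Lemma zp0 : zp 0 = 0. Proof. exact: linear0. Qed.

Definition omegaE := (omegaDl, omegaDr, omegaNl, omegaNr, omegaZl, omegaZr,
  omega0l, omega0r, omegavv).

Lemma hmulA g h k : hmul g (hmul h k) = hmul (hmul g h) k.
Proof.
apply: heisP; first by rewrite !hp_mul addrA.
rewrite !zp_mul !hp_mul !omegaDl !omegaDr; move: (omega _ _) (omega _ _) (omega _ _).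
by move=> *; field.
Qed.
Lemma hmul0g g : hmul 0 g = g.
Proof. by apply: heisP; rewrite ?hp_mul ?zp_mul ?hp0 ?zp0 ?omegaE ?add0r//; field. Qed.
Lemma hmulg0 g : hmul g 0 = g.
Proof. by apply: heisP; rewrite ?hp_mul ?zp_mul ?hp0 ?zp0 ?omegaE ?addr0//; field. Qed.
Lemma hmulVg g : hmul (hinv g) g = 0.
Proof.
by apply: heisP; rewrite ?hp_mul ?zp_mul ?hp_inv ?zp_inv ?hp0 ?zp0 ?omegaE ?addNr//;
  field.
Qed.
Lemma hmulgV g : hmul g (hinv g) = 0.
Proof.
by apply: heisP; rewrite ?hp_mul ?zp_mul ?hp_inv ?zp_inv ?hp0 ?zp0 ?omegaE ?addrN//;
  field.
Qed.
Lemma hmulKg g h : hmul (hinv g) (hmul g h) = h.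
Proof. by rewrite hmulA hmulVg hmul0g. Qed.
Lemma hmulVKg g h : hmul g (hmul (hinv g) h) = h.
Proof. by rewrite hmulA hmulgV hmul0g. Qed.
Lemma hmulgK g h : hmul (hmul h g) (hinv g) = h.
Proof. by rewrite -hmulA hmulgV hmulg0. Qed.
Lemma hmulgKV g h : hmul (hmul h (hinv g)) g = h.
Proof. by rewrite -hmulA hmulVg hmulg0. Qed.
Lemma hmulI g h k : hmul g h = hmul g k -> h = k.
Proof. by move=> /(congr1 (hmul (hinv g))); rewrite !hmulKg. Qed.
Lemma hmulIr g h k : hmul h g = hmul k g -> h = k.
Proof. by move=> /(congr1 (fun x => hmul x (hinv g))); rewrite !hmulgK. Qed.
Lemma hinvK g : hinv (hinv g) = g. Proof. exact: opprK. Qed.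
(** The dilations of the graded Lie algebra, with weight 1 on the horizontal part and weight 2 on
    the center. *)
Definition dil (s : R) h : H := hmk (s *: hp h) (s ^+ 2 * zp h).
Lemma hp_dil s h : hp (dil s h) = s *: hp h. Proof. exact: hpK. Qed.
Lemma zp_dil s h : zp (dil s h) = s ^+ 2 * zp h. Proof. exact: zpK. Qed.
Lemma dil1 h : dil 1 h = h.
Proof. by apply: heisP; rewrite ?hp_dil ?zp_dil ?scale1r ?expr1n ?mul1r. Qed.
Lemma dil0 h : dil 0 h = 0.
Proof. by apply: heisP; rewrite ?hp_dil ?zp_dil ?scale0r ?expr0n ?mul0r ?hp0 ?zp0. Qed.

End HeisenbergAlgebra.

Section EuclideanNorm.
Variables (R : realType) (m : nat).
Implicit Types (v w : 'cV[R]_m).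

Definition edot v w : R := \sum_i v i ord0 * w i ord0.
Definition enorm v : R := Num.sqrt (edot v v).

Lemma edot_ge0 v : 0 <= edot v v.
Proof. by apply: sumr_ge0 => i _; rewrite -expr2 sqr_ge0. Qed.
Lemma enorm_ge0 v : 0 <= enorm v. Proof. exact: sqrtr_ge0. Qed.
Lemma enorm_sq v : enorm v ^+ 2 = edot v v.
Proof. by rewrite sqr_sqrtr// edot_ge0. Qed.

Lemma edotC v w : edot v w = edot w v.
Proof. by apply: eq_bigr => i _; rewrite mulrC. Qed.
Lemma edotDl v1 v2 w : edot (v1 + v2) w = edot v1 w + edot v2 w.
Proof. by rewrite /edot -big_split; apply: eq_bigr => i _; rewrite !mxE mulrDl. Qed.
Lemma edotZl a v w : edot (a *: v) w = a * edot v w.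
Proof. by rewrite /edot mulr_sumr; apply: eq_bigr => i _; rewrite !mxE mulrA. Qed.
Lemma edotDr v w1 w2 : edot v (w1 + w2) = edot v w1 + edot v w2.
Proof. by rewrite edotC edotDl !(edotC v). Qed.
Lemma edotZr a v w : edot v (a *: w) = a * edot v w.
Proof. by rewrite edotC edotZl edotC. Qed.
Lemma edotE v w : edot v w = (v^T *m w) ord0 ord0.
Proof. by rewrite mxE; apply: eq_bigr => i _; rewrite mxE. Qed.

Lemma enormZ a v : enorm (a *: v) = `|a| * enorm v.
Proof.
by rewrite /enorm edotZl edotZr mulrA -expr2 sqrtrM ?sqr_ge0// sqrtr_sqr.
Qed.
Lemma enormN v : enorm (- v) = enorm v.
Proof. by rewrite -scaleN1r enormZ normrN1 mul1r. Qed.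
Lemma enorm0 : enorm 0 = 0.
Proof. by rewrite -[0](scale0r 0) enormZ normr0 mul0r. Qed.
Lemma enorm_eq0 v : enorm v = 0 -> v = 0.
Proof.
move=> v0; have := enorm_sq v; rewrite v0 expr0n /= => /esym/eqP.
rewrite psumr_eq0; last by move=> i _; rewrite -expr2 sqr_ge0.
move=> /allP h; apply/matrixP => i j; rewrite ord1 mxE.
by have := h i (mem_index_enum _); rewrite -expr2 sqrf_eq0 => /eqP.
Qed.

Lemma cauchy_schwarz v w : edot v w <= enorm v * enorm w.
Proof.
have [/enorm_eq0->|w0] := eqVneq (enorm w) 0.
  by rewrite -[0](scale0r 0) edotZr mul0r mulr_ge0 ?enorm_ge0.
have wp : 0 < enorm w by rewrite lt_neqAle eq_sym w0 enorm_ge0.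
rewrite (le_trans (ler_norm _))// -(@ler_pXn2r _ 2)// ?nnegrE ?mulr_ge0 ?enorm_ge0//.
rewrite real_normK ?num_real// exprMn !enorm_sq.
have := edot_ge0 (edot w w *: v + - edot v w *: w).
rewrite !edotDl !edotDr !edotZl !edotZr (edotC w v).
have w2 : 0 < edot w w by rewrite -enorm_sq exprn_gt0.
have -> : edot w w * (edot w w * edot v v) + edot w w * (- edot v w * edot v w) +
  (- edot v w * (edot w w * edot v w) + - edot v w * (- edot v w * edot w w)) =
  edot w w * (edot v v * edot w w - edot v w ^+ 2) by ring.
by rewrite pmulr_rge0// subr_ge0.
Qed.

Lemma coord_le_enorm v i : `|v i ord0| <= enorm v.
Proof.
rewrite -(@ler_pXn2r _ 2)// ?nnegrE ?enorm_ge0// enorm_sq real_normK ?num_real//.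
rewrite /edot (bigD1 i)//= expr2 lerDl; apply: sumr_ge0 => j _.
by rewrite -expr2 sqr_ge0.
Qed.

Lemma mulmx_coord_bound (p : nat) (B : 'M[R]_(p, m)) : exists2 K, 0 <= K &
  forall v i, `|(B *m v) i ord0| <= K * enorm v.
Proof.
exists (\sum_i \sum_j `|B i j|).
  by apply: sumr_ge0 => i _; apply: sumr_ge0 => j _.
move=> v i; rewrite mxE (le_trans (ler_norm_sum _ _ _))//.
apply: (@le_trans _ _ ((\sum_j `|B i j|) * enorm v)).
  rewrite mulr_suml; apply: ler_sum => j _; rewrite normrM ler_wpM2l//.
  exact: coord_le_enorm.
rewrite ler_wpM2r ?enorm_ge0// [leRHS](bigD1 i)//= lerDl.
by apply: sumr_ge0 => k _; apply: sumr_ge0.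
Qed.

End EuclideanNorm.

Section DerivativeRules.
Variable R : realType.
Implicit Types (f g : R -> R) (t a b : R).

Lemma derD f g t a b : is_derive t (1 : R) f a -> is_derive t (1 : R) g b ->
  is_derive t (1 : R) (fun s => f s + g s) (a + b).
Proof. by move=> df dg; exact: is_deriveD. Qed.

Lemma derZ f t (k a : R) : is_derive t (1 : R) f a ->
  is_derive t (1 : R) (fun s => k * f s) (k * a).
Proof. by move=> df; exact: is_deriveZ. Qed.

Lemma der_cst t (k : R) : is_derive t (1 : R) (fun=> k) 0.
Proof. exact: is_derive_cst. Qed.

Lemma der_sum (I : Type) (r : seq I) (F : I -> R -> R) (dF : I -> R) t :
  (forall i, is_derive t (1 : R) (F i) (dF i)) ->
  is_derive t (1 : R) (fun s => \sum_(i <- r) F i s) (\sum_(i <- r) dF i).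
Proof.
move=> h; elim: r => [|i r IH].
  rewrite big_nil (_ : (fun _ => _) = fun=> 0); first exact: der_cst.
  by apply/funext => s; rewrite big_nil.
rewrite big_cons (_ : (fun _ => _) = fun s => F i s + \sum_(j <- r) F j s).
  exact: derD (h i) IH.
by apply/funext => s; rewrite big_cons.
Qed.

Lemma der_affine f (al be t a : R) : is_derive (al + be * t) (1 : R) f a ->
  is_derive t (1 : R) (fun s => f (al + be * s)) (be * a).
Proof.
move=> df; rewrite mulrC.
have dg : is_derive t (1 : R) (fun s => al + be * s) be.
  rewrite -[X in is_derive _ _ _ X]add0r -[X in 0 + X]mulr1.
  exact: (derD (der_cst t al) (derZ be (is_derive_id t 1))).
exact: (is_derive1_comp (f := f)).
Qed.

Lemma der_eq_near f g (x y t a : R) : x < t -> t < y ->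
  (forall s, x < s < y -> f s = g s) ->
  is_derive t (1 : R) f a -> is_derive t (1 : R) g a.
Proof.
move=> xt ty fg; apply: near_eq_is_derive.
near=> s; apply: fg; apply/andP; split; near: s.
  exact: lt_nbhsr.
exact: lt_nbhsl.
Unshelve. all: by end_near. Qed.

End DerivativeRules.

(** * Sub-Riemannian distances *)

Section Arcs.
Variables (R : realType) (n : nat).
Local Notation H := (heis R n).
Local Notation V := ('cV[R]_(n + n)).
Local Notation mu := (@lebesgue_measure R).

(** The norm whose unit ball is the image under A of the Euclidean one, for A invertible. *)
Definition cnorm (A : 'M[R]_(n + n)) (v : V) : R := enorm (invmx A *m v).

(* The norm of pair_mx A rho on its image; when rho = 0 the last coordinate is
   0 there, and so is the quotient. *)
Definition unorm (A : 'M[R]_(n + n)) (rho : R) (u : H) : R :=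
  Num.sqrt (cnorm A (hp u) ^+ 2 + (zp u / rho) ^+ 2).

Lemma cnorm_ge0 A v : 0 <= cnorm A v. Proof. exact: enorm_ge0. Qed.
Lemma unorm_ge0 A rho u : 0 <= unorm A rho u. Proof. exact: sqrtr_ge0. Qed.
Lemma cnorm_le_unorm A rho u : cnorm A (hp u) <= unorm A rho u.
Proof.
rewrite -[leLHS]ger0_norm ?cnorm_ge0// -sqrtr_sqr ler_wsqrtr// lerDl.
exact: sqr_ge0.
Qed.
Lemma zp_le_unorm A rho u : (rho = 0 -> zp u = 0) ->
  `|zp u| <= `|rho| * unorm A rho u.
Proof.
have [->/(_ erefl)->|r0 _] := eqVneq rho 0; first by rewrite !normr0 mul0r.
have -> : zp u = rho * (zp u / rho) by rewrite mulrC divfK.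
rewrite normrM ler_wpM2l// -sqrtr_sqr ler_wsqrtr// lerDr; exact: sqr_ge0.
Qed.
Lemma cnormZ A a v : cnorm A (a *: v) = `|a| * cnorm A v.
Proof. by rewrite /cnorm -scalemxAr enormZ. Qed.
Lemma cnormN A v : cnorm A (- v) = cnorm A v.
Proof. by rewrite /cnorm mulmxN enormN. Qed.
Lemma cnorm0 A : cnorm A 0 = 0. Proof. by rewrite /cnorm mulmx0 enorm0. Qed.
Lemma unormZ A rho a u : unorm A rho (a *: u) = `|a| * unorm A rho u.
Proof.
rewrite /unorm !linearZ /= cnormZ exprMn real_normK ?num_real//.
have -> : a * zp u / rho = a * (zp u / rho) by rewrite mulrA.
by rewrite exprMn -mulrDr sqrtrM ?sqr_ge0// sqrtr_sqr.
Qed.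

(* P and W are primitives of the horizontal speed and of the vertical control,
   and l is an absolutely continuous majorant of the length. *)
Record arc_at (A : 'M[R]_(n + n)) (rho : R) (c u : R -> H) (P W l : R -> R)
    (t : R) : Prop := ArcAt {
  arc_hp : forall j, is_derive t (1 : R) (fun s => hp (c s) j ord0) (hp (u t) j ord0);
  arc_zp : is_derive t (1 : R) (fun s => zp (c s))
             (zp (u t) + omega (hp (c t)) (hp (u t)) / 2);
  arc_P : is_derive t (1 : R) P (cnorm A (hp (u t)));
  arc_W : is_derive t (1 : R) W (zp (u t));
  arc_l : exists2 l' : R, is_derive t (1 : R) l l' & unorm A rho (u t) <= l';
  arc_rho : rho = 0 -> zp (u t) = 0 }.

(** With P, W and l as data, integrals of the control become differences of absolutely continuous
    functions. Since l only has to dominate the length, it can be transported and rescaled together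
    with the curve. *)
Record hcurve A rho (a b : R) c u P W l : Prop := HCurve {
  arc_ac_hp : forall j, abs_continuous a b (fun s => hp (c s) j ord0);
  arc_ac_zp : abs_continuous a b (fun s => zp (c s));
  arc_ac_P : abs_continuous a b P;
  arc_ac_W : abs_continuous a b W;
  arc_ac_l : abs_continuous a b l;
  arc_ae : {ae mu, forall t, t \in `[a, b] -> arc_at A rho c u P W l t} }.

Variables (A : 'M[R]_(n + n)) (rho : R).

Lemma arc_sub a b a' b' c u P W l : a <= a' -> b' <= b ->
  hcurve A rho a b c u P W l -> hcurve A rho a' b' c u P W l.
Proof.
move=> aa bb [h1 h2 h3 h4 h5 h6]; split; try by [move=> j; exact: ac_sub (h1 j) | exact: ac_sub h2 | exact: ac_sub h3 | exact: ac_sub h4 | exact: ac_sub h5].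
by apply: ae_imp h6 => t ht; rewrite in_itv /= => tab; apply: ht; rewrite in_itv /=; lra.
Qed.

Lemma arc_affine a b a' b' al be c u P W l : 0 < be ->
  a' = al + be * a -> b' = al + be * b ->
  hcurve A rho a' b' c u P W l ->
  hcurve A rho a b (fun t => c (al + be * t)) (fun t => be *: u (al + be * t))
    (fun t => P (al + be * t)) (fun t => W (al + be * t)) (fun t => l (al + be * t)).
Proof.
move=> be0 ea eb [h1 h2 h3 h4 h5 h6].
have acc f : abs_continuous a' b' f -> abs_continuous a b (fun t => f (al + be * t)).
  apply: (@ac_comp _ _ _ _ _ f (fun t => al + be * t) be) => x y ax xy yb.
  split; rewrite ?ea ?eb ?lerD2l ?ler_pM2l//.
  by rewrite [leRHS]mulrBr; lra.
split; try by [move=> j; exact: (acc _ (h1 j)) | exact: (acc _ h2) | exact: acc].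
apply: ae_imp (ae_affine al (lt0r_neq0 be0) h6) => t ht.
rewrite in_itv /= => tab.
have /ht[k1 k2 k3 k4 [l' k5 k5'] k6] : al + be * t \in `[a', b'].
  by rewrite in_itv /= ea eb !lerD2l !ler_pM2l.
split.
- by move=> j; rewrite linearZ /= mxE; apply: (der_affine (f := fun s => hp (c s) j ord0)).
- rewrite !linearZ /= omegaZr -mulrA -mulrDr.
  exact: (der_affine (f := fun s => zp (c s))).
- by rewrite linearZ /= cnormZ gtr0_norm//; exact: der_affine.
- by rewrite linearZ /=; exact: der_affine.
- exists (be * l'); first exact: der_affine.
  by rewrite unormZ gtr0_norm// ler_pM2l.
- by rewrite linearZ /= => /k6 ->; rewrite mulr0.
Qed.

(** Reversing time changes the sign of the control. P and l change sign so as to keep nonnegative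
    derivatives; for W the two signs cancel. *)
Lemma arc_opp a b c u P W l : hcurve A rho (- b) (- a) c u P W l ->
  hcurve A rho a b (fun t => c (- t)) (fun t => - u (- t))
    (fun t => - P (- t)) (fun t => W (- t)) (fun t => - l (- t)).
Proof.
move=> [h1 h2 h3 h4 h5 h6].
have dN (f : R -> R) (t y : R) : is_derive (- t) (1 : R) f y -> is_derive t (1 : R) (fun s => f (- s)) (- y).
  move=> h; have := @der_affine R f 0 (-1) t y; rewrite add0r !mulN1r => /(_ h).
  by under eq_fun do rewrite add0r mulN1r.
have dNN (f : R -> R) (t y : R) : is_derive (- t) (1 : R) f y ->
    is_derive t (1 : R) (fun s => - f (- s)) y.
  move=> /dN /(derZ (-1)); rewrite mulN1r opprK.
  by under eq_fun do rewrite mulN1r.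
split; try by [move=> j; exact: (ac_opp (h1 j)) | exact: (ac_opp h2) | exact: acN (ac_opp _) | exact: ac_opp].
have h7 : {ae mu, forall t, - t \in `[- b, - a] -> arc_at A rho c u P W l (- t)}.
  have N10 : -1 != 0 :> R by rewrite oppr_eq0 oner_eq0.
  by apply: ae_imp (ae_affine 0 N10 h6) => t; rewrite add0r mulN1r.
apply: ae_imp h7 => t ht; rewrite in_itv /= => tab.
have /ht[k1 k2 k3 k4 [l' k5 k5'] k6] : - t \in `[- b, - a].
  by rewrite in_itv /= !lerN2; lra.
split.
- by move=> j; rewrite linearN /= mxE; exact: (dN (fun s => hp (c s) j ord0)).
- rewrite !linearN /= omegaNr mulNr -opprD; exact: (dN (fun s => zp (c s))).
- by rewrite linearN /= cnormN; exact: dNN.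
- by rewrite linearN /=; exact: dN.
- exists l'; first exact: dNN.
  by rewrite -scaleN1r unormZ normrN1 mul1r.
- by rewrite linearN /= => /k6 ->; rewrite oppr0.
Qed.

(** The second primitives are shifted by constants to match the first ones at m. The derivatives may
    fail to exist at m, which is a null set. *)
Lemma arc_concat a m b c1 u1 P1 W1 l1 c2 u2 P2 W2 l2 : a <= m -> m <= b ->
  c1 m = c2 m ->
  hcurve A rho a m c1 u1 P1 W1 l1 -> hcurve A rho m b c2 u2 P2 W2 l2 ->
  let glue (T : Type) (f g : R -> T) t := if t <= m then f t else g t in
  hcurve A rho a b (glue _ c1 c2) (glue _ u1 u2)
    (glue _ P1 (fun t => P2 t + (P1 m - P2 m)))
    (glue _ W1 (fun t => W2 t + (W1 m - W2 m)))
    (glue _ l1 (fun t => l2 t + (l1 m - l2 m))).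
Proof.
move=> am mb cm [h1 h2 h3 h4 h5 h6] [k1 k2 k3 k4 k5 k6] glue.
have gl (F : H -> R) : (fun t => F (glue _ c1 c2 t)) =
    glue _ (fun t => F (c1 t)) (fun t => F (c2 t)).
  by apply/funext => t; rewrite /glue; case: ifP.
have acS (f g : R -> R) : abs_continuous a m f -> abs_continuous m b g ->
    abs_continuous a b (glue _ f (fun t => g t + (f m - g m))).
  move=> hf hg; apply: ac_concat => //; first by rewrite addrC subrK.
  by apply: acD => //; exact: ac_cst.
split; [ | | exact: acS | exact: acS | exact: acS |].
- move=> j; rewrite (gl (fun h => hp h j ord0)); apply: ac_concat => //.
  by rewrite cm.
- by rewrite (gl (@zp R n)); apply: ac_concat => //; rewrite cm.
apply: ae_imp (ae_and (ae_neq m) (ae_and h6 k6)) => t [tm [ht kt]].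
rewrite in_itv /= => /andP[at_ tb].
have [tm'|tm'] := ltP t m.
  have /ht[q1 q2 q3 q4 [l' q5 q5'] q6] : t \in `[a, m].
    by rewrite in_itv /= at_ ltW.
  have gE T (f g : R -> T) : glue T f g t = f t by rewrite /glue ltW.
  have gN (f g : R -> R) y : is_derive t (1 : R) f y ->
      is_derive t (1 : R) (glue _ f g) y.
    apply: (@der_eq_near _ _ _ (t - 1) m) => //; first lra.
    by move=> s /andP[_ sm]; rewrite /glue ltW.
  split; rewrite ?gE//.
  - by move=> j; rewrite (gl (fun h => hp h j ord0)); exact: gN.
  - by rewrite (gl (@zp R n)); exact: gN.
  - exact: gN.
  - exact: gN.
  - by exists l' => //; exact: gN.
have {}tm' : m < t by rewrite lt_neqAle eq_sym tm.
have /kt[q1 q2 q3 q4 [l' q5 q5'] q6] : t \in `[m, b].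
  by rewrite in_itv /= tb ltW.
have gE T (f g : R -> T) : glue T f g t = g t by rewrite /glue leNgt tm'.
have gN (f g : R -> R) y : is_derive t (1 : R) g y ->
    is_derive t (1 : R) (glue _ f g) y.
  apply: (@der_eq_near _ _ _ m (t + 1)) => //; first lra.
  by move=> s /andP[ms _]; rewrite /glue leNgt ms.
have gS (f g : R -> R) k y : is_derive t (1 : R) g y ->
    is_derive t (1 : R) (glue _ f (fun s => g s + k)) y.
  by move=> h; apply: gN; rewrite -[y]addr0; apply: derD => //; exact: der_cst.
split; rewrite ?gE//.
- by move=> j; rewrite (gl (fun h => hp h j ord0)); exact: gN.
- by rewrite (gl (@zp R n)); exact: gN.
- exact: gS.
- exact: gS.
- by exists l' => //; exact: gS.
Qed.

(** The function f - K l has a nonpositive derivative almost everywhere. Lower bounds for lengths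
    come from this comparison, with f a suitable functional of the curve. *)
Lemma arc_bound a b c u P W l (f : R -> R) (K : R) s t : 0 <= K ->
  hcurve A rho a b c u P W l -> abs_continuous a b f ->
  a <= s -> s <= t -> t <= b ->
  (forall x, s <= x <= t -> arc_at A rho c u P W l x ->
    exists2 f' : R, is_derive x (1 : R) f f' & f' <= K * unorm A rho (u x)) ->
  f t - f s <= K * (l t - l s).
Proof.
move=> K0 [h1 h2 h3 h4 h5 h6] acf as_ st tb hf.
have : f t - K * l t <= f s - K * l s.
  apply: (@ac_nonincreasing _ s t (fun x => f x - K * l x)) => //.
    exact: acB (ac_sub as_ tb acf) (acZ K (ac_sub as_ tb h5)).
  apply: ae_imp h6 => x hx; rewrite in_itv /= => sxt.
  have /hx ax : x \in `[a, b] by rewrite in_itv /=; lra.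
  have [f' df fK] := hf _ sxt ax.
  have [l' dl lu] := arc_l ax.
  exists (f' - K * l'); last by rewrite subr_le0 (le_trans fK)// ler_wpM2l.
  by apply: is_deriveB => //; exact: derZ.
by rewrite mulrBr; lra.
Qed.

Lemma arc_l_mono a b c u P W l s t : hcurve A rho a b c u P W l ->
  a <= s -> s <= t -> t <= b -> l s <= l t.
Proof.
move=> arcu as_ st tb.
have : (0 : R) - 0 <= 1 * (l t - l s).
  apply: (@arc_bound a b c u P W l (fun=> 0) 1 s t) => //; first exact: ac_cst.
  by move=> x _ _; exists 0; [exact: der_cst | rewrite mul1r unorm_ge0].
by rewrite subrr mul1r subr_ge0.
Qed.

End Arcs.

(** * Distance estimates from curves *)

Section Reach.
Variables (R : realType) (n : nat).
Local Notation H := (heis R n).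
Local Notation V := ('cV[R]_(n + n)).
Local Notation mu := (@lebesgue_measure R).
Implicit Types (g h k : H).

(* The distance of g and h is less than e. *)
Definition reach (A : 'M[R]_(n + n)) (rho : R) g h (e : R) : Prop :=
  exists c u P W l, [/\ hcurve A rho 0 1 c u P W l, c 0 = g, c 1 = h & l 1 - l 0 < e].

Section Fixed.
Variables (A : 'M[R]_(n + n)) (rho : R).
Local Notation reach := (reach A rho).

Lemma reach_of_arc a b c u P W l e : a < b -> hcurve A rho a b c u P W l ->
  l b - l a < e -> reach (c a) (c b) e.
Proof.
move=> ab arcu le; have ba : 0 < b - a by rewrite subr_gt0.
have e0 : a = a + (b - a) * 0 by ring.
have e1 : b = a + (b - a) * 1 by ring.
have := arc_affine ba e0 e1 arcu => hcurve'.
exists (fun t => c (a + (b - a) * t)); do 4 eexists; split; first exact: hcurve'.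
- by rewrite -e0.
- by rewrite -e1.
- by rewrite /= -e0 -e1.
Qed.

Lemma reach_mono g h e e' : e <= e' -> reach g h e -> reach g h e'.
Proof.
move=> ee [c [u [P [W [l [h1 h2 h3 h4]]]]]]; exists c, u, P, W, l.
by split=> //; exact: lt_le_trans ee.
Qed.

Lemma reach_pos g h e : reach g h e -> 0 < e.
Proof.
move=> [c [u [P [W [l [h1 h2 h3 h4]]]]]]; apply: le_lt_trans h4.
by rewrite subr_ge0; apply: (arc_l_mono h1) => //; exact: ler01.
Qed.

Lemma reach_open g h e : reach g h e -> exists2 e', e' < e & reach g h e'.
Proof.
move=> [c [u [P [W [l [h1 h2 h3 h4]]]]]].
exists ((e + (l 1 - l 0)) / 2); first lra.
by exists c, u, P, W, l; split=> //; lra.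
Qed.

Lemma reach_refl g e : 0 < e -> reach g g e.
Proof.
move=> e0; exists (fun=> g), (fun=> 0), (fun=> 0), (fun=> 0), (fun=> 0).
split=> //; last by rewrite subrr.
split; try by [move=> j; exact: ac_cst | exact: ac_cst].
apply: aeW => t _; split; rewrite ?hp0 ?zp0 ?cnorm0.
- by move=> j; rewrite [X in is_derive _ _ _ X]mxE; exact: der_cst.
- by rewrite omega0r mul0r addr0; exact: der_cst.
- exact: der_cst.
- exact: der_cst.
- exists 0; first exact: der_cst.
  by rewrite /unorm hp0 zp0 cnorm0 mul0r expr0n addr0 sqrtr0.
- by [].
Qed.

Lemma reach_sym g h e : reach g h e -> reach h g e.
Proof.
move=> [c [u [P [W [l [h1 <- <- h4]]]]]].
have arc1 : hcurve A rho (- 0) (- - 1) c u P W l by rewrite oppr0 opprK.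
have := arc_opp arc1 => arc2.
have := @reach_of_arc (-1) 0 _ _ _ _ _ e _ arc2.
rewrite /= oppr0 !opprK; apply; first by rewrite ltrN10.
by rewrite addrC.
Qed.

Lemma reach_tri g h k e e' : reach g h e -> reach h k e' -> reach g k (e + e').
Proof.
move=> [c1 [u1 [P1 [W1 [l1 [a1 c10 c11 l1e]]]]]] [c2 [u2 [P2 [W2 [l2 [a2 c20 c21 l2e]]]]]].
have e0 : 0 = -1 + 1 * 1 :> R by ring.
have e1 : 1 = -1 + 1 * 2 :> R by ring.
have := arc_affine ltr01 e0 e1 a2 => a2'.
have cm : c1 1 = c2 (-1 + 1 * 1) by rewrite -e0 c11 c20.
have h12 : 1 <= 2 :> R by lra.
have := arc_concat (@ler01 R) h12 cm a1 a2' => a3.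
have := @reach_of_arc 0 2 _ _ _ _ _ (e + e') _ a3.
rewrite /= ler01 c10.
have -> : (2 <= 1 :> R) = false by apply/negbTE; rewrite -ltNge; lra.
rewrite -e1 c21 -e0; apply; first lra.
by lra.
Qed.

(** The metric is left invariant: translation changes the coordinates of the curve by a fixed affine
    map and leaves the control, hence P, W and l, as they are. *)
Lemma reach_left k g h e : reach g h e -> reach (hmul k g) (hmul k h) e.
Proof.
move=> [c [u [P [W [l [[h1 h2 h3 h4 h5 h6] <- <- le]]]]]].
exists (fun t => hmul k (c t)), u, P, W, l; split=> //; split=> //.
- move=> j; apply: (ac_eq (f := fun s => hp k j ord0 + hp (c s) j ord0)).
    by move=> t _; rewrite hp_mul [RHS]mxE.
  by apply: acD => //; exact: ac_cst.
- apply: (ac_eq (f := fun s => zp k + zp (c s) + \sum_(i < n)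
      ((hp k (lshift n i) ord0 / 2) * hp (c s) (rshift n i) ord0
       + (- hp k (rshift n i) ord0 / 2) * hp (c s) (lshift n i) ord0))).
    move=> t _; rewrite zp_mul; congr (_ + _); rewrite /omega mulr_suml.
    by apply: eq_bigr => i _; field.
  apply: acD; first by apply: acD => //; exact: ac_cst.
  by apply: ac_sum => i; apply: acD; exact: acZ.
apply: ae_imp h6 => t ht /ht[k1 k2 k3 k4 k5 k6]; split=> //.
- move=> j; rewrite (_ : (fun s => _) = fun s => hp k j ord0 + hp (c s) j ord0).
    by rewrite -[X in is_derive _ _ _ X]add0r; exact: derD (der_cst _ _) (k1 j).
  by apply/funext => s; rewrite hp_mul [LHS]mxE.
- rewrite (_ : (fun s => _) = fun s => zp k + zp (c s) + \sum_(i < n)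
      ((hp k (lshift n i) ord0 / 2) * hp (c s) (rshift n i) ord0
       + (- hp k (rshift n i) ord0 / 2) * hp (c s) (lshift n i) ord0)).
    have -> : zp (u t) + omega (hp (hmul k (c t))) (hp (u t)) / 2 =
      0 + (zp (u t) + omega (hp (c t)) (hp (u t)) / 2) + \sum_(i < n)
      ((hp k (lshift n i) ord0 / 2) * hp (u t) (rshift n i) ord0
       + (- hp k (rshift n i) ord0 / 2) * hp (u t) (lshift n i) ord0).
      rewrite hp_mul omegaDl mulrDl add0r [in RHS]addrAC -addrA; congr (_ + _).
      congr (_ + _).
      by rewrite /omega mulr_suml; apply: eq_bigr => i _; field.
    have d1 := derD (der_cst t (zp k)) k2.
    have d2 (i : 'I_n) := derD (derZ (hp k (lshift n i) ord0 / 2) (k1 (rshift n i)))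
      (derZ (- hp k (rshift n i) ord0 / 2) (k1 (lshift n i))).
    exact: (derD d1 (der_sum _ d2)).
  apply/funext => s; rewrite zp_mul; congr (_ + _); rewrite /omega mulr_suml.
  by apply: eq_bigr => i _; field.
Qed.

Lemma reach_leftE k g h e : reach (hmul k g) (hmul k h) e <-> reach g h e.
Proof.
split; last exact: reach_left.
by move=> /(reach_left (hinv k)); rewrite !hmulKg.
Qed.

Lemma reach_mul g h e e' : reach 0 g e -> reach 0 h e' -> reach 0 (hmul g h) (e + e').
Proof.
move=> h1 h2; apply: reach_tri h1 _.
by rewrite -{1}[g]hmulg0; exact: reach_left.
Qed.

Lemma reach_inv g e : reach 0 g e -> reach 0 (hinv g) e.
Proof. by move=> /(reach_left (hinv g)); rewrite hmulg0 hmulVg; exact: reach_sym. Qed.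

Lemma reach_straight v e : cnorm A v < e -> reach 0 (hmk v 0) e.
Proof.
move=> ve; exists (fun t => hmk (t *: v) 0), (fun=> hmk v 0),
  (fun t => cnorm A v * t), (fun=> 0), (fun t => cnorm A v * t).
have dE (k x : R) : is_derive x (1 : R) (fun t => k * t) k.
  rewrite -[X in is_derive _ _ _ X]mulr1; exact: derZ (is_derive_id _ _).
have dEr (k x : R) : is_derive x (1 : R) (fun t => t * k) k.
  by under eq_fun do rewrite mulrC; exact: dE.
have acE (k : R) : abs_continuous 0 1 (fun t => k * t).
  apply: acZ; apply: (@ac_lip _ _ _ _ 1) => x y _ xy _.
  by rewrite mul1r ger0_norm ?subr_ge0.
split.
- split => //.
  + move=> j; apply: (ac_eq (f := fun s => v j ord0 * s)) => // t _.
    by rewrite hpK [RHS]mxE mulrC.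
  + by apply: (ac_eq (f := fun=> 0)); [move=> t _; rewrite zpK | exact: ac_cst].
  + exact: ac_cst.
  + apply: aeW => t _; split; rewrite ?hpK ?zpK//.
    * move=> j; rewrite (_ : (fun _ => _) = fun s => s * v j ord0); first exact: dEr.
      by apply/funext => s; rewrite hpK [LHS]mxE.
    * rewrite omegaZl omegavv mulr0 mul0r addr0.
      rewrite (_ : (fun _ => _) = fun s => 0); first exact: der_cst.
      by apply/funext => s; rewrite zpK.
    * exact: der_cst.
    * exists (cnorm A v) => //.
      rewrite /unorm hpK zpK mul0r expr0n addr0 sqrtr_sqr ger0_norm//.
      exact: cnorm_ge0.
- by rewrite scale0r; apply: heisP; rewrite ?hpK ?zpK ?hp0 ?zp0.
- by rewrite scale1r.
- by rewrite mulr1 mulr0 subr0.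
Qed.

(** A central element is the commutator of two horizontal segments a v1 and b v2 with omega v1 v2 =
    1 and a b = z. Taking both |a| and |b| at most sqrt |z|, with the sign of z put into b, gives
    four segments of total length at most K sqrt |z|. *)
Lemma reach_vertical : (0 < n)%N -> exists2 K, 0 <= K &
  forall z e, K * Num.sqrt `|z| < e -> reach 0 (hmk 0 z) e.
Proof.
move=> n0; pose i0 : 'I_n := Ordinal n0.
pose v1 : V := delta_mx (lshift n i0) ord0; pose v2 : V := delta_mx (rshift n i0) ord0.
have om : omega v1 v2 = 1.
  rewrite /omega (bigD1 i0)//= big1 ?addr0; last first.
    move=> i ii0; rewrite !mxE !(inj_eq (@lshift_inj _ _)) (negbTE ii0).
    by rewrite !eq_lrshift !eq_rlshift /= !mul0r subrr.
  by rewrite !mxE !eqxx eq_lrshift eq_rlshift /= mulr1 mul0r subr0.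
exists (2 * (cnorm A v1 + cnorm A v2)).
  by rewrite mulr_ge0// addr_ge0 ?cnorm_ge0.
move=> z e hz; set s := Num.sqrt `|z| in hz.
have s0 : 0 <= s := sqrtr_ge0 _.
have ss : s * s = `|z| by rewrite -expr2 sqr_sqrtr.
pose a := s; pose b := Num.sg z * s.
have ab : a * b = z by rewrite /a /b mulrCA ss -numEsg.
have bs : `|b| <= s.
  rewrite /b normrM (ger0_norm s0) ler_piMl//.
  by rewrite normr_sg; case: eqP.
have -> : hmk 0 z = hmul (hmul (hmk (a *: v1) 0) (hmk (b *: v2) 0))
   (hmul (hinv (hmk (a *: v1) 0)) (hinv (hmk (b *: v2) 0))).
  apply: heisP; rewrite ?hpK ?zpK.
    by rewrite !hp_mul !hp_inv !hpK addrACA !addrN addr0.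
  rewrite !zp_mul !zp_inv !hp_mul !hp_inv !hpK !zpK !omegaE.
  by rewrite (omega_antisym v2 v1) om -ab; field.
pose d := (e - 2 * (cnorm A v1 + cnorm A v2) * s) / 4.
have d0 : 0 < d by rewrite /d; lra.
have r1 : reach 0 (hmk (a *: v1) 0) (s * cnorm A v1 + d).
  by apply: reach_straight; rewrite cnormZ ger0_norm// ltrDl.
have r2 : reach 0 (hmk (b *: v2) 0) (s * cnorm A v2 + d).
  apply: reach_straight; rewrite cnormZ (@le_lt_trans _ _ (s * cnorm A v2)) ?ltrDl//.
  by rewrite ler_wpM2r ?cnorm_ge0.
have r3 := reach_mul (reach_mul r1 r2) (reach_mul (reach_inv r1) (reach_inv r2)).
apply: (reach_mono _ r3).
by rewrite le_eqVlt; apply/orP; left; apply/eqP; rewrite /d; field.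
Qed.

(** The element is the product of its horizontal and central parts. The coefficient 1 of [cnorm]
    makes the bound sharp to first order along powers of an element, where the vertical term grows
    only like a square root. *)
Lemma reach_upper : (0 < n)%N -> exists2 K, 0 <= K &
  forall h e, cnorm A (hp h) + K * Num.sqrt `|zp h| < e -> reach 0 h e.
Proof.
move=> n0; have [K K0 hK] := reach_vertical n0; exists K => // h e he.
have -> : h = hmul (hmk (hp h) 0) (hmk 0 (zp h)).
  by apply: heisP; rewrite ?hp_mul ?zp_mul !hpK ?zpK ?omegaE; [rewrite addr0 | field].
pose d := (e - (cnorm A (hp h) + K * Num.sqrt `|zp h|)) / 2.
have d0 : 0 < d by rewrite /d; lra.
apply: (@reach_mono _ _ ((cnorm A (hp h) + d) + (K * Num.sqrt `|zp h| + d))).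
  by rewrite le_eqVlt; apply/orP; left; apply/eqP; rewrite /d; field.
by apply: reach_mul; [apply: reach_straight; lra | apply: hK; lra].
Qed.

(** The projection to the horizontal part is tested against the displacement y itself: by
    Cauchy-Schwarz, the inner product of y with A^-1 times the horizontal coordinates grows at rate
    at most |y| times the speed, and its total growth is |y|^2. *)
Lemma reach_hp g h e : reach g h e -> cnorm A (hp h - hp g) < e.
Proof.
move=> r0; have e0 := reach_pos r0; move: r0.
move=> [c [u [P [W [l [arcu <- <- le]]]]]]; apply: le_lt_trans le.
pose y := invmx A *m (hp (c 1) - hp (c 0)).
have [y0|y0] := eqVneq (enorm y) 0.
  by rewrite /cnorm -/y y0 subr_ge0; apply: (arc_l_mono arcu) => //; exact: ler01.
have yp : 0 < enorm y by rewrite lt_neqAle eq_sym y0 enorm_ge0.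
pose q j := \sum_i y i ord0 * invmx A i j.
pose f t := \sum_j q j * hp (c t) j ord0.
have fE (v : V) : \sum_j q j * v j ord0 = edot y (invmx A *m v).
  rewrite /q /edot; under eq_bigr do rewrite mulr_suml.
  rewrite exchange_big; apply: eq_bigr => i _.
  by rewrite [X in _ * X]mxE mulr_sumr; apply: eq_bigr => j _; rewrite mulrA.
have : f 1 - f 0 <= enorm y * (l 1 - l 0).
  apply: (arc_bound (enorm_ge0 y) arcu) => //; last move=> x _ ax.
    by apply: ac_sum => j; apply: acZ; exact: (arc_ac_hp arcu).
  exists (\sum_j q j * hp (u x) j ord0).
    by apply: der_sum => j; apply: derZ; exact: (arc_hp ax).
  rewrite fE (le_trans (cauchy_schwarz _ _))// ler_wpM2l ?enorm_ge0//.
  exact: cnorm_le_unorm.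
rewrite /f !fE.
have -> : edot y (invmx A *m hp (c 1)) - edot y (invmx A *m hp (c 0)) = edot y y.
  have yE : y = invmx A *m hp (c 1) + -1 *: (invmx A *m hp (c 0)).
    by rewrite scaleN1r /y mulmxBr.
  by rewrite -[RHS](congr1 (edot y) (esym yE)) edotDr edotZr mulN1r.
by rewrite -enorm_sq expr2 ler_pM2l.
Qed.

(** Two passes of [arc_bound]. The horizontal coordinates stay below K L along a curve of length L;
    the derivative of the vertical coordinate is then at most n K^2 L + |rho| times the speed, the
    first term coming from omega / 2 and the second from the vertical control. *)
Lemma reach_zp : A \in unitmx -> exists2 C, 0 <= C &
  forall h e, reach 0 h e -> `|zp h| <= (C * e + `|rho|) * e.
Proof.
move=> Au; have [K K0 hK] := mulmx_coord_bound A.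
have uK (v : V) j : `|v j ord0| <= K * cnorm A v.
  by rewrite -{1}[v](mulKVmx Au) hK.
exists (n%:R * (K * K)); first by rewrite !mulr_ge0.
move=> h e r0; have e0 := reach_pos r0; move: r0.
move=> [c [u [P [W [l [arcu c0 <- le]]]]]].
have l01 : l 0 <= l 1 by apply: (arc_l_mono arcu) => //; exact: ler01.
pose L := l 1 - l 0; have L0 : 0 <= L by rewrite subr_ge0.
have cb t j : 0 <= t <= 1 -> `|hp (c t) j ord0| <= K * L.
  move=> /andP[t0 t1].
  have lt : l t - l 0 <= L by rewrite lerD2r; apply: (arc_l_mono arcu).
  have key (s : R) : `|s| = 1 -> s * hp (c t) j ord0 <= K * L.
    move=> s1.
    have : s * hp (c t) j ord0 - s * hp (c 0) j ord0 <= K * (l t - l 0).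
      apply: (@arc_bound _ _ _ _ _ _ _ _ _ _ _ (fun t => s * hp (c t) j ord0) _ _ _ K0 arcu) => //.
        by apply: acZ; exact: (arc_ac_hp arcu).
      move=> x _ ax; exists (s * hp (u x) j ord0); first exact: derZ (arc_hp ax j).
      rewrite (le_trans (ler_norm _))// normrM s1 mul1r (le_trans (uK _ _))//.
      by rewrite ler_wpM2l// cnorm_le_unorm.
    have -> : hp (c 0) j ord0 = 0 by rewrite c0 hp0 [LHS]mxE.
    rewrite mulr0 subr0 => /le_trans; apply.
    by rewrite ler_wpM2l.
  rewrite ler_norml -(mul1r (hp _ _ _)) key ?normr1// andbT.
  by rewrite lerNl -mulNr key// normrN1.
pose C := n%:R * (K * K) * L + `|rho|.
have C0 : 0 <= C by rewrite addr_ge0// !mulr_ge0.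
have key (s : R) : `|s| = 1 -> s * zp (c 1) <= C * L.
  move=> s1; have : s * zp (c 1) - s * zp (c 0) <= C * L.
    apply: (@arc_bound _ _ _ _ _ _ _ _ _ _ _ (fun t => s * zp (c t)) _ _ _ C0 arcu) => //.
      by apply: acZ; exact: (arc_ac_zp arcu).
    move=> x x01 ax; exists (s * (zp (u x) + omega (hp (c x)) (hp (u x)) / 2)).
      exact: derZ (arc_zp ax).
    rewrite (le_trans (ler_norm _))// normrM s1 mul1r (le_trans (ler_normD _ _))//.
    rewrite addrC mulrDl; apply: lerD; last exact: zp_le_unorm (arc_rho ax).
    rewrite normrM [X in _ * X]ger0_norm ?invr_ge0// ler_pdivrMr//.
    apply: (@le_trans _ _ (\sum_(i < n) 2 * ((K * L) * (K * unorm A rho (u x))))).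
      apply: (le_trans (ler_norm_sum _ _ _)); apply: ler_sum => i _.
      have uj j : `|hp (u x) j ord0| <= K * unorm A rho (u x).
        by rewrite (le_trans (uK _ _))// ler_wpM2l// cnorm_le_unorm.
      rewrite (le_trans (ler_normB _ _))// !normrM mulr2n mulrDl !mul1r.
      by apply: lerD; apply: ler_pM => //; exact: cb.
    by rewrite sumr_const card_ord -mulr_natr le_eqVlt; apply/orP; left; apply/eqP; ring.
  by rewrite c0 zp0 mulr0 subr0.
have : `|zp (c 1)| <= C * L.
  rewrite ler_norml -(mul1r (zp _)) key ?normr1// andbT.
  by rewrite lerNl -mulNr key// normrN1.
move=> /le_trans; apply; apply: ler_pM => //; last exact: ltW.
by rewrite lerD2r ler_wpM2l ?mulr_ge0//; exact: ltW.
Qed.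

End Fixed.
End Reach.

Section ReachMaps.
Variables (R : realType) (n : nat).
Local Notation H := (heis R n).
Local Notation V := ('cV[R]_(n + n)).
Local Notation mu := (@lebesgue_measure R).
Implicit Types (A : 'M[R]_(n + n)) (g h : H).

(** Since S multiplies omega by ep, the block map (S, ep) is a Lie algebra endomorphism and takes a
    curve with its control to a curve with the image control. P is rescaled exactly by s, whereas K
    only has to bound the full norm. Both dilations and symplectic maps are instances. *)
Lemma reach_map A A' rho rho' (S : 'M[R]_(n + n)) ep s K g h e : 0 < K ->
  (forall v w, omega (S *m v) (S *m w) = ep * omega v w) ->
  (forall v, cnorm A' (S *m v) = s * cnorm A v) ->
  (forall u, (rho = 0 -> zp u = 0) ->
     unorm A' rho' (hmk (S *m hp u) (ep * zp u)) <= K * unorm A rho u) ->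
  (rho' = 0 -> rho = 0) ->
  reach A rho g h e ->
  reach A' rho' (hmk (S *m hp g) (ep * zp g)) (hmk (S *m hp h) (ep * zp h)) (K * e).
Proof.
move=> K0 hw hc hu hr [c [u [P [W [l [[h1 h2 h3 h4 h5 h6] <- <- le]]]]]].
exists (fun t => hmk (S *m hp (c t)) (ep * zp (c t))),
  (fun t => hmk (S *m hp (u t)) (ep * zp (u t))),
  (fun t => s * P t), (fun t => ep * W t), (fun t => K * l t).
split=> //; last by rewrite -mulrBr ltr_pM2l.
split; try by exact: acZ.
- move=> j; apply: (ac_eq (f := fun t => \sum_k S j k * hp (c t) k ord0)).
    by move=> t _; rewrite hpK [RHS]mxE.
  by apply: ac_sum => k; exact: acZ.
- by apply: (ac_eq (f := fun t => ep * zp (c t))); [move=> t _; rewrite zpK | exact: acZ].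
apply: ae_imp h6 => t ht /ht[k1 k2 k3 k4 [l' k5 k5'] k6]; split; rewrite ?hpK ?zpK.
- move=> j; rewrite (_ : (fun _ => _) = fun t => \sum_k S j k * hp (c t) k ord0).
    rewrite [X in is_derive _ _ _ X]mxE.
    by apply: der_sum => k; exact: derZ (k1 k).
  by apply/funext => x; rewrite hpK [LHS]mxE.
- rewrite (_ : (fun _ => _) = fun t => ep * zp (c t)).
    by rewrite hw -mulrA -mulrDr; exact: derZ k2.
  by apply/funext => x; rewrite zpK.
- by rewrite hc; exact: derZ k3.
- exact: derZ k4.
- exists (K * l'); first exact: derZ k5.
  by apply: (le_trans (hu _ k6)); rewrite ler_pM2l.
- by move=> /hr/k6 ->; rewrite mulr0.
Qed.

(** For 0 <= s <= 1 both s and s^2 are at most 1, so dilations do not increase distances, whatever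
    rho is. The factor 1 also covers s = 0. *)
Lemma reach_dil A rho s g h e : 0 <= s <= 1 -> reach A rho g h e ->
  reach A rho (dil s g) (dil s h) e.
Proof.
move=> /andP[s0 s1] r0; rewrite -[e]mul1r /dil -!mul_scalar_mx.
apply: (@reach_map A A rho rho s%:M (s ^+ 2) s 1) r0 => //.
- by move=> v w; rewrite !mul_scalar_mx omegaZl omegaZr; ring.
- by move=> v; rewrite mul_scalar_mx cnormZ ger0_norm.
move=> u _; rewrite mul1r /unorm hpK zpK mul_scalar_mx cnormZ ger0_norm//.
rewrite ler_wsqrtr// exprMn -mulrA exprMn; apply: lerD.
  by rewrite ler_piMl ?sqr_ge0// expr_le1.
by rewrite ler_piMl ?sqr_ge0// -exprM expr_le1.
Qed.

(** Without vertical control only the weight 1 part contributes to the norm, so dilations rescale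
    all lengths by s. *)
Lemma reach0_dil A s g h e : 0 < s -> reach A 0 g h e ->
  reach A 0 (dil s g) (dil s h) (s * e).
Proof.
move=> s0 r0; rewrite /dil -!mul_scalar_mx.
apply: (@reach_map A A 0 0 s%:M (s ^+ 2) s s) r0 => //.
- by move=> v w; rewrite !mul_scalar_mx omegaZl omegaZr; ring.
- by move=> v; rewrite mul_scalar_mx cnormZ gtr0_norm.
move=> u _; rewrite /unorm hpK zpK mul_scalar_mx cnormZ gtr0_norm//.
rewrite invr0 !mulr0 expr0n !addr0 !sqrtr_sqr normrM gtr0_norm//.
Qed.

(** The distance is a length distance: a curve is cut into pieces shorter than eta, and the triangle
    inequality for Q adds the pieces up. Thus a map that is nonincreasing on small distances is so
    on all of them. *)
Lemma reach_intrinsic A rho (Q : H -> H -> R -> Prop) (eta : R) : 0 < eta ->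
  (forall g h k e e', Q g h e -> Q h k e' -> Q g k (e + e')) ->
  (forall g h e e', e <= e' -> Q g h e -> Q g h e') ->
  (forall g h e, e <= eta -> reach A rho g h e -> Q g h e) ->
  forall g h e, reach A rho g h e -> Q g h e.
Proof.
move=> eta0 Qtri Qmono Qloc g h e [c [u [P [W [l [arcu <- <- le]]]]]].
(* The slack e - (l 1 - l 0) is split in two: one sg is spent at the start and the other at constant
   rate along the curve, so that every piece satisfies a strict inequality. *)
pose sg := (e - (l 1 - l 0)) / 2; have sg0 : 0 < sg by rewrite /sg; lra.
suff : Q (c 0) (c 1) (l 1 - l 0 + sg * (1 + 1)).
  by apply: Qmono; rewrite /sg; lra.
apply: (interval_induction (P := fun t => Q (c 0) (c t) (l t - l 0 + sg * (1 + t)))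
  (@ler01 R)).
  apply: (@Qmono _ _ (Num.min sg eta)); first by rewrite ge_min subrr add0r addr0 mulr1 lexx.
  by apply: Qloc; [rewrite ge_min lexx orbT | apply: reach_refl; rewrite lt_min sg0].
move=> x x01; have e4 : 0 < eta / 4 by lra.
have [d d0 dP] := ac_cont (arc_ac_l arcu) x01 e4.
exists (Num.min d (eta / (8 * sg))).
  by rewrite lt_min d0 divr_gt0//; lra.
move=> t t' t0 tx xt' t'1.
have m1 : Num.min d (eta / (8 * sg)) <= d by rewrite ge_min lexx.
have m2 : Num.min d (eta / (8 * sg)) <= eta / (8 * sg) by rewrite ge_min lexx orbT.
move: (Num.min _ _) m1 m2 => D Dd Ds xt t'x Qt.
have [tt'|tt'] := ltP t t'; last first.
  by have <- : t = t' by lra.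
have sD : sg * (t' - t) <= eta / 4.
  have : sg * (t' - t) <= sg * (eta / (8 * sg) * 2) by rewrite ler_wpM2l; lra.
  by move=> /le_trans; apply; rewrite le_eqVlt; apply/orP; left; apply/eqP; field; lra.
have lt1 : `|l x - l t| < eta / 4.
  apply: dP; first by lra.
  by rewrite ger0_norm; lra.
have lt2 : `|l x - l t'| < eta / 4.
  apply: dP; first by lra.
  by rewrite distrC ger0_norm; lra.
have ll : l t' - l t < eta / 2.
  have := ler_norm (l x - l t); have := ler_norm (l t' - l x).
  by rewrite (distrC (l t')); lra.
have r1 : reach A rho (c t) (c t') (l t' - l t + sg * (t' - t)).
  apply: (@reach_of_arc _ _ _ _ t t' c u P W l) => //.
    exact: (arc_sub _ _ arcu).
  by rewrite ltrDl mulr_gt0// subr_gt0.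
have -> : l t' - l 0 + sg * (1 + t') =
  (l t - l 0 + sg * (1 + t)) + (l t' - l t + sg * (t' - t)) by ring.
by apply: Qtri Qt _; apply: Qloc => //; lra.
Qed.

End ReachMaps.

(** * Distances of central elements *)

Section VerticalDistance.
Variables (R : realType) (n : nat).
Local Notation H := (heis R n).
Variables (A : 'M[R]_(n + n)) (n0 : (0 < n)%N) (Au : A \in unitmx).

(** kap is the distance from 0 to Z for rho = 0: finite by [reach_upper] and positive by [reach_zp].
    Dilation by sqrt t, which sends Z to t Z, gives the other t > 0, and inversion gives t < 0. *)
Lemma reach0_vertical : exists2 kap : R, 0 < kap &
  forall t e, reach A 0 0 (hmk 0 t) e <-> kap * Num.sqrt `|t| < e.
Proof.
pose E := [set e | reach A 0 0 (hmk 0 1) e].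
have [C C0 hC] := reach_zp 0 Au.
have lbE : lbound E (C + 1)^-1.
  move=> e re; have e0 := reach_pos re; have := hC _ _ re.
  rewrite zpK normr0 normr1 addr0 => le.
  rewrite leNgt; apply/negP => lt.
  have C1 : 0 < C + 1 by lra.
  have h1 : (C + 1) * e < 1 by rewrite mulrC -ltr_pdivlMr// mul1r.
  have h2 : C * e * e <= C * e by rewrite ler_piMr ?mulr_ge0//; nra.
  by nra.
have neE : E !=set0.
  have [K _ hK] := reach_upper A 0 n0.
  by exists (cnorm A (hp (hmk 0 1 : H)) + K * Num.sqrt `|zp (hmk 0 1 : H)| + 1); apply: hK; rewrite ltrDl.
have hinf : has_inf E by split=> //; exists (C + 1)^-1.
exists (inf E).
  by apply: lt_le_trans (lb_le_inf neE lbE); rewrite invr_gt0; lra.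
have E1 e : reach A 0 0 (hmk 0 1) e <-> inf E < e.
  split=> [/reach_open[e' e'e re']|/(inf_lt neE)[e' re' e'e]].
    by apply: le_lt_trans e'e; apply: ge_inf => //; exists (C + 1)^-1.
  exact: reach_mono (ltW e'e) re'.
have E2 t e : 0 < t -> reach A 0 0 (hmk 0 t) e <-> inf E * Num.sqrt t < e.
  move=> t0; have s0 : 0 < Num.sqrt t by rewrite sqrtr_gt0.
  have ss : Num.sqrt t ^+ 2 = t by rewrite sqr_sqrtr// ltW.
  have h0 s : dil s 0 = 0 :> H.
    by apply: heisP; rewrite ?hp_dil ?zp_dil ?hp0 ?zp0 ?scaler0 ?mulr0.
  rewrite -ltr_pdivlMr//; split.
    have is0 : 0 < (Num.sqrt t)^-1 by rewrite invr_gt0.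
    move=> /(reach0_dil is0); rewrite h0 => r1; apply/E1.
    rewrite mulrC; move: r1; congr (reach A 0 0 _ _).
    by apply: heisP; rewrite ?hp_dil ?zp_dil ?hpK ?zpK ?scaler0// exprVn ss mulVf// gt_eqF.
  move=> /E1 /(reach0_dil s0); rewrite h0 mulrC divfK ?gt_eqF//.
  congr (reach A 0 0 _ _).
  by apply: heisP; rewrite ?hp_dil ?zp_dil ?hpK ?zpK ?scaler0// ss mulr1.
move=> t e; have [t0|t0|->] := ltgtP t 0.
- have hN : hinv (hmk 0 t) = hmk 0 (- t) :> H.
    by apply: heisP; rewrite ?hp_inv ?zp_inv ?hpK ?zpK ?oppr0.
  rewrite ltr0_norm// -E2 ?oppr_gt0// -hN; split; first exact: reach_inv.
  by move=> /reach_inv; rewrite hinvK.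
- by rewrite gtr0_norm//; exact: E2.
- rewrite normr0 sqrtr0 mulr0.
  have -> : hmk 0 0 = 0 :> H by apply: heisP; rewrite ?hpK ?zpK ?hp0 ?zp0.
  by split; [exact: reach_pos | exact: reach_refl].
Qed.

Variables (kap : R) (kap0 : 0 < kap).
Hypothesis hkap : forall t e, reach A 0 0 (hmk 0 t) e <-> kap * Num.sqrt `|t| < e.

(* Removing the vertical part of a control leaves a curve for rho = 0 whose end
   point is lowered by the vertical displacement w; the length l then satisfies
   l^2 >= kap^2 |t - w| + (w / rho)^2. *)
Lemma reach_vertical_lower rho t e : reach A rho 0 (hmk 0 t) e ->
  kap ^+ 2 * t - kap ^+ 4 * rho ^+ 2 / 4 < e ^+ 2.
Proof.
move=> [c [u [P [W [l [arcu c0 c1 le]]]]]].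
have L0 : 0 <= l 1 - l 0.
  by rewrite subr_ge0; apply: (arc_l_mono arcu) => //; exact: ler01.
pose p := P 1 - P 0; pose w := W 1 - W 0.
have p0 : kap * Num.sqrt `|t - w| <= p.
  apply/ler_addgt0Pr => eps eps0; apply/ltW/hkap.
  exists (fun s => hmk (hp (c s)) (zp (c s) - (W s - W 0))),
    (fun s => hmk (hp (u s)) 0), P, (fun=> 0), P.
  move: (arcu) => [h1 h2 h3 h4 h5 h6]; split.
  - split=> //; last 1 first.
    + apply: ae_imp h6 => s hs /hs[k1 k2 k3 k4 k5 k6]; split; rewrite ?hpK ?zpK//.
      * move=> j; rewrite (_ : (fun _ => _) = fun t => hp (c t) j ord0)//.
        by apply/funext => x; rewrite hpK.
      * rewrite (_ : (fun _ => _) = fun t => zp (c t) + -1 * W t + W 0).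
          rewrite [X in is_derive _ _ _ X](_ : _ = (zp (u s) +
            omega (hp (c s)) (hp (u s)) / 2) + -1 * zp (u s) + 0); last by ring.
          exact: derD (derD k2 (derZ _ k4)) (der_cst _ _).
        by apply/funext => x; rewrite zpK; ring.
      * exact: der_cst.
      * exists (cnorm A (hp (u s))) => //.
        by rewrite /unorm hpK zpK mul0r expr0n addr0 sqrtr_sqr ger0_norm ?cnorm_ge0.
    + move=> j; apply: (ac_eq (f := fun t => hp (c t) j ord0)) => // x _.
      by rewrite hpK.
    + apply: (ac_eq (f := fun t => zp (c t) - (W t - W 0))).
        by move=> x _; rewrite zpK.
      by apply: acB => //; apply: acB => //; exact: ac_cst.
    + exact: ac_cst.
  - by rewrite c0 hp0 zp0 subrr subr0; apply: heisP; rewrite ?hpK ?zpK ?hp0 ?zp0.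
  - by rewrite c1 hpK zpK.
  - by rewrite /p ltrDl.
have w0 : rho = 0 -> w = 0.
  move=> rho0; have key (s : R) : s * W 1 - s * W 0 <= 0 * (l 1 - l 0).
    apply: (@arc_bound _ _ _ _ _ _ _ _ _ _ _ (fun t => s * W t) _ _ _ (lexx 0) arcu) => //.
    - by apply: acZ; exact: (arc_ac_W arcu).
    - by move=> x _ ax; exists (s * zp (u x)); [exact: derZ (arc_W ax) |
        rewrite (arc_rho ax rho0) mulr0 mul0r].
  by have := key 1; have := key (-1); rewrite /w; lra.
pose q := w / rho.
(* Cauchy-Schwarz in the plane: with r = sqrt (p^2 + q^2), the functional p P + (q / rho) W grows at
   rate at most r times the norm of the control, while its total growth is r^2. *)
have pq : p ^+ 2 + q ^+ 2 <= (l 1 - l 0) ^+ 2.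
  pose r := Num.sqrt (p ^+ 2 + q ^+ 2).
  have pq0 : 0 <= p ^+ 2 + q ^+ 2 by rewrite addr_ge0// sqr_ge0.
  have r0 : 0 <= r := sqrtr_ge0 _.
  have r2 : r ^+ 2 = p ^+ 2 + q ^+ 2 by rewrite sqr_sqrtr.
  rewrite -r2 ler_pXn2r ?nnegrE//.
  have [->//|rn0] := eqVneq r 0.
  have rp : 0 < r by rewrite lt_neqAle eq_sym rn0.
  rewrite -(ler_pM2l rp) -expr2 r2.
  have -> : p ^+ 2 + q ^+ 2 = (p * P 1 + q / rho * W 1) - (p * P 0 + q / rho * W 0).
    by rewrite /p /q /w; ring.
  apply: (@arc_bound _ _ _ _ _ _ _ _ _ _ _ (fun t => p * P t + q / rho * W t) _ _ _ r0 arcu) => //.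
    by apply: acD; apply: acZ; [exact: (arc_ac_P arcu) | exact: (arc_ac_W arcu)].
  move=> x _ ax; exists (p * cnorm A (hp (u x)) + q / rho * zp (u x)).
    exact: derD (derZ _ (arc_P ax)) (derZ _ (arc_W ax)).
  rewrite /r /unorm -mulrA (mulrC rho^-1) -sqrtrM// (le_trans (ler_norm _))//.
  rewrite -sqrtr_sqr ler_wsqrtr//.
  move: (cnorm A _) (zp (u x) / rho) => x1 x2.
  rewrite -subr_ge0 (_ : _ - _ = (p * x2 - q * x1) ^+ 2) ?sqr_ge0//; ring.
have le2 : (l 1 - l 0) ^+ 2 < e ^+ 2.
  by rewrite ltr_pXn2r ?nnegrE//; apply: le_trans L0 (ltW le).
apply: le_lt_trans le2; apply: le_trans pq.
have p2 : kap ^+ 2 * (t - w) <= p ^+ 2.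
  apply: (@le_trans _ _ (kap ^+ 2 * `|t - w|)).
    by rewrite ler_wpM2l ?sqr_ge0// ler_norm.
  rewrite -[X in _ * X](@sqr_sqrtr _ `|t - w|)// -exprMn ler_pXn2r ?nnegrE//.
    by rewrite mulr_ge0 ?sqrtr_ge0// ltW.
  by apply: le_trans p0; rewrite mulr_ge0 ?sqrtr_ge0// ltW.
have [rho0|rho0] := eqVneq rho 0.
  rewrite (w0 rho0) subr0 in p2.
  have -> : kap ^+ 2 * t - kap ^+ 4 * rho ^+ 2 / 4 = kap ^+ 2 * t by rewrite rho0; ring.
  by have := sqr_ge0 q; lra.
(* Completing the square in q = w / rho: the value claimed is the minimum over w of kap^2 (t - w) +
   (w / rho)^2. *)
have -> : kap ^+ 2 * t - kap ^+ 4 * rho ^+ 2 / 4 =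
  kap ^+ 2 * (t - w) + q ^+ 2 - (q - kap ^+ 2 * rho / 2) ^+ 2.
  by rewrite /q; field.
by have := sqr_ge0 (q - kap ^+ 2 * rho / 2); lra.
Qed.

(** The minimum of kap^2 (t - w) + (w / rho)^2 is at w = kap^2 rho^2 / 2, and the lower bound on t
    makes t - w positive. A nearly minimizing curve to (t - w) Z for rho = 0 is completed by a
    vertical control proportional to the derivative of l, the equality case of Cauchy-Schwarz. *)
Lemma reach_vertical_upper rho t e : 0 < e -> kap ^+ 2 * rho ^+ 2 / 2 < t ->
  kap ^+ 2 * t - kap ^+ 4 * rho ^+ 2 / 4 < e ^+ 2 -> reach A rho 0 (hmk 0 t) e.
Proof.
move=> e0 at0 te; have [rho0|rho0] := eqVneq rho 0.
  have t0 : 0 < t by apply: le_lt_trans at0; rewrite rho0; lra.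
  have {}te : kap ^+ 2 * t < e ^+ 2 by apply: le_lt_trans te; rewrite rho0; lra.
  rewrite rho0.
  apply/hkap; rewrite gtr0_norm//.
  rewrite -(@ltr_pXn2r _ 2) ?nnegrE ?mulr_ge0 ?sqrtr_ge0 ?ltW//.
  by rewrite exprMn sqr_sqrtr// ltW.
pose w := kap ^+ 2 * rho ^+ 2 / 2; pose a := t - w.
have a0 : 0 < a by rewrite subr_gt0.
have w0 : 0 < w.
  by apply: divr_gt0; rewrite // mulr_gt0 ?(exprn_gt0 _ kap0)// exprn_even_gt0.
have ka : kap ^+ 2 * a + (w / rho) ^+ 2 < e ^+ 2.
  apply: le_lt_trans te; rewrite le_eqVlt; apply/orP; left; apply/eqP.
  by rewrite /a /w; field.
(* x^2 is the midpoint of kap^2 a and e^2 - (w / rho)^2, which leaves room for strict inequalities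
   on both sides. *)
pose x := Num.sqrt ((kap ^+ 2 * a + (e ^+ 2 - (w / rho) ^+ 2)) / 2).
have ka0 : 0 < kap ^+ 2 * a by rewrite mulr_gt0// exprn_gt0.
have x2 : x ^+ 2 = (kap ^+ 2 * a + (e ^+ 2 - (w / rho) ^+ 2)) / 2.
  by rewrite sqr_sqrtr//; lra.
have kx : kap * Num.sqrt `|a| < x.
  rewrite -(@ltr_pXn2r _ 2) ?nnegrE ?mulr_ge0 ?sqrtr_ge0 ?ltW//.
  by rewrite exprMn sqr_sqrtr// x2 gtr0_norm//; lra.
have [c [u [P [W [l [arcu c0 c1 lx]]]]]] := (hkap a x).2 kx.
pose L := l 1 - l 0.
have Lk : kap * Num.sqrt `|a| <= L.
  apply/ler_addgt0Pr => eps eps0; apply/ltW/hkap.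
  by exists c, u, P, W, l; split=> //; rewrite ltrDl.
have L0 : 0 < L.
  by apply: lt_le_trans Lk; rewrite mulr_gt0// sqrtr_gt0 gtr0_norm.
(* The vertical displacement w is distributed in proportion to l; the length majorant is then
   multiplied by k = sqrt (1 + (lam / rho)^2). *)
pose lam := w / L.
pose k := Num.sqrt (1 + (lam / rho) ^+ 2).
have k2 : k ^+ 2 = 1 + (lam / rho) ^+ 2.
  by rewrite sqr_sqrtr// addr_ge0// sqr_ge0.
move: (arcu) => [h1 h2 h3 h4 h5 h6].
exists (fun s => hmk (hp (c s)) (zp (c s) + lam * (l s - l 0))),
  (fun s => hmk (hp (u s)) (lam * 'D_1 l s)), P, (fun s => lam * l s), (fun s => k * l s).
split.
- split=> //; [ | | exact: acZ | exact: acZ | ].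
  + move=> j; apply: (ac_eq (f := fun t => hp (c t) j ord0)) => // y _.
    by rewrite hpK.
  + apply: (ac_eq (f := fun t => zp (c t) + lam * (l t - l 0))).
      by move=> y _; rewrite zpK.
    by apply: acD => //; apply: acZ; apply: acB => //; exact: ac_cst.
  + apply: ae_imp h6 => s hs /hs[k1 k3 k4 k5 [l' k6 k6'] k7].
    have Dl : 'D_1 l s = l' by exact: derive_val.
    split; rewrite ?hpK ?zpK ?Dl//.
    * move=> j; rewrite (_ : (fun _ => _) = fun t => hp (c t) j ord0)//.
      by apply/funext => y; rewrite hpK.
    * rewrite (_ : (fun _ => _) = fun t => zp (c t) + lam * l t + - (lam * l 0)).
        rewrite [X in is_derive _ _ _ X](_ : _ = (zp (u s) +
          omega (hp (c s)) (hp (u s)) / 2) + lam * l' + 0).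
          exact: derD (derD k3 (derZ _ k6)) (der_cst _ _).
        by rewrite k7//; ring.
      by apply/funext => y; rewrite zpK; ring.
    * exact: derZ k6.
    * exists (k * l'); first exact: derZ k6.
      have cl : cnorm A (hp (u s)) <= l' by apply: le_trans k6'; exact: cnorm_le_unorm.
      have l'0 : 0 <= l' := le_trans (cnorm_ge0 _ _) cl.
      have -> : k * l' = Num.sqrt ((1 + (lam / rho) ^+ 2) * l' ^+ 2).
        by rewrite sqrtrM ?addr_ge0 ?sqr_ge0// sqrtr_sqr ger0_norm.
      rewrite /unorm hpK zpK ler_wsqrtr// mulrDl mul1r; apply: lerD.
        by rewrite ler_pXn2r ?nnegrE// cnorm_ge0.
      by rewrite -exprMn le_eqVlt; apply/orP; left; apply/eqP; congr (_ ^+ 2); ring.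
    * by move=> r0; rewrite r0 eqxx in rho0.
- by rewrite c0 hp0 zp0 subrr mulr0 addr0; apply: heisP; rewrite ?hpK ?zpK ?hp0 ?zp0.
- rewrite c1 hpK zpK -/L /lam /a; congr hmk; field; lra.
- rewrite -mulrBr -/L.
  rewrite -(@ltr_pXn2r _ 2) ?nnegrE ?mulr_ge0 ?sqrtr_ge0 ?ltW// exprMn k2.
  have -> : (1 + (lam / rho) ^+ 2) * L ^+ 2 = L ^+ 2 + (w / rho) ^+ 2.
    rewrite /lam; field; rewrite rho0; lra.
  have : L ^+ 2 < x ^+ 2 by rewrite ltr_pXn2r ?nnegrE ?sqrtr_ge0// ltW.
  rewrite x2; lra.
Qed.

End VerticalDistance.

(** kap is common to rho and rho'. If rho^2 < rho'^2, the upper estimate for rho' and the lower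
    estimate for rho are incompatible at any integer k beyond the minimizer kap^2 rho'^2 / 2. *)
Lemma rho_determined (R : realType) (n : nat) (A : 'M[R]_(n + n)) (rho rho' : R) :
  (0 < n)%N -> A \in unitmx ->
  (forall (k : nat) e, reach A rho 0 (hmk 0 k%:R) e <-> reach A rho' 0 (hmk 0 k%:R) e) ->
  rho ^+ 2 = rho' ^+ 2.
Proof.
move=> n0 Au; have [kap kap0 hkap] := reach0_vertical n0 Au.
wlog rr : rho rho' / rho ^+ 2 < rho' ^+ 2.
  move=> H h; have [r1|r1|//] := ltgtP (rho ^+ 2) (rho' ^+ 2); first exact: H.
  by apply/esym/H => // k e; rewrite h.
move=> h; exfalso.
pose k := (Num.truncn (kap ^+ 2 * rho' ^+ 2 / 2)).+1.
have kk : kap ^+ 2 * rho' ^+ 2 / 2 < k%:R by exact: truncnS_gt.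
have k2 : 0 < kap ^+ 2 by rewrite exprn_gt0.
have rr' : kap ^+ 4 * rho ^+ 2 < kap ^+ 4 * rho' ^+ 2 by rewrite ltr_pM2l// exprn_gt0.
(* X is the midpoint of the two squared distances kap^2 k - kap^4 rho^2 / 4 and kap^2 k - kap^4
   rho'^2 / 4. *)
pose X := kap ^+ 2 * k%:R - kap ^+ 4 * (rho ^+ 2 + rho' ^+ 2) / 8.
have X0 : 0 < X.
  have : kap ^+ 2 * (kap ^+ 2 * rho' ^+ 2 / 2) < kap ^+ 2 * k%:R by rewrite ltr_pM2l.
  have : 0 <= kap ^+ 4 * rho ^+ 2.
    exact: mulr_ge0 (ltW (exprn_gt0 4 kap0)) (sqr_ge0 _).
  have -> : kap ^+ 2 * (kap ^+ 2 * rho' ^+ 2 / 2) = kap ^+ 4 * rho' ^+ 2 / 2 by ring.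
  by rewrite /X mulrDr; lra.
have e2 : Num.sqrt X ^+ 2 = X by rewrite sqr_sqrtr// ltW.
have e0 : 0 < Num.sqrt X by rewrite sqrtr_gt0.
have := reach_vertical_upper kap0 hkap e0 kk.
rewrite e2 => /(_ ltac:(rewrite /X mulrDr; lra)) /h.
move=> /(reach_vertical_lower kap0 hkap); rewrite e2 /X mulrDr; lra.
Qed.

(** * Lifting isometries *)

Section Lifting.
Variables (R : realType) (n : nat).
Local Notation H := (heis R n).
Implicit Types (g h y : H).

(** These sets are stable under [dil s] for 0 <= s <= 1 and exhaust the group. On each of them the
    number of short steps along dilations is uniform. *)
Definition box (A : 'M[R]_(n + n)) (K : R) (h : H) : Prop :=
  cnorm A (hp h) <= K /\ `|zp h| <= K.

Lemma box_self A h : box A (cnorm A (hp h) + `|zp h|) h.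
Proof. by split; [rewrite lerDl | rewrite lerDr cnorm_ge0]. Qed.

Lemma box_mono A K K' h : K <= K' -> box A K h -> box A K' h.
Proof. by move=> KK [h1 h2]; split; [exact: le_trans KK | exact: le_trans KK]. Qed.

Lemma box_dil A K s h : 0 <= s <= 1 -> box A K h -> box A K (dil s h).
Proof.
move=> /andP[s0 s1] [h1 h2]; split.
  by rewrite hp_dil cnormZ ger0_norm// (le_trans _ h1)// ler_piMl// cnorm_ge0.
rewrite zp_dil normrM ger0_norm ?sqr_ge0// (le_trans _ h2)// ler_piMl//.
by rewrite expr_le1.
Qed.

Lemma dil_dil0 s : dil s 0 = 0 :> H.
Proof. by apply: heisP; rewrite ?hp_dil ?zp_dil ?hp0 ?zp0 ?scaler0 ?mulr0. Qed.

(** Dilates of h have proportional horizontal parts, so consecutive ones differ by an element with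
    horizontal norm at most K / N and vertical part at most 2 K / N. The two terms of X make each
    cost in [reach_upper] less than eta / 2. *)
Lemma dil_steps A rho K eta : (0 < n)%N -> 0 <= K -> 0 < eta ->
  exists2 N : nat, (0 < N)%N & forall h i, box A K h -> (i < N)%N ->
    reach A rho (dil (i%:R / N%:R) h) (dil (i.+1%:R / N%:R) h) eta.
Proof.
move=> n0 K0 eta0; have [C C0 hC] := reach_upper A rho n0.
pose X := 2 * K / eta + 8 * C ^+ 2 * K / eta ^+ 2.
pose N := (Num.truncn X).+1; have NX : X < N%:R by exact: truncnS_gt.
have N0 : 0 < N%:R :> R by rewrite ltr0n.
have t1 : 0 <= 2 * K / eta by rewrite divr_ge0 ?mulr_ge0// ltW.
have t2 : 0 <= 8 * C ^+ 2 * K / eta ^+ 2.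
  by rewrite divr_ge0 ?sqr_ge0// !mulr_ge0 ?sqr_ge0.
have k1 : K / N%:R < eta / 2.
  rewrite ltr_pdivrMr//; have : 2 * K / eta < N%:R by rewrite /X in NX; lra.
  rewrite ltr_pdivrMr//; lra.
have k2 : C * Num.sqrt (2 * K / N%:R) < eta / 2.
  have e2 : 0 < eta / 2 by lra.
  have c1 : 0 <= C * Num.sqrt (2 * K / N%:R) by rewrite mulr_ge0// sqrtr_ge0.
  rewrite -(@ltr_pXn2r _ 2) ?nnegrE ?(ltW e2)// exprMn.
  rewrite sqr_sqrtr ?divr_ge0 ?mulr_ge0// ?ltW// mulrA ltr_pdivrMr//.
  have : 8 * C ^+ 2 * K / eta ^+ 2 < N%:R by rewrite /X in NX; lra.
  rewrite ltr_pdivrMr ?exprn_gt0//.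
  have -> : (eta / 2) ^+ 2 * N%:R = (N%:R * eta ^+ 2) / 4 by field.
  lra.
exists N => // h i [b1 b2] iN; set s := i%:R / N%:R; set s' := i.+1%:R / N%:R.
have ss : s' - s = N%:R^-1.
  by rewrite /s /s' -natr1; field; lra.
have s01 : 0 <= s <= 1.
  by rewrite /s divr_ge0 ?ler0n//= ler_pdivrMr// mul1r ler_nat ltnW.
have s'01 : 0 <= s' <= 1.
  by rewrite /s' divr_ge0 ?ler0n//= ler_pdivrMr// mul1r ler_nat.
have -> : dil s' h = hmul (dil s h) (hmk ((s' - s) *: hp h) ((s' ^+ 2 - s ^+ 2) * zp h)).
  apply: heisP; first by rewrite hp_mul !hp_dil hpK scalerBl addrC subrK.
  by rewrite zp_mul !hp_dil !zp_dil hpK zpK omegaZr omegaZl omegavv; ring.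
rewrite -[X in reach _ _ X]hmulg0; apply/reach_left/hC; rewrite hpK zpK ss.
have -> : s' ^+ 2 - s ^+ 2 = N%:R^-1 * (s' + s) by rewrite -ss; ring.
rewrite cnormZ normfV normr_nat mulrC.
apply: (@le_lt_trans _ _ (K / N%:R + C * Num.sqrt (2 * K / N%:R))); last lra.
apply: lerD; first by rewrite ler_wpM2r// invr_ge0 ler0n.
rewrite ler_wpM2l// ler_wsqrtr// !normrM normfV normr_nat.
have : `|s' + s| <= 2 by rewrite ger0_norm; lra.
move=> h1; rewrite -mulrA mulrC ler_wpM2r ?invr_ge0 ?ler0n//.
by apply: ler_pM.
Qed.

(* Lifts along the short steps of s |-> dil s h are unique as long as over is
   separated; over y h means that y lies above the image of h. *)
Section Lift.
Variables (A A' : 'M[R]_(n + n)) (rho rho' : R) (n0 : (0 < n)%N).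
Local Notation r := (reach A rho).
Local Notation r' := (reach A' rho').

(** Finitely many short steps along the dilations lead from 0 to h. This spreads an identity between
    lifts from 0 to the whole group. *)
Lemma dil_chain eta (Q : H -> Prop) : 0 < eta -> Q 0 ->
  (forall g h, r g h eta -> Q g -> Q h) -> forall h, Q h.
Proof.
move=> eta0 Q0 Qs h; have K0 : 0 <= cnorm A (hp h) + `|zp h|.
  by rewrite addr_ge0// cnorm_ge0.
have [N N0 hN] := dil_steps A rho n0 K0 eta0.
suff : forall i, (i <= N)%N -> Q (dil (i%:R / N%:R) h).
  by move=> /(_ N (leqnn _)); rewrite divff ?dil1// pnatr_eq0 -lt0n.
elim=> [|i IH] iN; first by rewrite mul0r dil0.
by apply: Qs (IH (ltnW iN)); apply: hN => //; exact: box_self.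
Qed.

Variables (over : H -> H -> Prop) (y0 : H) (eps0 : R).
Hypothesis eps00 : 0 < eps0.
Hypothesis over0 : over y0 0.
Hypothesis overS : forall y g h e, over y g -> r g h e ->
  exists2 y', over y' h & r' y y' e.
Hypothesis overI : forall y y' h, over y h -> over y' h -> r' y y' eps0 -> y = y'.

(** Advancing the lift by one step closes a quadrilateral with four sides of length eta; its
    perimeter has to stay within eps0 for [overI] to apply. *)
Let eta := eps0 / 4.
Let eta0 : 0 < eta. Proof. exact: divr_gt0. Qed.

Definition local_lift (D : H -> Prop) (F : H -> H) : Prop :=
  [/\ F 0 = y0, forall h, D h -> over (F h) h &
   forall g h e, D g -> D h -> e <= eta -> r g h e -> r' (F g) (F h) e].

Lemma local_lift_unique K F F' : 0 <= K ->
  local_lift (box A K) F -> local_lift (box A K) F' ->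
  forall h, box A K h -> F h = F' h.
Proof.
move=> K0 [F0 Fo Fl] [F'0 F'o F'l] h bh.
have [N N0 hN] := dil_steps A rho n0 K0 eta0.
suff : forall i, (i <= N)%N -> F (dil (i%:R / N%:R) h) = F' (dil (i%:R / N%:R) h).
  by move=> /(_ N (leqnn _)); rewrite divff ?dil1// pnatr_eq0 -lt0n.
have N0' : 0 < N%:R :> R by rewrite ltr0n.
have bi i : (i <= N)%N -> box A K (dil (i%:R / N%:R) h).
  move=> iN; apply: box_dil => //.
  by rewrite divr_ge0 ?ler0n//= ler_pdivrMr// mul1r ler_nat.
elim=> [|i IH] iN; first by rewrite mul0r dil0 F0 F'0.
have st := hN _ _ bh iN.
apply: overI (Fo _ (bi _ iN)) (F'o _ (bi _ iN)) _.
have := Fl _ _ _ (bi _ (ltnW iN)) (bi _ iN) (lexx _) st.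
have := F'l _ _ _ (bi _ (ltnW iN)) (bi _ iN) (lexx _) st.
rewrite -(IH (ltnW iN)) => r1 /reach_sym r2.
by apply: reach_mono (reach_tri r2 r1); have := eps00; rewrite /eta; lra.
Qed.

(** All dilation paths in the box are lifted at once, one step at a time, under the invariant that
    eta-close end points h have eta-close lifts. The invariant survives a step because dilations do
    not increase distances, and it excludes monodromy. *)
Lemma local_lift_box K : 0 <= K -> exists F, local_lift (box A K) F.
Proof.
move=> K0; have [N N0 hN] := dil_steps A rho n0 K0 eta0.
have N0' : 0 < N%:R :> R by rewrite ltr0n.
suff : forall i, (i <= N)%N -> exists Y : H -> H,
    [/\ Y 0 = y0, forall h, box A K h -> over (Y h) (dil (i%:R / N%:R) h) &
     forall g h, box A K g -> box A K h -> r g h eta -> r' (Y g) (Y h) eta].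
  move=> /(_ N (leqnn _))[Y]; rewrite divff ?pnatr_eq0 -?lt0n//.
  move=> [Y0 Yo Yl]; exists Y; split=> //.
    by move=> h bh; rewrite -{2}[h]dil1; exact: Yo.
  move=> g h e bg bh le rgh.
  have Yg := Yo _ bg; rewrite dil1 in Yg; have Yh := Yo _ bh; rewrite dil1 in Yh.
  have [y' y'h ry'] := overS Yg rgh.
  rewrite (overI Yh y'h)//.
  have := Yl _ _ bg bh (reach_mono le rgh) => /reach_sym r1.
  by apply: reach_mono (reach_tri r1 ry'); have := eps00; rewrite /eta in le *; lra.
have b0 : box A K 0 by split; rewrite ?hp0 ?zp0 ?cnorm0 ?normr0.
elim=> [|i IH] iN.
  exists (fun=> y0); split=> //; last by move=> *; exact: reach_refl.
  by move=> h _; rewrite mul0r dil0.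
have [Y [Y0 Yo Yl]] := IH (ltnW iN).
have /choice[Y' Y'P] : forall h, exists y', box A K h ->
    over y' (dil (i.+1%:R / N%:R) h) /\ r' (Y h) y' eta.
  move=> h; have [bh|nb] := pselect (box A K h); last by exists 0.
  by have [y' ov ry'] := overS (Yo _ bh) (hN _ _ bh iN); exists y'.
exists Y'; split.
- have [] := Y'P _ b0; rewrite Y0 dil_dil0 => ov1 r1.
  by apply/esym/(overI over0 ov1)/(reach_mono _ r1); have := eps00; rewrite /eta; lra.
- by move=> h bh; have [] := Y'P _ bh.
move=> g h bg bh rgh; have [ov1 r1] := Y'P _ bg; have [ov2 r2] := Y'P _ bh.
have s01 : 0 <= (i.+1%:R / N%:R : R) <= 1.
  by rewrite divr_ge0 ?ler0n//= ler_pdivrMr// mul1r ler_nat.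
(* y' is the point over the dilate of h that is close to the lift for g. The path through the two
   previous lifts bounds its distance to the lift for h by eps0, so both coincide. *)
have [y' ov3 r3] := overS ov1 (reach_dil s01 rgh).
rewrite (overI ov2 ov3)//.
have r4 := reach_tri (reach_sym r2) (reach_sym (Yl _ _ bg bh rgh)).
by apply: reach_mono (reach_tri (reach_tri r4 r1) r3); have := eps00; rewrite /eta; lra.
Qed.

(** The lifts on boxes of integer size agree by uniqueness and glue to one map. It preserves short
    distances on each box, and [reach_intrinsic] extends this to all distances. *)
Lemma lift_exists : exists F : H -> H,
  [/\ F 0 = y0, forall h, over (F h) h & forall g h e, r g h e -> r' (F g) (F h) e].
Proof.
have /choice[Fk FkP] : forall k : nat, exists F, local_lift (box A k%:R) F.
  by move=> k; exact: local_lift_box.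
pose kh (h : H) := (Num.truncn (cnorm A (hp h) + `|zp h|)).+1.
have bkh h : box A (kh h)%:R h.
  by apply: box_mono (box_self A h); apply/ltW/truncnS_gt.
have FkE k h : (kh h <= k)%N -> Fk k h = Fk (kh h) h.
  move=> kk; have [q1 q2 q3] := FkP k.
  apply: (local_lift_unique _ _ (FkP (kh h)) (bkh h)); first exact: ler0n.
  have sub g : box A (kh h)%:R g -> box A k%:R g.
    by apply: box_mono; rewrite ler_nat.
  split=> //; first by move=> g /sub; exact: q2.
  by move=> g h' e /sub b1 /sub b2; exact: q3.
exists (fun h => Fk (kh h) h); split.
- by have [] := FkP (kh 0).
- by move=> h; have [_ + _] := FkP (kh h); apply.
have tri g h k e e' := @reach_tri R n A' rho' (Fk (kh g) g) (Fk (kh h) h) (Fk (kh k) k) e e'.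
move=> g h e; apply: (@reach_intrinsic _ _ _ _
  (fun g h e => r' (Fk (kh g) g) (Fk (kh h) h) e) eta eta0 tri).
  by move=> g1 h1 e1 e2 le; exact: reach_mono.
move=> {}g {}h {}e le rgh; pose k := maxn (kh g) (kh h).
rewrite -(FkE k) ?leq_maxl// -(FkE k h) ?leq_maxr//.
have [_ _ q3] := FkP k; apply: q3 => //; apply: box_mono (bkh _); rewrite ler_nat.
  exact: leq_maxl.
exact: leq_maxr.
Qed.

End Lift.

Definition reach_separated A rho (G : set H) (eps : R) : Prop :=
  forall gam h, G gam -> reach A rho h (hmul gam h) eps -> gam = 0.

Lemma separated_orbit A rho G eps g1 g2 h : is_subgroup G -> reach_separated A rho G eps ->
  G g1 -> G g2 -> reach A rho (hmul g1 h) (hmul g2 h) eps -> g1 = g2.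
Proof.
move=> [G0 GM GV] sep G1 G2 rr.
have : hmul g2 (hinv g1) = 0.
  apply: (sep _ (hmul g1 h)); first by apply: (GM) => //; exact: GV.
  by rewrite hmulA hmulgKV.
by move=> /(congr1 (fun x => hmul x g1)); rewrite hmulgKV hmul0g.
Qed.

Section IsometryLift.
Variables (A A' : 'M[R]_(n + n)) (rho rho' : R) (n0 : (0 < n)%N).
Local Notation r := (reach A rho).
Local Notation r' := (reach A' rho').
Variables (G : set H) (eps : R).
Hypotheses (subG : is_subgroup G) (eps0 : 0 < eps).
Hypotheses (sep : reach_separated A rho G eps) (sep' : reach_separated A' rho' G eps).
Let G0 : G 0. Proof. by case: subG. Qed.
Let GM g h : G g -> G h -> G (hmul g h). Proof. by case: subG => _ + _; apply. Qed.
Let GV g : G g -> G (hinv g). Proof. by case: subG => _ _; apply. Qed.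

(** p only picks representatives and may jump; F corrects it by elements of G. The element relating
    F (gam h) to F h may a priori depend on h, but separation makes it constant in short steps, so
    the one found at 0 serves everywhere. *)
Lemma orbit_lift (p : H -> H) :
  (forall g h e, r g h e -> exists2 gam, G gam & r' (p g) (hmul gam (p h)) e) ->
  (forall gam h, G gam -> exists2 gam', G gam' & p (hmul gam h) = hmul gam' (p h)) ->
  exists F : H -> H,
  [/\ forall h, exists2 gam, G gam & F h = hmul gam (p h),
      forall g h e, r g h e -> r' (F g) (F h) e &
      forall gam, G gam -> exists2 gam', G gam' &
        forall h, F (hmul gam h) = hmul gam' (F h)].
Proof.
move=> pr pG.
pose over y h := exists2 gam, G gam & y = hmul gam (p h).
have [F [F0 Fo Fl]] : exists F : H -> H,
  [/\ F 0 = p 0, forall h, over (F h) h & forall g h e, r g h e -> r' (F g) (F h) e].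
  apply: (lift_exists n0 eps0).
  - by exists 0 => //; rewrite hmul0g.
  - move=> _ g h e [gam Gg ->] /pr[gam' Gg' r1].
    exists (hmul (hmul gam gam') (p h)); last by rewrite -hmulA; exact: reach_left.
    by exists (hmul gam gam') => //; exact: GM.
  - by move=> _ _ h [g1 G1 ->] [g2 G2 ->] /(separated_orbit subG sep' G1 G2) ->.
exists F; split=> // gam Gg.
have ex h : exists2 gam', G gam' & F (hmul gam h) = hmul gam' (F h).
  have [g1 G1 ->] := Fo (hmul gam h); have [g2 G2 ->] := Fo h.
  have [g3 G3 ->] := pG _ h Gg.
  exists (hmul (hmul g1 g3) (hinv g2)); first by apply: (GM); [exact: GM | exact: GV].
  by rewrite !hmulA hmulgKV.
have [gam' Gg' E0] := ex 0; exists gam' => //.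
have e2 : 0 < eps / 2 by exact: divr_gt0.
apply: (dil_chain n0 e2 E0) => g h rgh Eg.
have [g2 G2 Eh] := ex h; rewrite Eh.
have r1 := Fl _ _ _ (reach_left gam rgh); rewrite Eg Eh in r1.
have r2 := reach_tri (reach_sym (reach_left gam' (Fl _ _ _ rgh))) r1.
rewrite (separated_orbit subG sep' Gg' G2 (reach_mono _ r2))//; lra.
Qed.

End IsometryLift.

(* The isometry between the quotients enters through maps p and q between
   representatives of the cosets. *)
Lemma isometry_lift (A A' : 'M[R]_(n + n)) (rho rho' : R) (G : set H) (eps : R)
    (p q : H -> H) : (0 < n)%N -> is_subgroup G -> 0 < eps ->
  reach_separated A rho G eps -> reach_separated A' rho' G eps ->
  (forall g h e, reach A rho g h e ->
     exists2 gam, G gam & reach A' rho' (p g) (hmul gam (p h)) e) ->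
  (forall g h e, reach A' rho' g h e ->
     exists2 gam, G gam & reach A rho (q g) (hmul gam (q h)) e) ->
  (forall gam h, G gam -> exists2 gam', G gam' & p (hmul gam h) = hmul gam' (p h)) ->
  (forall gam h, G gam -> exists2 gam', G gam' & q (hmul gam h) = hmul gam' (q h)) ->
  (forall h, exists2 gam, G gam & q (p h) = hmul gam h) ->
  (forall h, exists2 gam, G gam & p (q h) = hmul gam h) ->
  exists F F' : H -> H,
  [/\ cancel F F', cancel F' F,
    (forall g h e, reach A rho g h e <-> reach A' rho' (F g) (F h) e),
    (forall gam, G gam -> exists2 gam', G gam' &
       forall h, F (hmul gam h) = hmul gam' (F h)) &
    (forall gam, G gam -> exists2 gam', G gam' &
       forall h, F' (hmul gam h) = hmul gam' (F' h))].
Proof.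
move=> n0 subG eps0 sep sep' pr qr pG qG qp pq.
have [G0 GM GV] := subG.
have [F [Fo Fl FG]] := orbit_lift n0 subG eps0 sep' pr pG.
have [F1 [F1o F1l F1G]] := orbit_lift n0 subG eps0 sep qr qG.
have e2 : 0 < eps / 2 by exact: divr_gt0.
(* A distance nonincreasing map that moves each point within its orbit is one translation by G: the
   translating element cannot change in a short step. Applied to F1 o F, it shows how F1 must be
   corrected to become a left inverse of F. *)
have cst (B : 'M[R]_(n + n)) (sg : R) (T : H -> H) : reach_separated B sg G eps ->
    (forall h, exists2 gam, G gam & T h = hmul gam h) ->
    (forall g h e, reach B sg g h e -> reach B sg (T g) (T h) e) ->
    exists2 gam, G gam & forall h, T h = hmul gam h.
  move=> sepB ex Tl; have [gam Gg T0] := ex 0; exists gam => //.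
  apply: (dil_chain n0 e2 T0 (A := B) (rho := sg)) => g h rgh Tg.
  have [g2 G2 Th] := ex h.
  have r1 := Tl _ _ _ rgh; rewrite Tg Th in r1.
  have r2 := reach_tri (reach_sym (reach_left gam rgh)) r1.
  by rewrite Th (separated_orbit subG sepB Gg G2 (reach_mono _ r2))//; lra.
have [g1 Gg1 F1F] : exists2 gam, G gam & forall h, F1 (F h) = hmul gam h.
  apply: (cst A rho (F1 \o F)) => //= [h|g h e /Fl/F1l//].
  have [a Ga ->] := F1o (F h); have [b Gb ->] := Fo h.
  have [c Gc ->] := qG _ (p h) Gb; have [d Gd ->] := qp h.
  by exists (hmul a (hmul c d)); rewrite ?hmulA//; apply: (GM) => //; exact: GM.
pose F' h := hmul (hinv g1) (F1 h).
have F'K : cancel F F' by move=> h; rewrite /F' F1F hmulKg.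
have F'l g h e : reach A' rho' g h e -> reach A rho (F' g) (F' h) e.
  by move=> /F1l; exact: reach_left.
have [g2 Gg2 FF'] : exists2 gam, G gam & forall h, F (F' h) = hmul gam h.
  apply: (cst A' rho' (F \o F')) => //= [h|g h e /F'l/Fl//].
  have [x Gx Ex] := FG _ (GV _ Gg1); have [a Ga Ea] := F1o h.
  have [y Gy Ey] := FG _ Ga; have [b Gb Eb] := Fo (q h); have [c Gc Ec] := pq h.
  exists (hmul x (hmul y (hmul b c))).
    by apply: (GM) => //; apply: (GM) => //; exact: GM.
  by rewrite /F' Ex Ea Ey Eb Ec !hmulA.
have g20 : g2 = 0.
  by apply: (@hmulIr _ _ (F 0)); rewrite -FF' F'K hmul0g.
have FK : cancel F' F by move=> h; rewrite FF' g20 hmul0g.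
exists F, F'; split=> //.
  move=> g h e; split; first exact: Fl.
  by move=> /F'l; rewrite !F'K.
move=> gam Gg; have [g3 Gg3 E3] := F1G _ Gg.
exists (hmul (hmul (hinv g1) g3) g1).
  by apply: (GM) => //; apply: (GM) => //; exact: GV.
by move=> h; rewrite /F' E3 !hmulA hmulgK.
Qed.

End Lifting.

(** * Paths in the quotient *)

Section Horizontal.
Variables (R : realType) (n : nat).
Local Notation H := (heis R n).
Local Notation mu := (@lebesgue_measure R).
Implicit Types (g h : H) (m : sr_metric R n).

Lemma linear_coord (L : {linear H -> H}) h i :
  L h i ord0 = \sum_k L (delta_mx k ord0) i ord0 * h k ord0.
Proof.
rewrite {1}(matrix_sum_delta h) linear_sum /= summxE; apply: eq_bigr => k _.
by rewrite big_ord1 linearZ mxE mulrC.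
Qed.

Lemma hpD g h : hp (g + h) = hp g + hp h. Proof. exact: linearD. Qed.
Lemma hpZ (a : R) g : hp (a *: g) = a *: hp g. Proof. exact: linearZ. Qed.
Lemma zpD g h : zp (g + h) = zp g + zp h. Proof. exact: linearD. Qed.
Lemma zpZ (a : R) g : zp (a *: g) = a * zp g. Proof. exact: linearZ. Qed.

Lemma dleft_is_linear g : linear (dleft g).
Proof.
move=> a u v; apply: heisP.
  by rewrite hp_dleft (hpD (a *: u)) (hpD (a *: dleft g u)) !hpZ !hp_dleft.
rewrite zp_dleft (hpD (a *: u)) (zpD (a *: u)) (zpD (a *: dleft g u)) hpZ !zpZ.
by rewrite !zp_dleft omegaDr omegaZr; ring.
Qed.
HB.instance Definition _ g := GRing.isLinear.Build R H H _ (dleft g) (dleft_is_linear g).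

Lemma hmul_dleft g h : hmul g h = g + dleft g h.
Proof. by rewrite /hmul /dleft addrA. Qed.

Lemma dleft_hmul g h u : dleft (hmul g h) u = dleft g (dleft h u).
Proof.
apply: heisP; first by rewrite !hp_dleft.
by rewrite !zp_dleft hp_dleft hp_mul omegaDl; ring.
Qed.

Definition bracket_morphism (M : 'M[R]_(n + n + 1)) : Prop :=
  forall v w, bracket (M *m v) (M *m w) = M *m bracket v w.

Lemma mulmx_hmul M g h : bracket_morphism M ->
  M *m hmul g h = hmul (M *m g) (M *m h).
Proof. by move=> bM; rewrite /hmul bM !mulmxDr -scalemxAr. Qed.

Lemma mulmx_dleft M g u : bracket_morphism M ->
  M *m dleft g u = dleft (M *m g) (M *m u).
Proof. by move=> bM; rewrite /dleft bM !mulmxDr -scalemxAr. Qed.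

Lemma horizontal_affine m m' M g a b c u : bracket_morphism M ->
  (forall v, v \in sr_dist m -> M *m v \in sr_dist m') ->
  horizontal m a b c u ->
  horizontal m' a b (fun t => hmul g (M *m c t)) (fun t => M *m u t).
Proof.
move=> bM dM [acc aec].
pose L : {linear H -> H} := dleft g \o mulmx M.
have LE t i : hmul g (M *m c t) i ord0 =
    g i ord0 + \sum_k L (delta_mx k ord0) i ord0 * c t k ord0.
  by rewrite hmul_dleft mxE -(linear_coord L).
split.
  move=> i; rewrite (_ : (fun _ => _) = fun t => g i ord0 +
      \sum_k L (delta_mx k ord0) i ord0 * c t k ord0).
    by apply: acD; [exact: ac_cst | apply: ac_sum => k; exact: acZ].
  by apply/funext => t; exact: LE.
apply: ae_imp aec => t ht /ht[ud dt]; split; first exact: dM.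
move=> i; rewrite (_ : (fun _ => _) = fun t => g i ord0 +
      \sum_k L (delta_mx k ord0) i ord0 * c t k ord0); last first.
  by apply/funext => s; exact: LE.
rewrite dleft_hmul -mulmx_dleft// -[dleft g _]/(L (dleft (c t) (u t))).
rewrite linear_coord -[X in is_derive _ _ _ X]add0r.
have d2 k := derZ (L (delta_mx k ord0) i ord0) (dt k).
exact: derD (der_cst _ _) (der_sum _ d2).
Qed.

Lemma bracket_morphism1 : bracket_morphism 1%:M.
Proof. by move=> v w; rewrite !mul1mx. Qed.

Lemma horizontal_left m g a b c u : horizontal m a b c u ->
  horizontal m a b (fun t => hmul g (c t)) u.
Proof.
have d1 : forall v, v \in sr_dist m -> 1%:M *m v \in sr_dist m.
  by move=> v; rewrite mul1mx.
move=> /(horizontal_affine g bracket_morphism1 d1); congr horizontal.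
  by apply/funext => t; rewrite mul1mx.
by apply/funext => t; rewrite mul1mx.
Qed.

Lemma horizontal_sub m a b a' b' c u : a <= a' -> b' <= b ->
  horizontal m a b c u -> horizontal m a' b' c u.
Proof.
move=> aa bb [h1 h2]; split; first by move=> i; exact: ac_sub (h1 i).
by apply: ae_imp h2 => t ht; rewrite in_itv /= => tab; apply: ht; rewrite in_itv /=; lra.
Qed.

Lemma horizontal_concat m a x b c1 c2 u : a <= x -> x <= b -> c1 x = c2 x ->
  horizontal m a x c1 u -> horizontal m x b c2 u ->
  horizontal m a b (fun t => if t <= x then c1 t else c2 t) u.
Proof.
move=> ax xb cx [h1 h2] [k1 k2].
have cE i : (fun t => (if t <= x then c1 t else c2 t) i ord0) =
    (fun t => if t <= x then c1 t i ord0 else c2 t i ord0).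
  by apply/funext => t; case: ifP.
split; first by move=> i; rewrite cE; apply: ac_concat => //; rewrite cx.
apply: ae_imp (ae_and (ae_neq x) (ae_and h2 k2)) => t [tx [ht kt]].
rewrite in_itv /= => /andP[at_ tb].
have [tx'|tx'] := ltP t x.
  have /ht[q1 q2] : t \in `[a, x] by rewrite in_itv /= at_ ltW.
  rewrite ltW//; split=> // i; rewrite cE.
  apply: (@der_eq_near _ (fun t => c1 t i ord0) _ (t - 1) x) => //; first lra.
  by move=> s /andP[_ sx]; rewrite ltW.
have {}tx' : x < t by rewrite lt_neqAle eq_sym tx.
have /kt[q1 q2] : t \in `[x, b] by rewrite in_itv /= tb ltW.
rewrite leNgt tx' /=; split=> // i; rewrite cE.
apply: (@der_eq_near _ (fun t => c2 t i ord0) _ x (t + 1)) => //; first lra.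
by move=> s /andP[xs _]; rewrite leNgt xs.
Qed.

Section Quotient.
Variables (G : set H) (subG : is_subgroup G).
Let G0 : G 0. Proof. by case: subG. Qed.
Let GM g h : G g -> G h -> G (hmul g h). Proof. by case: subG => _ + _; apply. Qed.
Let GV g : G g -> G (hinv g). Proof. by case: subG => _ _; apply. Qed.

Lemma hcoset_self h : hcoset G h h. Proof. by exists 0 => //; rewrite hmul0g. Qed.

Lemma hcoset_eqP g h : hcoset G g = hcoset G h <-> exists2 gam, G gam & g = hmul gam h.
Proof.
split=> [e|[gam Gg ->]].
  by have := hcoset_self g; rewrite e => -[gam Gg <-]; exists gam.
apply/seteqP; split=> _ [x Gx <-].
  by exists (hmul x gam); rewrite ?hmulA//; exact: (GM).
exists (hmul x (hinv gam)); first by apply: (GM) => //; exact: GV.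
by rewrite hmulA hmulgKV.
Qed.

(** Local lifts are glued by interval induction: where two of them meet they differ by an element of
    G, and left translation by it keeps the control u. *)
Lemma path_lifting m c u h : quotient_horizontal G m c u -> c 0 = hcoset G h ->
  exists c', [/\ horizontal m 0 1 c' u, c' 0 = h & c 1 = hcoset G (c' 1)].
Proof.
move=> qh c0.
apply: (interval_induction (P := fun t => exists c',
  [/\ horizontal m 0 t c' u, c' 0 = h & c t = hcoset G (c' t)]) (@ler01 R)).
  exists (fun=> h); split=> //; split; first by move=> i; exact: ac_cst.
  exists [set 0]; split; [exact: measurable_set1 | exact: lebesgue_measure_set1 |].
  move=> t /=; apply: contra_notP => t0; rewrite in_itv /= => t00.
  by exfalso; apply: t0; lra.
move=> x x01; have [d d0 [c2 [c2P h2]]] := qh x x01; exists d => //.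
move=> t t' t0 tx xt' t'1 xt t'x [c1 [h1 c10 c1t]].
have tt' := le_trans tx xt'.
have at_ : Num.max 0 (x - d) <= t by rewrite ge_max t0 ltW.
have t'b : t' <= Num.min 1 (x + d) by rewrite le_min t'1 ltW.
have := c1t; rewrite c2P ?at_ ?(le_trans tt')// => /esym/hcoset_eqP[gam Gg c1E].
exists (fun s => if s <= t then c1 s else hmul gam (c2 s)); split.
- apply: horizontal_concat => //.
  exact/horizontal_left/(horizontal_sub at_ t'b).
- by rewrite t0.
- rewrite c2P; last by rewrite t'b andbT (le_trans at_).
  case: ifP => [t't|_]; last first.
    by apply/esym/hcoset_eqP; exists gam.
  have -> : t' = t by lra.
  by rewrite c1E; apply/esym/hcoset_eqP; exists gam.
Qed.

Lemma quotient_dist_ltP m g h (e : R) :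
  (quotient_dist G m (hcoset G g) (hcoset G h) < e%:E)%E <->
  exists c u gam, [/\ horizontal m 0 1 c u, c 0 = g, G gam, c 1 = hmul gam h &
    (path_length m u < e%:E)%E].
Proof.
split.
  move=> /ereal_inf_lt[_ [c [u [qh c0 c1 ->]]] le].
  have [c' [h1 h2 h3]] := path_lifting qh c0.
  have [gam Gg E] : exists2 gam, G gam & c' 1 = hmul gam h.
    by apply/hcoset_eqP; rewrite -h3.
  by exists c', u, gam.
move=> [c [u [gam [hc c0 Gg c1 le]]]]; apply: le_lt_trans le.
apply: ereal_inf_lbound; exists (fun t => hcoset G (c t)), u; split=> //.
- move=> t0 t01; exists 1 => //; exists c; split=> //.
  apply: horizontal_sub hc.
    by rewrite le_max lexx.
  by rewrite ge_min lexx.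
- by rewrite c0.
- by rewrite c1; apply/hcoset_eqP; exists gam.
Qed.

End Quotient.
End Horizontal.

(** * Block metrics: comparison of [reach] with the quotient distance *)

Section MatrixMetric.
Variables (R : realType) (n : nat).
Local Notation H := (heis R n).
Local Notation mu := (@lebesgue_measure R).
Implicit Types (g h : H) (A : 'M[R]_(n + n)) (rho : R).

Lemma pair_mxE A rho h : pair_mx A rho *m h = hmk (A *m hp h) (rho * zp h).
Proof.
rewrite -{1}[h]hmkK /hmk /pair_mx mul_block_col !mul0mx addr0 add0r.
by congr col_mx; rewrite -scalar_mxM.
Qed.

Lemma dot0_split g h : dot0 g h = edot (hp g) (hp h) + zp g * zp h.
Proof.
rewrite /dot0 big_split_ord /= big_ord1; congr (_ + _).
by apply: eq_bigr => i _; rewrite !hpE.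
Qed.

Lemma norm0_split g : norm0 g = Num.sqrt (enorm (hp g) ^+ 2 + zp g ^+ 2).
Proof.
rewrite enorm_sq -[zp g ^+ 2]/(zp g * zp g) -dot0_split /norm0.
by congr Num.sqrt; apply: eq_bigr => i _; rewrite expr2.
Qed.

Lemma mem_pair_mx A rho u : A \in unitmx ->
  (u \in sr_dist (metric_of (pair_mx A rho))) <-> (rho = 0 -> zp u = 0).
Proof.
move=> Au; split.
  by move=> /mem_mx_image[v ->] ->; rewrite pair_mxE zpK mul0r.
move=> hu; apply/mem_mx_image; exists (hmk (invmx A *m hp u) (rho^-1 * zp u)).
rewrite pair_mxE hpK zpK mulKVmx//; apply: heisP; rewrite ?hpK ?zpK//.
have [r0|r0] := eqVneq rho 0; first by rewrite hu// !mulr0.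
by rewrite mulVKf.
Qed.

(** With 1 / 0 = 0, the block matrix B of A^-1 and 1 / rho selects the preimage orthogonal to the
    kernel in both coranks. *)
Lemma mx_norm_pair_mx A rho u : A \in unitmx -> (rho = 0 -> zp u = 0) ->
  Defs.mx_norm (pair_mx A rho) u = unorm A rho u.
Proof.
move=> Au hu; pose B := pair_mx (invmx A) rho^-1.
have ABu : pair_mx A rho *m (B *m u) = u.
  rewrite !pair_mxE hpK zpK mulKVmx//; apply: heisP; rewrite ?hpK ?zpK//.
  have [r0|r0] := eqVneq rho 0; first by rewrite hu// !mulr0.
  by rewrite mulVKf.
have orth k : pair_mx A rho *m k = 0 -> dot0 (B *m u) k = 0.
  rewrite pair_mxE => k0.
  have /(congr1 (mulmx (invmx A))) := congr1 (@hp R n) k0.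
  rewrite hpK mulKmx// hp0 mulmx0 => hk.
  have := congr1 (@zp R n) k0; rewrite zpK zp0 => /eqP.
  rewrite mulf_eq0 dot0_split hk pair_mxE hpK zpK /edot big1 ?add0r; last first.
    by move=> i _; rewrite [X in _ * X]mxE mulr0.
  by move=> /orP[|] /eqP ->; rewrite ?invr0 ?mul0r ?mulr0.
have [_ ->] := mx_norm_lift ABu orth.
by rewrite norm0_split pair_mxE hpK zpK /unorm /cnorm mulrC.
Qed.

Lemma sr_norm_pair_mx A rho u : A \in unitmx -> (rho = 0 -> zp u = 0) ->
  sr_norm (metric_of (pair_mx A rho)) u = unorm A rho u.
Proof.
move=> Au hu; rewrite /sr_norm /= /mx_prod subrr.
have h2 : rho = 0 -> zp (u + u) = 0 by move=> /hu uu; rewrite zpD uu addr0.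
have h0 : rho = 0 -> zp (0 : H) = 0 by rewrite zp0.
rewrite !mx_norm_pair_mx// -mulr2n -scaler_nat unormZ.
have -> : unorm A rho 0 = 0.
  by rewrite /unorm hp0 zp0 cnorm0 mul0r expr0n addr0 sqrtr0.
rewrite expr0n subr0 ger0_norm// exprMn.
have -> : 2 ^+ 2 * unorm A rho u ^+ 2 / 4 = unorm A rho u ^+ 2 by field.
by rewrite sqrtr_sqr ger0_norm ?unorm_ge0.
Qed.

Lemma horizontal_of_reach A rho g h e : A \in unitmx -> reach A rho g h e ->
  exists c u, [/\ horizontal (metric_of (pair_mx A rho)) 0 1 c u, c 0 = g, c 1 = h &
    (path_length (metric_of (pair_mx A rho)) u < e%:E)%E].
Proof.
move=> Au [c [u0 [P [W [l [arcu <- <- le]]]]]].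
pose m := metric_of (pair_mx A rho).
pose u t := if u0 t \in sr_dist m then u0 t else 0.
have um t : rho = 0 -> zp (u t) = 0.
  rewrite /u; case: ifP => [/(mem_pair_mx _ _ Au)//|_ _]; exact: zp0.
exists c, u; split=> //.
  split.
    move=> i; case: (splitP i) => j ij.
      have -> : i = lshift 1 j by apply: val_inj.
      rewrite (_ : (fun _ => _) = fun t => hp (c t) j ord0); first exact: (arc_ac_hp arcu).
      by apply/funext => t; rewrite hpE.
    have -> : i = iZ n by apply: val_inj; rewrite /= ij ord1.
    exact: (arc_ac_zp arcu).
  apply: ae_imp (arc_ae arcu) => t ht /ht[k1 k2 k3 k4 k5 k6].
  have ut : u t = u0 t by rewrite /u ifT//; apply/mem_pair_mx.
  rewrite ut; split; first exact/mem_pair_mx.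
  move=> i; case: (splitP i) => j ij.
    have -> : i = lshift 1 j by apply: val_inj.
    rewrite -hpE hp_dleft (_ : (fun _ => _) = fun t => hp (c t) j ord0)//.
    by apply/funext => s; rewrite hpE.
  have -> : i = iZ n by apply: val_inj; rewrite /= ij ord1.
  by rewrite -[dleft _ _ _ _]/(zp _) zp_dleft.
apply: (@le_lt_trans _ _ (l 1 - l 0)%:E); last by rewrite lte_fin.
rewrite /path_length; apply: integral_le_ac => //.
- by move=> t; exact: sqrtr_ge0.
- exact: (arc_ac_l arcu).
apply: ae_imp (arc_ae arcu) => t ht /ht[k1 k2 k3 k4 [l' k5 k5'] k6].
exists l' => //; rewrite sr_norm_pair_mx//; last exact: um.
by rewrite /u ifT//; apply/mem_pair_mx.
Qed.

Lemma measurable_mulmx_coord (p q : nat) (B : 'M[R]_(p, q)) (f : R -> 'cV[R]_q) i :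
  (forall j, measurable_fun [set: R] (fun t => f t j ord0)) ->
  measurable_fun [set: R] (fun t => (B *m f t) i ord0).
Proof.
move=> mf; rewrite (_ : (fun _ => _) = fun t => \sum_j B i j * f t j ord0).
  by apply: measurable_sum => j; apply: measurable_funM => //; exact: measurable_cst.
by apply/funext => t; rewrite mxE.
Qed.

Lemma measurable_sqrt (f : R -> R) : measurable_fun [set: R] f ->
  measurable_fun [set: R] (fun t => Num.sqrt (f t)).
Proof.
move=> mf; have ms : measurable_fun [set: R] (fun x : R => Num.sqrt x).
  by apply: continuous_measurable_fun; exact: sqrt_continuous.
exact: (measurableT_comp ms mf).
Qed.

Lemma measurable_cnorm A (f : R -> 'cV[R]_(n + n)) :
  (forall j, measurable_fun [set: R] (fun t => f t j ord0)) ->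
  measurable_fun [set: R] (fun t => cnorm A (f t)).
Proof.
move=> mf; rewrite /cnorm /enorm; apply: measurable_sqrt.
apply: measurable_sum => i; apply: measurable_funM; exact: measurable_mulmx_coord.
Qed.

(** The control is an arbitrary function constrained only almost everywhere. On a measurable set E
    of full measure it is read off from the derivative of c: its horizontal part directly, its
    vertical part after subtracting omega (hp c) (hp u) / 2. Hence it is measurable there. *)
Lemma horizontal_measurable_control (m : sr_metric R n) (c u : R -> H) : horizontal m 0 1 c u ->
  exists (E : set R), [/\ measurable E, E `<=` `]0, 1[,
    {ae mu, forall t, t \in `[0, 1] -> E t},
    (forall t, E t -> u t \in sr_dist m /\
       forall i, is_derive t (1 : R) (fun s => c s i ord0) (dleft (c t) (u t) i ord0)) &
    (forall j, measurable_fun [set: R] (fun t => hp (if t \in E then u t else 0) j ord0)) /\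
    measurable_fun [set: R] (fun t => zp (if t \in E then u t else 0))].
Proof.
move=> [acc [N [mN N0 NP]]].
pose E := `]0, 1[ `\` N.
have mE : measurable E by apply: measurableD.
have E01 : E `<=` `]0, 1[ by move=> t [].
have EP t : E t -> u t \in sr_dist m /\
    forall i, is_derive t (1 : R) (fun s => c s i ord0) (dleft (c t) (u t) i ord0).
  move=> [t01 Nt]; apply: contrapT => h; apply: Nt; apply: NP => /= h'; apply/h/h'.
  by move: t01; rewrite /= !in_itv /=; lra.
have mdl i : measurable_fun [set: R] ((fun t => dleft (c t) (u t) i ord0) \_ E).
  by apply: (measurable_derivative (acc i) mE E01) => t /EP[_]; apply.
have mhp j : measurable_fun [set: R] (fun t => hp (if t \in E then u t else 0) j ord0).
  rewrite (_ : (fun _ => _) = (fun t => dleft (c t) (u t) (lshift 1 j) ord0) \_ E)//.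
  apply/funext => t; rewrite patchE; case: ifP => _; last by rewrite hp0 mxE.
  by rewrite -hpE hp_dleft.
exists E; split=> //.
  have aeN : {ae mu, forall t, ~ N t} by exists N; split=> // t /contrapT.
  apply: ae_imp (ae_and aeN (ae_and (ae_neq 0) (ae_neq 1))) => t [Nt [t0 t1]].
  rewrite in_itv /= => /andP[t0' t1']; split=> //=.
  by rewrite in_itv /= !lt_neqAle t0' t1' eq_sym t0 t1.
split=> //; pose x (j : 'I_(n + n)) t := hp (c (Num.max 0 (Num.min t 1))) j ord0.
have mx j : measurable_fun [set: R] (x j).
  have -> : x j = fun t => c (Num.max 0 (Num.min t 1)) (lshift 1 j) ord0.
    by apply/funext => t; rewrite /x hpE.
  apply: continuous_measurable_fun; exact: (ac_clamp_continuous ler01 (acc _)).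
pose v (j : 'I_(n + n)) t := hp (if t \in E then u t else 0) j ord0.
rewrite (_ : (fun _ => _) = fun t => ((fun t => dleft (c t) (u t) (iZ n) ord0) \_ E) t -
  (\sum_(i < n) (x (lshift n i) t * v (rshift n i) t - x (rshift n i) t * v (lshift n i) t)) / 2).
  apply: measurable_funB => //; apply: measurable_funM; last exact: measurable_cst.
  by apply: measurable_sum => i; apply: measurable_funB;
    exact: measurable_funM (mx _) (mhp _).
apply/funext => t; rewrite patchE /v; case: ifPn => [|_].
  rewrite inE => Et; rewrite -[dleft _ _ _ _]/(zp _) zp_dleft.
  have := E01 _ Et; rewrite /= in_itv /= => /andP[t0 t1].
  by rewrite /x min_l ?max_r ?(ltW t0) ?(ltW t1)// addrK.
rewrite zp0 big1 ?mul0r ?subr0// => i _.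
by rewrite hp0 !mxE !mulr0 subrr.
Qed.

(** The control cut off outside E is measurable, and integrable because the length is finite.
    Primitives of its norm, horizontal speed and vertical part provide l, P and W. *)
Lemma reach_of_horizontal A rho c u e : A \in unitmx ->
  horizontal (metric_of (pair_mx A rho)) 0 1 c u ->
  (path_length (metric_of (pair_mx A rho)) u < e%:E)%E ->
  reach A rho (c 0) (c 1) e.
Proof.
move=> Au hc le; have [E [mE E01 aeE EP [mhp mzp]]] := horizontal_measurable_control hc.
pose v t : H := if t \in E then u t else 0.
have v0 t : rho = 0 -> zp (v t) = 0.
  rewrite /v; case: ifPn => [|_ _]; last exact: zp0.
  by rewrite inE => /EP[/(mem_pair_mx _ _ Au)].
have mc : measurable_fun [set: R] (fun t => cnorm A (hp (v t))).
  exact: measurable_cnorm.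
have mN : measurable_fun [set: R] (fun t => unorm A rho (v t)).
  apply: measurable_sqrt; apply: measurable_funD; apply: measurable_funX => //.
  by apply: measurable_funM => //; exact: measurable_cst.
have intle : (\int[mu]_t (unorm A rho (v t))%:E <=
    path_length (metric_of (pair_mx A rho)) u)%E.
  rewrite /path_length [leRHS]integral_mkcond; apply: le_integral_ge0 => t _.
    by rewrite lee_fin unorm_ge0.
  rewrite /v patchE; case: ifPn => tE.
    move: (tE); rewrite inE => Et; have [ud _] := EP _ Et.
    rewrite ifT.
      by rewrite lee_fin sr_norm_pair_mx//; exact/(mem_pair_mx _ _ Au).
    by rewrite inE /=; have := E01 _ Et; rewrite /= !in_itv /=; lra.
  have -> : unorm A rho 0 = 0.
    by rewrite /unorm hp0 zp0 cnorm0 mul0r expr0n addr0 sqrtr0.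
  by case: ifP => _ //; rewrite lee_fin sqrtr_ge0.
have intN : mu.-integrable setT (EFin \o (fun t => unorm A rho (v t))).
  apply/integrableP; split; first exact/measurable_EFinP.
  have intfin : (\int[mu]_t (unorm A rho (v t))%:E < +oo)%E.
    by apply: (le_lt_trans intle); apply: lt_trans le _; rewrite ltry.
  apply: le_lt_trans intfin; apply: le_integral_ge0 => t _ //=.
  by rewrite lee_fin ger0_norm// unorm_ge0.
have intP : mu.-integrable setT (EFin \o (fun t => cnorm A (hp (v t)))).
  apply: le_integrable intN => //; first exact/measurable_EFinP.
  move=> t _ /=; rewrite lee_fin !ger0_norm ?unorm_ge0 ?cnorm_ge0//.
  exact: cnorm_le_unorm.
have intW : mu.-integrable setT (EFin \o (fun t => zp (v t))).
  have intrN := integrableZl measurableT `|rho| intN.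
  apply: le_integrable intrN => //; first exact/measurable_EFinP.
  move=> t _ /=; rewrite lee_fin normrM normr_id (ger0_norm (unorm_ge0 _ _ _)).
  by apply: zp_le_unorm; exact: v0.
have [l [acl ael lB]] := primitive_exists intN.
have [P [acP aeP _]] := primitive_exists intP.
have [W [acW aeW _]] := primitive_exists intW.
have [acc _] := hc.
exists c, v, P, W, l; split=> //.
- split=> //.
  + move=> j; have := acc (lshift 1 j); congr abs_continuous.
    by apply/funext => t; rewrite hpE.
  + exact: (acc (iZ n)).
  + apply: ae_imp (ae_and aeE (ae_and ael (ae_and aeP aeW))) => t [tE [h1 [h2 h3]]].
    move=> /tE Et; have vt : v t = u t by rewrite /v mem_set.
    have [ud dc] := EP _ Et; split=> //.
    * move=> j; have := dc (lshift 1 j); rewrite -hpE hp_dleft vt.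
      by congr is_derive; apply/funext => s; rewrite hpE.
    * by have := dc (iZ n); rewrite -[dleft _ _ _ _]/(zp _) zp_dleft vt.
    * by exists (unorm A rho (v t)).
    * exact: v0.
- rewrite lB ?ler01// -lte_fin; apply: le_lt_trans le; apply: le_trans intle.
  rewrite /Rintegral fineK; last first.
    by apply: integrable_fin_num => //; exact: integrableS intN.
  apply: ge0_subset_integral => //; first exact/measurable_EFinP.
  by move=> t _; rewrite lee_fin unorm_ge0.
Qed.

Lemma quotient_dist_reach (G : set H) A rho g h e : is_subgroup G -> A \in unitmx ->
  (quotient_dist G (metric_of (pair_mx A rho)) (hcoset G g) (hcoset G h) < e%:E)%E <->
  exists2 gam, G gam & reach A rho g (hmul gam h) e.
Proof.
move=> subG Au; split.
  move=> /(quotient_dist_ltP subG)[c [u [gam [hc <- Gg c1 le]]]].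
  by exists gam; rewrite // -c1; exact: reach_of_horizontal le.
move=> [gam Gg /(horizontal_of_reach Au)[c [u [hc c0 c1 le]]]].
by apply/(quotient_dist_ltP subG); exists c, u, gam.
Qed.

End MatrixMetric.

(** * Isometries and normal forms *)

Section Isometries.
Variables (R : realType) (n : nat).
Local Notation H := (heis R n).
Implicit Types (g h : H) (m : sr_metric R n).

Lemma sr_norm0 m : sr_norm m 0 = 0.
Proof.
have := @sr_linear _ _ m 1 0 0 0 (mem0v _) (mem0v _) (mem0v _).
rewrite scale1r addr0 mul1r => h; have p0 : sr_prod m 0 0 = 0 by move: h; lra.
by rewrite /sr_norm p0 sqrtr0.
Qed.

(** Outside the subspace the values of [sr_prod] are arbitrary. Putting the control to 0 there does
    not increase the length and allows norms to be compared at every t. *)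
Lemma horizontal_in_dist m c u : horizontal m 0 1 c u -> exists u',
  [/\ horizontal m 0 1 c u', forall t, u' t \in sr_dist m &
      (path_length m u' <= path_length m u)%E].
Proof.
move=> [acc aec]; exists (fun t => if u t \in sr_dist m then u t else 0); split.
- split=> //; apply: ae_imp aec => t ht /ht[ud dc]; rewrite ud; split=> //.
- by move=> t; case: ifP => // _; exact: mem0v.
- apply: le_integral_ge0 => t _; rewrite lee_fin ?sqrtr_ge0//.
  by case: ifP => _ //; rewrite sr_norm0 sqrtr_ge0.
Qed.

Variables (G : set H) (subG : is_subgroup G).
Let GM g h : G g -> G h -> G (hmul g h). Proof. by case: subG => _ + _; apply. Qed.

Definition affmap (M : 'M[R]_(n + n + 1)) g h : H := hmul g (M *m h).

Lemma quotient_dist_affine_le m m' M g x y : bracket_morphism M ->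
  (forall v, v \in sr_dist m -> M *m v \in sr_dist m') ->
  (forall v, v \in sr_dist m -> sr_norm m' (M *m v) = sr_norm m v) ->
  (forall gam h, G gam -> exists2 gam', G gam' &
     affmap M g (hmul gam h) = hmul gam' (affmap M g h)) ->
  (quotient_dist G m' (hcoset G (affmap M g x)) (hcoset G (affmap M g y)) <=
   quotient_dist G m (hcoset G x) (hcoset G y))%E.
Proof.
move=> bM dM nM GT; apply: le_ereal_inf_tmp => _ [c [u [qh c0 c1 ->]]].
have [c' [h1 h2 h3]] := path_lifting subG qh c0.
have [u' [h4 h5 h6]] := horizontal_in_dist h1.
have {}h6 : (path_length m' (fun t => M *m u' t) <= path_length m u)%E.
  by apply: le_trans h6; apply: le_integral_ge0 => t _; rewrite lee_fin ?sqrtr_ge0// nM.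
apply: le_trans h6; apply: ereal_inf_lbound.
exists (fun t => hcoset G (affmap M g (c' t))), (fun t => M *m u' t); split; last by [].
- move=> t0 t01; exists 1 => //; exists (fun t => affmap M g (c' t)); split=> //.
  apply: horizontal_affine bM dM _; apply: horizontal_sub h4.
    by rewrite le_max lexx.
  by rewrite ge_min lexx.
- by rewrite h2.
- have /esym/(hcoset_eqP subG)[gam Gg ->] : hcoset G y = hcoset G (c' 1) by rewrite -h3 c1.
  have [gam' Gg' ->] := GT gam y Gg.
  by apply/(hcoset_eqP subG); exists gam'.
Qed.

(** The last two hypotheses say that gam |-> g (M gam) g^-1 and its inverse preserve G. So h |-> g
    (M h) and its inverse pass to cosets, and neither increases distances. *)
Lemma isometric_affine m m' M N g : bracket_morphism M ->
  M *m N = 1%:M ->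
  (forall v, v \in sr_dist m -> M *m v \in sr_dist m') ->
  (forall v, v \in sr_dist m' -> N *m v \in sr_dist m) ->
  (forall v, v \in sr_dist m -> sr_norm m' (M *m v) = sr_norm m v) ->
  (forall gam, G gam -> G (hmul (hmul g (M *m gam)) (hinv g))) ->
  (forall gam, G gam -> G (N *m hmul (hmul (hinv g) gam) g)) ->
  isometric G m m'.
Proof.
move=> bM MN dM dN nM GT GT'.
have NM : N *m M = 1%:M by exact: mulmx1C.
have NK h : M *m (N *m h) = h by rewrite mulmxA MN mul1mx.
have MK h : N *m (M *m h) = h by rewrite mulmxA NM mul1mx.
have bN : bracket_morphism N.
  by move=> v w; rewrite -[LHS]MK -bM !NK.
pose T := affmap M g; pose g' := N *m hinv g; pose T' := affmap N g'.
have TK h : T' (T h) = h.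
  by rewrite /T' /g' /affmap -mulmx_hmul// /T /affmap hmulKg MK.
have T'K h : T (T' h) = h.
  by rewrite /T /T' /affmap mulmx_hmul// !NK hmulVKg.
have hT gam h : G gam -> exists2 gam', G gam' & T (hmul gam h) = hmul gam' (T h).
  move=> Gg; exists (hmul (hmul g (M *m gam)) (hinv g)); first exact: GT.
  by rewrite /T /affmap mulmx_hmul// !hmulA hmulgKV.
have hT' gam h : G gam -> exists2 gam', G gam' & T' (hmul gam h) = hmul gam' (T' h).
  move=> Gg; exists (N *m hmul (hmul (hinv g) gam) g); first exact: GT'.
  rewrite /T' /affmap /g' -(mulmx_hmul _ h bN) -(mulmx_hmul _ (hmul gam h) bN).
  rewrite -mulmx_hmul//; congr (mulmx N _).
  by rewrite !hmulA hmulgK.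
have imE (U : H -> H) h (U' : H -> H) : cancel U U' -> cancel U' U ->
    (forall gam h, G gam -> exists2 gam', G gam' & U (hmul gam h) = hmul gam' (U h)) ->
    (forall gam h, G gam -> exists2 gam', G gam' & U' (hmul gam h) = hmul gam' (U' h)) ->
    U @` hcoset G h = hcoset G (U h).
  move=> UK U'K hU hU'; apply/seteqP; split => [_ [_ [gam Gg <-] <-]|_ [gam Gg <-]].
    by have [gam' Gg' ->] := hU gam h Gg; exists gam'.
  have [gam' Gg' E] := hU' gam (U h) Gg; rewrite UK in E.
  by exists (hmul gam' h); [exists gam' | rewrite -E U'K].
have fE h := imE T h T' TK T'K hT hT'.
have fE' h := imE T' h T T'K TK hT' hT.
exists (fun x => T @` x); split.
  split.
  - by move=> _ [h _ <-]; rewrite fE; exists (T h).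
  - move=> x y; rewrite !inE => -[h _ <-] [k _ <-]; rewrite !fE => E.
    by rewrite -(TK h) -(TK k) -!fE' E.
  - move=> _ [h _ <-]; exists (hcoset G (T' h)); first by exists (T' h).
    by rewrite fE T'K.
move=> _ _ [x _ <-] [y _ <-]; rewrite !fE; apply/eqP; rewrite eq_le; apply/andP; split.
  exact: (quotient_dist_affine_le x y bM dM nM hT).
have nN v : v \in sr_dist m' -> sr_norm m (N *m v) = sr_norm m' v.
  by move=> vd; rewrite -nM ?NK//; exact: dN.
have := quotient_dist_affine_le (T x) (T y) bN dN nN hT'.
by rewrite -![affmap N g' _]/(T' _) !TK.
Qed.

Lemma isometric_refl m : isometric G m m.
Proof.
exists id; split=> //; split => //.
by move=> x xq; exists x.
Qed.

Lemma isometric_trans m1 m2 m3 : isometric G m1 m2 -> isometric G m2 m3 ->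
  isometric G m1 m3.
Proof.
move=> [f [bf hf]] [f' [bf' hf']]; exists (f' \o f); split; first exact: set_bij_comp bf'.
have [ff _ _] := bf.
by move=> x y xq yq /=; rewrite hf' ?hf//; exact: ff.
Qed.

Lemma isometric_sym m1 m2 : isometric G m1 m2 -> isometric G m2 m1.
Proof.
move=> [f [[ff fi fs] hf]].
have /choice[f' f'P] : forall y, exists x, hquotient G y -> hquotient G x /\ f x = y.
  move=> y; have [/fs[x xq <-]|nq] := pselect (hquotient G y); first by exists x.
  by exists y.
exists f'; split.
  split.
  - by move=> y /f'P[].
  - move=> x y; rewrite !inE => /f'P[_ ex] /f'P[_ ey] E.
    by rewrite -ex -ey E.
  - move=> x xq; exists (f x); first exact: ff.
    have [q1 q2] := f'P _ (ff _ xq).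
    by apply: fi; rewrite ?inE.
move=> x y /f'P[xq ex] /f'P[yq ey].
by rewrite -{2}ex -{2}ey hf.
Qed.

Lemma isometry_class_eq m1 m2 : isometric G m1 m2 ->
  isometry_class G m1 = isometry_class G m2.
Proof.
move=> i12; apply/seteqP; split=> m [am im]; split=> //.
  exact: isometric_trans (isometric_sym i12) im.
exact: isometric_trans i12 im.
Qed.

Lemma isometry_class_isometric m1 m2 : admissible m2 ->
  isometry_class G m1 = isometry_class G m2 -> isometric G m1 m2.
Proof.
move=> a2 E; have : isometry_class G m2 m2 by split=> //; exact: isometric_refl.
by rewrite -E => -[].
Qed.

End Isometries.

(** * Cholesky factorization *)

Section Cholesky.
Variable R : realType.

(** Induction on the size. With pivot a and first column b, the Schur complement C - b b^T / a is
    positive definite, since its value at w is that of S at the vector (x, w) with x = - b^T w /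
    a. *)
Lemma cholesky (N : nat) (S : 'M[R]_N) : S^T = S ->
  (forall v : 'cV[R]_N, v != 0 -> 0 < (v^T *m S *m v) ord0 ord0) ->
  exists2 L : 'M[R]_N, L \in unitmx & S = L^T *m L.
Proof.
elim: N S => [|N IH] S sS pS.
  by exists 1%:M; rewrite ?unitmx1//; apply/matrixP => -[].
pose S' : 'M[R]_(1 + N) := S.
pose a := ulsubmx S' ord0 ord0; pose b : 'cV[R]_N := dlsubmx S'; pose C := drsubmx S'.
have aE : ulsubmx S' = a%:M by rewrite /a -mx11_scalar.
have bE : ursubmx S' = b^T by rewrite /b trmx_dlsub /S' sS.
have CE : C^T = C by rewrite /C trmx_drsub /S' sS.
have SE : S' = block_mx a%:M b^T b C by rewrite -aE -bE submxK.
have pS' (x : 'M[R]_1) (w : 'cV[R]_N) : col_mx x w != 0 ->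
    0 < ((col_mx x w)^T *m S' *m col_mx x w) ord0 ord0 by exact: pS.
have qE (x : 'M[R]_1) (w : 'cV[R]_N) : (col_mx x w)^T *m S' *m col_mx x w =
    a *: (x^T *m x) + w^T *m b *m x + (x^T *m b^T *m w + w^T *m C *m w).
  rewrite SE tr_col_mx mul_row_block mul_row_col !mulmxDl mul_mx_scalar.
  by rewrite -scalemxAl.
have a0 : 0 < a.
  have := pS' 1%:M 0; rewrite qE trmx0 !mul0mx mulmx0 !addr0 trmx1 mulmx1 => h.
  have := h _; rewrite !mxE eqxx mulr1; apply.
  by apply/eqP => /colP /(_ (lshift N ord0)); rewrite col_mxEu !mxE eqxx; apply/eqP/oner_neq0.
pose C' := C - a^-1 *: (b *m b^T).
have [||L' uL' CL'] := IH C'.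
- by rewrite /C' linearB linearZ /= trmx_mul trmxK CE.
- move=> w w0; have [x xE] : exists x : 'M[R]_1, x = - a^-1 *: (b^T *m w) by eexists.
  have := pS' x w; rewrite qE.
  have xT : x^T = x by apply/matrixP => i j; rewrite !ord1 mxE.
  have bT : w^T *m b = b^T *m w.
    by rewrite -[RHS]trmxK trmx_mul trmxK; apply/matrixP => i j; rewrite !ord1 [RHS]mxE.
  have -> : a *: (x^T *m x) + w^T *m b *m x + (x^T *m b^T *m w + w^T *m C *m w) =
      w^T *m C' *m w.
    rewrite xT -(mulmxA x) bT /C' mulmxBr mulmxBl -scalemxAr -scalemxAl.
    rewrite (mulmxA w^T) -(mulmxA (w^T *m b)) bT xE.
    rewrite -!scalemxAl -!scalemxAr !scalerA addrA -!scalerDl.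
    rewrite addrC -scaleNr; congr (_ + _ *: _).
    by field; rewrite gt_eqF.
  by apply; apply: contra w0 => /eqP/(congr1 dsubmx); rewrite col_mxKd linear0 => ->.
pose s := Num.sqrt a.
have s0 : s != 0 by rewrite gt_eqF// sqrtr_gt0.
have ss : s * s = a by rewrite -expr2 sqr_sqrtr// ltW.
pose L : 'M[R]_(1 + N) := block_mx s%:M (s^-1 *: b^T) 0 L'.
have uL : L \in unitmx.
  by rewrite unitmxE /L det_ublock det_scalar1 unitrM unitfE s0 /= -unitmxE.
suff SL : S' = L^T *m L by exists L.
have bs : (s^-1 *: b^T)^T = s^-1 *: b by rewrite linearZ /= trmxK.
rewrite SE /L tr_block_mx bs mulmx_block !trmx0 !mul0mx !mulmx0 !addr0.
rewrite tr_scalar_mx -scalar_mxM ss -CL' /C'.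
congr block_mx.
- by rewrite mul_scalar_mx scalerA mulfV// scale1r.
- by rewrite mul_mx_scalar scalerA mulfV// scale1r.
- by rewrite -scalemxAl -scalemxAr scalerA -invfM ss addrC subrK.
Qed.

End Cholesky.

(** * Reduction of admissible metrics to block form *)

Section NormalForm.
Variables (R : realType) (n : nat).
Local Notation H := (heis R n).
Local Notation V := ('cV[R]_(n + n)).
Implicit Types (g h : H) (k : V) (m : sr_metric R n).

Lemma mulmx_ext (p q : nat) (A B : 'M[R]_(p, q)) :
  (forall h : 'cV[R]_q, A *m h = B *m h) -> A = B.
Proof.
move=> AB; apply/matrixP => i j.
by have /matrixP/(_ i ord0) := AB (delta_mx j ord0); rewrite -!colE !mxE.
Qed.

Lemma hmkD v w x y : hmk (v + w) (x + y) = hmk v x + hmk w y :> H.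
Proof. by apply: heisP; rewrite ?hpD ?zpD ?hpK ?zpK. Qed.
Lemma hmkZ a v x : hmk (a *: v) (a * x) = a *: hmk v x :> H.
Proof. by apply: heisP; rewrite ?hpZ ?zpZ ?hpK ?zpK. Qed.
Lemma hmk0 x : hmk 0 x = x *: hZ R n.
Proof. by apply: heisP; rewrite ?hpZ ?zpZ ?hpK ?zpK ?hp_hZ ?zp_hZ ?scaler0 ?mulr1. Qed.

(** These maps are the inner automorphisms h |-> g^-1 h g with g = [hmk k 0]. *)
Lemma shear_mx k : exists M : 'M[R]_(n + n + 1),
  forall h, M *m h = hmk (hp h) (zp h + omega (hp h) k).
Proof.
pose L h : H := hmk (hp h) (zp h + omega (hp h) k).
have lL : linear L.
  move=> a g h; rewrite /L hpD zpD hpZ zpZ omegaDl omegaZl.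
  by rewrite -hmkZ -hmkD; congr hmk; ring.
pose L' : {linear H -> H} := HB.pack L (GRing.isLinear.Build R H H _ L lL).
exists (\matrix_(i, j) L' (delta_mx j ord0) i ord0) => h.
apply/matrixP => i j; have -> : j = ord0 by exact: ord1.
rewrite [LHS]mxE -[hmk _ _ _ _]/(L' h i ord0) (linear_coord L').
by apply: eq_bigr => l _; rewrite mxE.
Qed.

(** For g = [hmk k 0] the map h |-> g (M h) is the right translation h |-> h g. It commutes with the
    left action of G, so it descends to the quotient for every subgroup G. *)
Lemma isometric_shear (G : set H) m m' (k : V) (M : 'M[R]_(n + n + 1)) : is_subgroup G ->
  (forall h, M *m h = hmk (hp h) (zp h + omega (hp h) k)) ->
  (forall v, v \in sr_dist m <-> M *m v \in sr_dist m') ->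
  (forall v, v \in sr_dist m -> sr_norm m' (M *m v) = sr_norm m v) ->
  isometric G m m'.
Proof.
move=> subG ME dM nM; have [N NE] := shear_mx (- k).
have MN : M *m N = 1%:M.
  apply: mulmx_ext => h; rewrite -mulmxA mul1mx ME NE hpK zpK omegaNr.
  by rewrite subrK hmkK.
have NK h : M *m (N *m h) = h by rewrite mulmxA MN mul1mx.
have bM : bracket_morphism M.
  move=> v w; rewrite !bracketE !ME !hpK hpZ zpZ hp_hZ zp_hZ scaler0 omega0l addr0.
  by rewrite mulr1 hmk0.
apply: (isometric_affine (g := hmk k 0) subG bM MN) => //.
- by move=> v /dM.
- by move=> v vd; apply/dM; rewrite NK.
- move=> gam; congr G; rewrite ME.
  apply: heisP; first by rewrite !hp_mul hp_inv !hpK addrAC addrN add0r.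
  rewrite !zp_mul zp_inv !hp_mul hp_inv !hpK !zpK !omegaE (omega_antisym k (hp gam)).
  by field.
- move=> gam; congr G; rewrite NE.
  have E : hp (hmul (hmul (hinv (hmk k 0)) gam) (hmk k 0)) = hp gam.
    by rewrite !hp_mul hp_inv hpK addrAC addNr add0r.
  apply: heisP; rewrite ?hpK ?zpK E// !zp_mul !hp_mul zp_inv hp_inv hpK zpK !omegaE.
  by rewrite (omega_antisym k (hp gam)); field.
Qed.

(** Nondegeneracy of omega, with the representing vector written out in coordinates. *)
Lemma omega_repr (f : V -> R) : (forall a v w, f (a *: v + w) = a * f v + f w) ->
  exists k, forall v, omega v k = f v.
Proof.
move=> flin; pose e (j : 'I_(n + n)) : V := delta_mx j ord0.
have f0 : f 0 = 0 by have := flin 1 0 0; rewrite scale1r addr0 mul1r; lra.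
have fs v : f v = \sum_j v j ord0 * f (e j).
  rewrite {1}(matrix_sum_delta v).
  elim/big_rec2: _ => [//|j x y _ <-]; rewrite big_ord1.
  exact: flin.
pose q (s : 'I_n + 'I_n) := match s with
  | inl i => - f (e (rshift n i)) | inr i => f (e (lshift n i)) end.
exists (\col_(j < n + n) q (fintype.split j)).
move=> v; rewrite fs big_split_ord /= -big_split; apply: eq_bigr => i _ /=.
by rewrite !mxE (unsplitK (inl i)) (unsplitK (inr i)) /= mulrN opprK.
Qed.

Lemma sr_prodDl m u v w : u \in sr_dist m -> v \in sr_dist m -> w \in sr_dist m ->
  sr_prod m (u + v) w = sr_prod m u w + sr_prod m v w.
Proof. by move=> ud vd wd; have := sr_linear 1 ud vd wd; rewrite scale1r mul1r. Qed.

Lemma sr_prod0l m w : w \in sr_dist m -> sr_prod m 0 w = 0.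
Proof.
by move=> wd; have := sr_prodDl (mem0v _) (mem0v _) wd; rewrite addr0; lra.
Qed.

Lemma sr_prodZl m a u w : u \in sr_dist m -> w \in sr_dist m ->
  sr_prod m (a *: u) w = a * sr_prod m u w.
Proof.
move=> ud wd; have := sr_linear a ud (mem0v _) wd.
by rewrite addr0 sr_prod0l// addr0.
Qed.

(** Every bracket is a multiple of Z, so a subspace containing Z is closed under brackets and cannot
    generate anything larger. *)
Lemma hZ_notin_dist m : bracket_generating m -> corank m = 1 -> hZ R n \notin sr_dist m.
Proof.
move=> [s [sP sfull]] co; apply/negP => zD.
have bD v : iterated_bracket (sr_dist m) v -> v \in sr_dist m.
  by elim=> // v1 w1 _ _ _ _; rewrite bracketE; apply: memvZ.
have : (fullv <= sr_dist m)%VS by rewrite -sfull; apply/span_subvP => v /sP/bD.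
by move=> /dimvS; move: co; rewrite /corank; lia.
Qed.

(** The hyperplane is a complement of the line through Z, hence the graph of a linear form on R^2n,
    which omega represents by a vector k. *)
Lemma corank1_graph m : bracket_generating m -> corank m = 1 -> exists k,
  (forall v, hmk v (- omega v k) \in sr_dist m) /\
  (forall u, u \in sr_dist m -> zp u = - omega (hp u) k).
Proof.
move=> bg co; have ZD := hZ_notin_dist bg co.
have Zn0 : hZ R n != 0 by apply: contraNneq ZD => ->; exact: mem0v.
have capD : (sr_dist m :&: <[hZ R n]>)%VS = 0%VS.
  apply/eqP; rewrite -subv0; apply/subvP => x; rewrite memv_cap => /andP[xD].
  move=> /vlineP[a ax]; rewrite memv0; apply: contraNT ZD => x0.
  have a0 : a != 0 by apply: contraNneq x0 => a0; rewrite ax a0 scale0r.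
  by rewrite -(scalerK a0 (hZ R n)) -ax memvZ.
have full : (sr_dist m + <[hZ R n]>)%VS = fullv.
  apply/eqP; rewrite eqEdim subvf dimv_disjoint_sum// dim_vline Zn0.
  by move: co; rewrite /corank /=; lia.
have uniqf v x y : hmk v x \in sr_dist m -> hmk v y \in sr_dist m -> x = y.
  move=> hx hy; have := memvB hx hy.
  have -> : hmk v x - hmk v y = (x - y) *: hZ R n.
    by rewrite -hmk0; apply: heisP; rewrite ?hpD ?zpD ?hpK ?zpK linearN /= ?hpK ?zpK ?addrN.
  move=> hxy; apply/eqP; rewrite -subr_eq0; apply: contraNT ZD => xy0.
  by rewrite -(scalerK xy0 (hZ R n)) memvZ.
have /choice[f fP] : forall v, exists x, hmk v x \in sr_dist m.
  move=> v; have : hmk v 0 \in (sr_dist m + <[hZ R n]>)%VS by rewrite full memvf.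
  move=> /memv_addP[d dD [_ /vlineP[a ->] E]]; exists (- a).
  have -> : hmk v (- a) = d; last by [].
  have -> : d = hmk v 0 - a *: hZ R n by rewrite E addrK.
  by rewrite -scaleNr -hmk0 -hmkD addr0 add0r.
have [k kE] : exists k, forall v, omega v k = - f v.
  apply: omega_repr => a v w; rewrite mulrN -opprD; congr (- _).
  by apply: (uniqf (a *: v + w)) => //; rewrite hmkD hmkZ memvD ?memvZ.
exists k; split=> [v|u uD]; rewrite kE opprK//.
by apply: (uniqf (hp u)) => //; rewrite hmkK.
Qed.

(** Here the graph is the orthogonal complement of Z for the given scalar product. *)
Lemma corank0_graph m : corank m = 0 -> exists k,
  forall v, sr_prod m (hmk v (- omega v k)) (hZ R n) = 0.
Proof.
move=> co; have full u : u \in sr_dist m.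
  suff -> : sr_dist m = fullv by rewrite memvf.
  apply/eqP; rewrite eqEdim subvf /=.
  by have := dimvS (subvf (sr_dist m)); move: co; rewrite /corank; lia.
have Zn0 : hZ R n != 0.
  by apply/eqP => /(congr1 (@zp R n)); rewrite zp_hZ zp0; apply/eqP/oner_neq0.
have pZ := sr_pos (full _) Zn0; set p := sr_prod m _ _ in pZ.
have [k kE] : exists k, forall v, omega v k = sr_prod m (hmk v 0) (hZ R n) / p.
  apply: omega_repr => a v w; rewrite mulrA -mulrDl -sr_prodZl// -sr_prodDl//.
  by rewrite -hmkZ -hmkD mulr0 addr0.
exists k => v; rewrite kE.
have -> : hmk v (- (sr_prod m (hmk v 0) (hZ R n) / p)) =
    hmk v 0 + - (sr_prod m (hmk v 0) (hZ R n) / p) *: hZ R n.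
  by rewrite -hmk0 -hmkD addr0 add0r.
rewrite sr_prodDl// sr_prodZl// -/p mulNr divfK ?subrr//.
by rewrite gt_eqF.
Qed.

Lemma horizontal_gram m (B : V -> H) : (forall v, B v \in sr_dist m) ->
  (forall a v w, B (a *: v + w) = a *: B v + B w) -> (forall v, B v = 0 -> v = 0) ->
  exists2 A : 'M[R]_(n + n), A \in unitmx &
    forall v, sr_prod m (B v) (B v) = cnorm A v ^+ 2.
Proof.
move=> BD Blin Binj; pose e (j : 'I_(n + n)) : V := delta_mx j ord0.
pose S := \matrix_(i, j) sr_prod m (B (e i)) (B (e j)).
have sum1 v w : sr_prod m (B v) (B w) = \sum_i v i ord0 * sr_prod m (B (e i)) (B w).
  rewrite {1}(matrix_sum_delta v).
  elim/big_rec2: _ => [|j x y _ <-].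
    have B0 : B 0 = 0 by have := Blin (-1) 0 0; rewrite scaler0 addr0 scaleN1r addNr.
    by rewrite B0 sr_prod0l.
  by rewrite big_ord1 Blin sr_linear.
have SE v w : (v^T *m S *m w) ord0 ord0 = sr_prod m (B v) (B w).
  rewrite sum1 -mulmxA mxE; apply: eq_bigr => i _; rewrite mxE; congr (_ * _).
  rewrite sr_sym// sum1 mxE; apply: eq_bigr => j _.
  by rewrite mxE mulrC; congr (_ * _); rewrite sr_sym.
have [|v v0|L uL SL] := @cholesky R (n + n) S.
- by apply/matrixP => i j; rewrite !mxE sr_sym.
- rewrite SE; apply: sr_pos => //; apply: contraNneq v0 => /Binj ->; exact: eqxx.
exists (invmx L); first by rewrite unitmx_inv.
move=> v; rewrite -SE SL /cnorm invmxK enorm_sq edotE trmx_mul !mulmxA.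
by [].
Qed.

(** The shear along k carries the graph onto the horizontal hyperplane, and Cholesky on the graph
    yields A. In corank 0 the center is then orthogonal to that hyperplane, and rho = 1 / sqrt <Z,
    Z> makes rho Z a unit vector. *)
Lemma admissible_normal_form (G : set H) m : is_subgroup G -> admissible m ->
  exists (A : 'M[R]_(n + n)) (rho : R), [/\ A \in unitmx,
    isometric G m (metric_of (pair_mx A rho)),
    corank m = 0 -> rho != 0 & corank m = 1 -> rho = 0].
Proof.
move=> subG [bg co].
have mk k : (forall v, hmk v (- omega v k) \in sr_dist m) ->
    exists2 A : 'M[R]_(n + n), A \in unitmx &
    forall v, sr_prod m (hmk v (- omega v k)) (hmk v (- omega v k)) = cnorm A v ^+ 2.
  move=> BD; apply: (horizontal_gram (B := fun v => hmk v (- omega v k))) => //.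
    move=> a v w; rewrite -hmkZ -hmkD omegaDl omegaZl; congr hmk; ring.
  by move=> v /(congr1 (@hp R n)); rewrite hpK hp0.
have [co0|co1] : corank m = 0 \/ corank m = 1 by lia.
  have full u : u \in sr_dist m.
    suff -> : sr_dist m = fullv by rewrite memvf.
    apply/eqP; rewrite eqEdim subvf /=.
    by have := dimvS (subvf (sr_dist m)); move: co0; rewrite /corank; lia.
  have Zn0 : hZ R n != 0.
    by apply/eqP => /(congr1 (@zp R n)); rewrite zp_hZ zp0; apply/eqP/oner_neq0.
  have pZ := sr_pos (full _) Zn0; set p := sr_prod m _ _ in pZ.
  have [k kP] := corank0_graph co0; have [A Au AE] := mk k (fun v => full _).
  have [M ME] := shear_mx k.
  have s0 : Num.sqrt p != 0 by rewrite gt_eqF// sqrtr_gt0.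
  have rho0 : (Num.sqrt p)^-1 != 0 by rewrite invr_eq0.
  exists A, (Num.sqrt p)^-1; split=> //; last by rewrite co0.
  apply: (isometric_shear subG ME) => [v|u _].
    by split=> // _; apply/(mem_pair_mx _ _ Au) => r0; rewrite r0 eqxx in rho0.
  rewrite sr_norm_pair_mx//; last by move=> r0; rewrite r0 eqxx in rho0.
  rewrite /unorm /sr_norm ME hpK zpK invrK exprMn (sqr_sqrtr (ltW pZ)).
  congr Num.sqrt; set t := zp u + _; set b := hmk (hp u) (- omega (hp u) k).
  have uE : u = b + t *: hZ R n.
    rewrite -hmk0 -hmkD addr0 /t addrC addrK hmkK//.
  have bZ : sr_prod m b (hZ R n) = 0 by exact: kP.
  rewrite [in RHS]uE sr_prodDl// (sr_sym (full b))// sr_prodDl// !sr_prodZl//.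
  rewrite (sr_sym (full (hZ R n)) (full (_ + _))) sr_prodDl// sr_prodZl//.
  by rewrite (sr_sym (full (hZ R n)) (full b)) bZ AE -/p; ring.
have [k [kD kz]] := corank1_graph bg co1; have [A Au AE] := mk k kD.
have [M ME] := shear_mx k.
exists A, 0; split=> //; last by rewrite co1.
have zM u : u \in sr_dist m -> zp (M *m u) = 0.
  by move=> /kz uz; rewrite ME zpK uz addNr.
apply: (isometric_shear subG ME) => [v|u uD].
  split; first by move=> /zM vz; apply/(mem_pair_mx _ _ Au).
  move=> /(mem_pair_mx _ _ Au)/(_ erefl); rewrite ME zpK => /eqP.
  by rewrite addr_eq0 => /eqP vz; rewrite -(hmkK v) vz.
rewrite sr_norm_pair_mx//; last by rewrite zM.
rewrite /unorm zM// mul0r expr0n addr0 ME hpK -AE /sr_norm.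
by rewrite -(kz _ uD) hmkK.
Qed.

Lemma corank_pair_mx (A : 'M[R]_(n + n)) (rho : R) : A \in unitmx ->
  corank (metric_of (pair_mx A rho)) = (rho == 0).
Proof.
move=> Au; have [->|r0] := eqVneq rho 0; last first.
  rewrite /corank (_ : sr_dist _ = fullv) ?subnn//.
  apply/vspaceP => u; rewrite memvf; apply/(mem_pair_mx _ _ Au) => r1.
  by rewrite r1 eqxx in r0.
rewrite /corank; set D := sr_dist _.
have DP u : u \in D <-> zp u = 0.
  by rewrite (mem_pair_mx _ _ Au); split=> // -> //.
have Zn0 : hZ R n != 0.
  by apply/eqP => /(congr1 (@zp R n)); rewrite zp_hZ zp0; apply/eqP/oner_neq0.
have capD : (D :&: <[hZ R n]>)%VS = 0%VS.
  apply/eqP; rewrite -subv0; apply/subvP => x; rewrite memv_cap => /andP[/DP xD].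
  move=> /vlineP[a ax]; move: xD; rewrite ax zpZ zp_hZ mulr1 => ->.
  by rewrite scale0r mem0v.
have full : (D + <[hZ R n]>)%VS = fullv.
  apply/vspaceP => u; rewrite memvf; apply/memv_addP.
  exists (hmk (hp u) 0); first by apply/DP; rewrite zpK.
  exists (zp u *: hZ R n); first by rewrite memvZ// memv_line.
  by rewrite -hmk0 -hmkD addr0 add0r hmkK.
rewrite -full dimv_disjoint_sum// dim_vline Zn0 /=; lia.
Qed.

Lemma bracket_generating_pair_mx (A : 'M[R]_(n + n)) (rho : R) : (0 < n)%N -> A \in unitmx ->
  bracket_generating (metric_of (pair_mx A rho)).
Proof.
move=> n0 Au; pose D := sr_dist (metric_of (pair_mx A rho)).
have [i0] : exists i : 'I_n, true by exists (Ordinal n0).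
pose s := (vbasis D : seq H) ++ [:: bracket (hX R i0) (hY R i0)].
have zX : zp (hX R i0) = 0.
  by rewrite /zp mxE; case: eqP => // /eqP; rewrite /iZ /iX eq_rlshift.
have zY : zp (hY R i0) = 0.
  by rewrite /zp mxE; case: eqP => // /eqP; rewrite /iZ /iY eq_rlshift.
have bZ : bracket (hX R i0) (hY R i0) = hZ R n.
  rewrite /bracket (bigD1 i0)//= big1 ?addr0; last first.
    move=> i ii0; rewrite !mxE /iX /iY !eq_lshift !eq_rlshift (negbTE ii0) /=.
    by rewrite !mul0r subrr.
  rewrite !mxE !eqxx /iX /iY !eq_lshift eq_rlshift /=.
  by rewrite mulr1 mul0r subr0 scale1r.
exists s; split.
  move=> v; rewrite mem_cat mem_seq1 => /orP[vs|/eqP ->].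
    by apply: iterated_base; exact: vbasis_mem.
  by apply: iterated_step; apply: iterated_base; apply/(mem_pair_mx _ _ Au).
apply/vspaceP => u; rewrite memvf span_cat span_seq1 bZ (span_basis (vbasisP _)).
apply/memv_addP; exists (hmk (hp u) 0).
  by apply/(mem_pair_mx _ _ Au) => _; rewrite zpK.
exists (zp u *: hZ R n); first by rewrite memvZ// memv_line.
by rewrite -hmk0 -hmkD addr0 add0r hmkK.
Qed.

End NormalForm.

(** * The lattice and its double cosets *)

Section Lattice.
Variables (R : realType) (n : nat) (r : 'I_n -> nat).
Local Notation H := (heis R n).
Local Notation V := ('cV[R]_(n + n)).
Local Notation D := (diag_r R r).
Local Notation ivec w := (map_mx (intr : int -> R) w).
Implicit Types (g h : H) (v : V) (w : 'cV[int]_(n + n)) (S : 'M[R]_(n + n)).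

(** The central coordinate of the product of the X part of v by its Y part. Subtracting it passes
    from exponential coordinates to coordinates in which the center of the lattice contributes plain
    integers. *)
Definition qf v : R := (\sum_(i < n) v (lshift n i) ord0 * v (rshift n i) ord0) / 2.

Definition lat : set H := [set h | exists w (c : int),
  hp h = D *m ivec w /\ zp h = c%:~R + qf (hp h)].

Lemma diag_rE (v : V) :
  (forall i, (D *m v) (lshift n i) ord0 = (r i)%:R * v (lshift n i) ord0) /\
  (forall i, (D *m v) (rshift n i) ord0 = v (rshift n i) ord0).
Proof.
split=> i; rewrite /diag_r mul_diag_mx mxE.
  by rewrite row_mxEl mxE.
by rewrite row_mxEr mxE mul1r.
Qed.

Lemma lat_cross w1 w2 : \sum_(i < n) (D *m ivec w1) (lshift n i) ord0 *
    (D *m ivec w2) (rshift n i) ord0 =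
  (\sum_(i < n) (r i)%:Z * w1 (lshift n i) ord0 * w2 (rshift n i) ord0)%:~R.
Proof.
rewrite rmorph_sum; apply: eq_bigr => i _ /=.
by rewrite (diag_rE _).1 (diag_rE _).2 !mxE !rmorphM /= -pmulrn.
Qed.

(** The defect of additivity of qf is the term omega / 2 of the group law plus a cross sum, which is
    an integer on lattice vectors by [lat_cross]; hence [lat] is closed under products. *)
Lemma qfD v1 v2 : qf (v1 + v2) = qf v1 + qf v2 + omega v1 v2 / 2 +
  \sum_(i < n) v2 (lshift n i) ord0 * v1 (rshift n i) ord0.
Proof.
pose X v := \sum_(i < n) v (lshift n i) ord0 * v (rshift n i) ord0.
have : X (v1 + v2) = X v1 + X v2 + omega v1 v2 +
    2 * \sum_(i < n) v2 (lshift n i) ord0 * v1 (rshift n i) ord0.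
  rewrite /X /omega mulr_sumr -!big_split; apply: eq_bigr => i _ /=.
  by rewrite !mxE; ring.
by rewrite /qf -/(X (v1 + v2)) -/(X v1) -/(X v2) => ->; field.
Qed.

Lemma qfN v : qf (- v) = qf v.
Proof. by rewrite /qf; congr (_ / 2); apply: eq_bigr => i _; rewrite !mxE mulrNN. Qed.

Lemma qf0 : qf 0 = 0.
Proof. by rewrite /qf big1 ?mul0r// => i _; rewrite !mxE mul0r. Qed.

Lemma lat_subgroup : is_subgroup lat.
Proof.
split.
- by exists 0, 0; rewrite hp0 zp0 qf0 map_mx0 mulmx0 addr0.
- move=> g h [w1 [c1 [e1 z1]]] [w2 [c2 [e2 z2]]].
  exists (w1 + w2), (c1 + c2 - \sum_(i < n) (r i)%:Z * w2 (lshift n i) ord0 * w1 (rshift n i) ord0).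
  rewrite hp_mul zp_mul qfD {1}e1 {1}e2 map_mxD mulmxDr; split=> //.
  by rewrite z1 z2 rmorphB rmorphD /= -lat_cross -e1 -e2; ring.
- move=> g [w [c [e z]]].
  exists (- w), (- c - \sum_(i < n) (r i)%:Z * w (lshift n i) ord0 * w (rshift n i) ord0).
  rewrite hp_inv zp_inv qfN {1}e map_mxN mulmxN; split=> //.
  by rewrite z rmorphB rmorphN /= -lat_cross -e /qf; field.
Qed.

Lemma lattice_subgroup : is_subgroup (lattice R r).
Proof.
split.
- by move=> S [[S0 _ _] _].
- move=> g h gL hL S SS; have [[_ SM _] _] := SS.
  by apply: SM; [exact: gL | exact: hL].
- by move=> g gL S SS; have [[_ _ SV] _] := SS; apply: SV; exact: gL.
Qed.

Lemma lattice_ind (K : set H) : is_subgroup K -> lattice_gens r `<=` K ->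
  lattice R r `<=` K.
Proof. by move=> sK gK h; apply. Qed.

Lemma hp_hX i : hp (hX R i) = delta_mx (lshift n i) ord0.
Proof. by apply/matrixP => j k; rewrite ord1 hpE !mxE eq_lshift. Qed.
Lemma hp_hY i : hp (hY R i) = delta_mx (rshift n i) ord0.
Proof. by apply/matrixP => j k; rewrite ord1 hpE !mxE eq_lshift. Qed.
Lemma zp_hX (i : 'I_n) : zp (hX R i) = 0.
Proof. by rewrite /zp mxE /iZ /iX eq_rlshift. Qed.
Lemma zp_hY (i : 'I_n) : zp (hY R i) = 0.
Proof. by rewrite /zp mxE /iZ /iY eq_rlshift. Qed.

Lemma ivec_delta j : ivec (delta_mx j ord0) = delta_mx j ord0 :> V.
Proof. by apply/matrixP => i k; rewrite !mxE rmorph_nat. Qed.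

Lemma diag_r_delta :
  (forall i, D *m delta_mx (lshift n i) ord0 = (r i)%:R *: hp (hX R i)) /\
  (forall i, D *m delta_mx (rshift n i) ord0 = hp (hY R i)).
Proof.
have dE j (x : 'I_(n + n)) : (delta_mx j ord0 : V) x ord0 = (x == j)%:R.
  by rewrite mxE andbT.
split=> i; rewrite ?hp_hX ?hp_hY; apply/matrixP => j k; have -> : k = ord0 by exact: ord1.
  rewrite /diag_r mul_diag_mx [LHS]mxE [RHS]mxE dE.
  by case: eqP => [->|_]; rewrite ?mulr0// row_mxEl mxE.
rewrite /diag_r mul_diag_mx [LHS]mxE dE.
by case: eqP => [->|_]; rewrite ?mulr0// row_mxEr mxE mulr1.
Qed.

Lemma lattice_gensP g : lattice_gens r g ->
  (exists2 j, g = hmk (D *m delta_mx j ord0) 0 & qf (hp g) = 0) \/ g = hZ R n.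
Proof.
have [dX dY] := diag_r_delta.
have q0 i : qf (hp (hX R i)) = 0 /\ qf (hp (hY R i)) = 0.
  rewrite hp_hX hp_hY /qf; split; rewrite big1 ?mul0r// => j _; rewrite !mxE.
    by rewrite eq_rlshift mulr0.
  by rewrite eq_lrshift mul0r.
move=> [[i ->]|[[i ->]|->]]; [left|left|by right].
  exists (lshift n i).
    by rewrite dX; apply: heisP; rewrite ?hpZ ?zpZ ?hpK ?zpK ?zp_hX ?mulr0.
  rewrite hpZ /qf big1 ?mul0r// => j _; rewrite hp_hX !mxE.
  by rewrite eq_rlshift !mulr0.
exists (rshift n i); last exact: (q0 i).2.
by rewrite dY; apply: heisP; rewrite ?hpK ?zpK ?zp_hY.
Qed.

Lemma lat_hmk w (c : int) : lat (hmk (D *m ivec w) (c%:~R + qf (D *m ivec w))).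
Proof. by exists w, c; rewrite hpK zpK. Qed.

Lemma lattice_sub_lat : lattice R r `<=` lat.
Proof.
apply: (lattice_ind lat_subgroup) => g /lattice_gensP[[j -> q]|->].
  exists (delta_mx j ord0), 0; rewrite hpK zpK ivec_delta; split=> //.
  by rewrite hpK in q; rewrite q addr0.
exists 0, 1; rewrite hp_hZ zp_hZ map_mx0 mulmx0; split=> //.
by rewrite qf0 addr0.
Qed.

Lemma subgroup_zmul (K : set H) g (a : int) : is_subgroup K -> K g -> K (a%:~R *: g).
Proof.
move=> [K0 KM KV] Kg.
have nat_case (k : nat) : K (k%:R *: g).
  elim: k => [|k IH]; first by rewrite scale0r.
  suff -> : k.+1%:R *: g = hmul g (k%:R *: g) by exact: KM.
  apply: heisP; rewrite ?hp_mul ?zp_mul !hpZ ?zpZ ?omegaE -natr1; last by field.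
  by rewrite scalerDl scale1r addrC.
case: a => k; first by rewrite -pmulrn.
rewrite NegzE mulrNz -pmulrn scaleNr; exact: KV.
Qed.

(** The summands commute, so their sum is their product. *)
Lemma subgroup_sum (K : set H) (I : finType) (f : I -> H) : is_subgroup K ->
  (forall i, K (f i)) -> (forall i, zp (f i) = 0) ->
  (forall i j, omega (hp (f i)) (hp (f j)) = 0) -> K (\sum_i f i).
Proof.
move=> [K0 KM KV] Kf f0 fo.
suff [] : K (\sum_i f i) /\ (forall j, omega (hp (f j)) (hp (\sum_i f i)) = 0) by [].
elim/big_rec: _ => [|i x _ [Kx ox]]; first by split=> // j; rewrite hp0 omega0r.
split; last by move=> j; rewrite hpD omegaDr fo ox addr0.
suff -> : f i + x = hmul (f i) x by exact: KM.
apply: heisP; first by rewrite hpD hp_mul.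
by rewrite zpD zp_mul ox mul0r addr0.
Qed.

Lemma lat_sub_lattice : lat `<=` lattice R r.
Proof.
move=> h [w [c [hw zw]]].
have sL := lattice_subgroup; have [L0 LM LV] := sL.
have gL g : lattice_gens r g -> lattice R r g by move=> gg K [_ /(_ _ gg)].
pose X := \sum_(i < n) (w (lshift n i) ord0)%:~R *: ((r i)%:R *: hX R i).
pose Y := \sum_(i < n) (w (rshift n i) ord0)%:~R *: hY R i.
have oX i j : omega (delta_mx (lshift n i) ord0 : V) (delta_mx (lshift n j) ord0) = 0.
  by rewrite /omega big1// => k _; rewrite !mxE !eq_rlshift /= mulr0 mul0r subrr.
have oY i j : omega (delta_mx (rshift n i) ord0 : V) (delta_mx (rshift n j) ord0) = 0.
  by rewrite /omega big1// => k _; rewrite !mxE !eq_lrshift /= mulr0 mul0r subrr.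
have LX : lattice R r X.
  apply: (@subgroup_sum (lattice R r)) => // [i|i|i j].
  - by apply: (@subgroup_zmul (lattice R r)) => //; apply: gL; left; exists i.
  - by rewrite !zpZ zp_hX !mulr0.
  - by rewrite !hpZ !hp_hX !omegaZl !omegaZr oX !mulr0.
have LY : lattice R r Y.
  apply: (@subgroup_sum (lattice R r)) => // [i|i|i j].
  - by apply: (@subgroup_zmul (lattice R r)) => //; apply: gL; right; left; exists i.
  - by rewrite !zpZ zp_hY !mulr0.
  - by rewrite !hpZ !hp_hY !omegaZl !omegaZr oY !mulr0.
have LZ : lattice R r (c%:~R *: hZ R n).
  by apply: (@subgroup_zmul (lattice R r)) => //; apply: gL; right; right.
have [dl dr] := diag_rE (ivec w).
have hX' j : hp X j ord0 = \sum_(i < n) (w (lshift n i) ord0)%:~R * ((r i)%:R * (j == lshift n i)%:R).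
  rewrite /X linear_sum summxE; apply: eq_bigr => i _ /=.
  by rewrite !hpZ hp_hX !mxE andbT.
have hY' j : hp Y j ord0 = \sum_(i < n) (w (rshift n i) ord0)%:~R * (j == rshift n i)%:R.
  rewrite /Y linear_sum summxE; apply: eq_bigr => i _ /=.
  by rewrite !hpZ hp_hY !mxE andbT.
have hXl i : hp X (lshift n i) ord0 = hp h (lshift n i) ord0.
  rewrite hX' hw dl (bigD1 i)//= big1 ?addr0; last first.
    by move=> k ki; rewrite eq_lshift eq_sym (negbTE ki) !mulr0.
  by rewrite eqxx mulr1 mulrC mxE.
have hXr i : hp X (rshift n i) ord0 = 0.
  by rewrite hX' big1// => k _; rewrite eq_rlshift !mulr0.
have hYl i : hp Y (lshift n i) ord0 = 0.
  by rewrite hY' big1// => k _; rewrite eq_lrshift !mulr0.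
have hYr i : hp Y (rshift n i) ord0 = hp h (rshift n i) ord0.
  rewrite hY' hw dr (bigD1 i)//= big1 ?addr0; last first.
    by move=> k ki; rewrite eq_rshift eq_sym (negbTE ki) !mulr0.
  by rewrite eqxx mulr1 mxE.
have zX : zp X = 0.
  by rewrite /X linear_sum big1// => i _ /=; rewrite !zpZ zp_hX !mulr0.
have zY : zp Y = 0.
  by rewrite /Y linear_sum big1// => i _ /=; rewrite !zpZ zp_hY !mulr0.
(* Factorization into X part, Y part and central part; the product X Y creates exactly the central
   coordinate qf (hp h). *)
have -> : h = hmul (hmul X Y) (c%:~R *: hZ R n).
  apply: heisP.
    rewrite !hp_mul hpZ hp_hZ scaler0 addr0; apply/matrixP => j k.
    have -> : k = ord0 by exact: ord1.
    rewrite [RHS]mxE; case: (splitP j) => i ji.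
      have -> : j = lshift n i by apply: val_inj.
      by rewrite hXl hYl addr0.
    have -> : j = rshift n i by apply: val_inj.
    by rewrite hXr hYr add0r.
  rewrite !zp_mul hpZ zpZ hp_hZ zp_hZ scaler0 omega0r zX zY zw mulr1 mul0r.
  rewrite addr0 !add0r [RHS]addrC /qf /omega; congr (_ + _ / 2).
  by apply: eq_bigr => i _; rewrite hXl hYr hXr hYl mul0r subr0.
by apply: (LM) => //; exact: LM.
Qed.

Lemma latticeE : lattice R r = lat.
Proof. by apply/seteqP; split; [exact: lattice_sub_lat | exact: lat_sub_lattice]. Qed.

Hypothesis r_gt0 : forall i, (0 < r i)%N.

Lemma diag_r_unit : D \in unitmx.
Proof.
rewrite unitmxE /diag_r det_diag unitfE; apply/prodf_neq0 => j _.
case: (splitP j) => i ji.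
  have -> : j = lshift n i by apply: val_inj.
  by rewrite row_mxEl mxE pnatr_eq0 -lt0n.
have -> : j = rshift n i by apply: val_inj.
by rewrite row_mxEr mxE oner_neq0.
Qed.

Lemma int_norm_lt1 (z : int) : `|z%:~R : R| < 1 -> z = 0.
Proof.
by rewrite -intr_norm -[1]/(1%:~R) ltr_int; lia.
Qed.

(** The displacement of h by gam is the distance from 0 to h^-1 gam h, which has the horizontal part
    of gam, and its central part too once the horizontal part is 0. A short displacement forces the
    integral coordinates below 1 in absolute value, the horizontal ones first. *)
Lemma lat_separated (A : 'M[R]_(n + n)) (rho : R) : A \in unitmx -> exists2 eps, 0 < eps &
  reach_separated A rho lat eps.
Proof.
move=> Au; have [K K0 hK] := mulmx_coord_bound (invmx D *m A).
have [C C0 hC] := reach_zp rho Au.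
pose eps := Num.min (K + 1)^-1 (C + `|rho| + 1)^-1.
have K1 : 0 < K + 1 by lra.
have C1 : 0 < C + `|rho| + 1 by have := normr_ge0 rho; lra.
have eps0 : 0 < eps by rewrite lt_min !invr_gt0 K1 C1.
exists eps => // gam h [w [c [gw gz]]] rr.
have g0 : reach A rho 0 (hmul (hmul (hinv h) gam) h) eps.
  by move: rr => /(reach_left (hinv h)); rewrite hmulVg !hmulA.
have hpg : hp (hmul (hmul (hinv h) gam) h) = hp gam.
  by rewrite !hp_mul hp_inv addrAC addNr add0r.
have w0 : w = 0.
  apply/matrixP => j k; have -> : k = ord0 by exact: ord1.
  rewrite [RHS]mxE; apply: int_norm_lt1.
  have -> : (w j ord0)%:~R = ((invmx D *m A) *m (invmx A *m hp gam)) j ord0.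
    by rewrite -mulmxA mulKVmx// gw mulKmx ?diag_r_unit// mxE.
  apply: (le_lt_trans (hK _ _)).
  have := reach_hp g0; rewrite hpg hp0 subr0 -/(cnorm A (hp gam)) => lt.
  have e1 : eps <= (K + 1)^-1 by rewrite ge_min lexx.
  apply: (@le_lt_trans _ _ (K * (K + 1)^-1)).
    by rewrite ler_wpM2l// (le_trans (ltW lt)).
  by rewrite ltr_pdivrMr// mul1r ltrDl.
have hp_gam : hp gam = 0 by rewrite gw w0 map_mx0 mulmx0.
have zg : zp (hmul (hmul (hinv h) gam) h) = zp gam.
  by rewrite !zp_mul !hp_mul zp_inv hp_inv hp_gam !omegaE; field.
have zc : zp gam = c%:~R by rewrite gz hp_gam qf0 addr0.
apply: heisP; rewrite ?hp0 ?zp0// zc (_ : c = 0)//; apply: int_norm_lt1.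
rewrite -zc -zg; apply: (le_lt_trans (hC _ _ g0)).
have e2 : eps <= (C + `|rho| + 1)^-1 by rewrite ge_min lexx orbT.
have e3 : eps * (C + `|rho| + 1) <= 1 by rewrite -ler_pdivlMr// div1r.
have e1 : eps <= 1.
  apply: le_trans e2 _; rewrite invf_le1//; have := normr_ge0 rho; lra.
apply: (@le_lt_trans _ _ ((C + `|rho|) * eps)).
  by rewrite ler_wpM2r ?(ltW eps0)// lerD2r ler_piMr.
by move: e3; rewrite mulrDr mulr1 mulrC; lra.
Qed.

End Lattice.

(** * Symplectic matrices and lattice automorphisms *)

Section DoubleCosets.
Variables (R : realType) (n : nat) (r : 'I_n -> nat).
Hypothesis r_gt0 : forall i, (0 < r i)%N.
Local Notation H := (heis R n).
Local Notation V := ('cV[R]_(n + n)).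
Local Notation D := (diag_r R r).
Local Notation J := (@Jmx R n).
Local Notation ivec w := (map_mx (intr : int -> R) w).
Local Notation L := (lattice R r).
Implicit Types (A S Q : 'M[R]_(n + n)) (rho e : R).

Lemma omega_J (v w : V) : omega v w = (v^T *m J *m w) ord0 ord0.
Proof.
rewrite -{2}[v]vsubmxK -{2}[w]vsubmxK /Jmx tr_col_mx mul_row_block !mulmx0.
rewrite addr0 add0r mulmx1 mulmxN mulmx1 mul_row_col mulNmx !mxE /omega sumrB addrC.
congr (_ - _); apply: eq_bigr => i _; rewrite !mxE//.
Qed.

Lemma delta_form (M : 'M[R]_(n + n)) i j :
  ((delta_mx i ord0 : V)^T *m M *m (delta_mx j ord0 : V)) ord0 ord0 = M i j.
Proof. by rewrite trmx_delta -rowE -colE !mxE. Qed.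

Lemma omega_basis_ext (B : 'M[R]_(n + n)) S e : B \in unitmx ->
  (forall i j, omega (S *m (B *m delta_mx i ord0)) (S *m (B *m delta_mx j ord0)) =
    e * omega (B *m delta_mx i ord0) (B *m delta_mx j ord0)) ->
  S^T *m J *m S = e *: J.
Proof.
move=> uB h; have BE : B^T *m (S^T *m J *m S) *m B = B^T *m (e *: J) *m B.
  apply/matrixP => i j; have := h i j; rewrite !omega_J !trmx_mul => E.
  rewrite -[LHS]delta_form -[RHS]delta_form -!scalemxAr -!scalemxAl -!scalemxAr -!scalemxAl [RHS]mxE.
  by move: E; rewrite !mulmxA.
have uBT : B^T \in unitmx by rewrite unitmx_tr.
by apply: (can_inj (mulKmx uBT)); apply: (can_inj (mulmxK uB)); exact: BE.
Qed.

Lemma symplectic_omega S e : S^T *m J *m S = e *: J <->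
  (forall v w : V, omega (S *m v) (S *m w) = e * omega v w).
Proof.
split=> [SJ v w|h].
  rewrite !omega_J trmx_mul !mulmxA -(mulmxA _ S^T) -(mulmxA _ _ S) SJ.
  by rewrite -scalemxAr -scalemxAl mxE.
by apply: (omega_basis_ext (B := 1%:M)) => [|i j]; rewrite ?unitmx1// !mul1mx.
Qed.

Lemma sign_sq e : e = 1 \/ e = -1 -> e * e = 1.
Proof. by case=> ->; rewrite ?mulr1// mulrNN mulr1. Qed.

Lemma sign_neq0 e : e = 1 \/ e = -1 -> e != 0.
Proof. by case=> ->; rewrite ?oppr_eq0 oner_neq0. Qed.

Lemma sign_mul e e' : e = 1 \/ e = -1 -> e' = 1 \/ e' = -1 -> e * e' = 1 \/ e * e' = -1.
Proof. by case=> ->; case=> ->; rewrite ?mulrNN ?mulr1 ?mul1r; [left|right|right|left]. Qed.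

Lemma pair_mxM A rho A' rho' :
  pair_mx A rho *m pair_mx A' rho' = pair_mx (A *m A') (rho * rho').
Proof.
by rewrite /pair_mx mulmx_block !mulmx0 !mul0mx !addr0 !add0r scalar_mxM.
Qed.

Lemma pair_mx1 : pair_mx 1%:M 1 = 1%:M :> 'M[R]_(n + n + 1).
Proof. by rewrite /pair_mx -scalar_mx_block. Qed.

Lemma symplectic_inv S e : symplectic_sign S e -> symplectic_sign (invmx S) e.
Proof.
move=> [uS se SJ]; split=> //; first by rewrite unitmx_inv.
apply/symplectic_omega => v w.
rewrite -[in RHS](mulKVmx uS v) -[in RHS](mulKVmx uS w).
by rewrite (symplectic_omega S e).1// mulrA sign_sq// mul1r.
Qed.

Lemma symplectic_mul S e S' e' : symplectic_sign S e -> symplectic_sign S' e' ->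
  symplectic_sign (S *m S') (e * e').
Proof.
move=> [uS se SJ] [uS' se' SJ']; split; first by rewrite unitmx_mul uS.
  exact: sign_mul.
apply/symplectic_omega => v w; rewrite -!mulmxA.
by rewrite (symplectic_omega S e).1// (symplectic_omega S' e').1// mulrA.
Qed.

Lemma intr_unitmx (P : 'M[int]_(n + n)) : P \in unitmx ->
  map_mx (intr : int -> R) P \in unitmx.
Proof.
move=> uP; have : map_mx (intr : int -> R) P *m map_mx intr (invmx P) = 1%:M.
  by rewrite -map_mxM mulmxV// map_mx1.
by move=> /mulmx1_unit[].
Qed.

Lemma G_r_inv S : G_r r S -> G_r r (invmx S).
Proof.
move=> [P uP <-]; exists (invmx P); first by rewrite /= unitmx_inv.
have uD := diag_r_unit R r_gt0.
have uD' : D *m map_mx intr P *m invmx D \in unitmx.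
  by rewrite !unitmx_mul uD unitmx_inv uD intr_unitmx.
rewrite -[RHS](mul1mx _); apply: (can_inj (mulmxK uD')); rewrite mulmxKV//.
rewrite !mulmxA mulmxKV// -(mulmxA D) -map_mxM mulVmx// map_mx1 mulmx1.
by rewrite mulmxV.
Qed.

Lemma G_r_mul S S' : G_r r S -> G_r r S' -> G_r r (S *m S').
Proof.
move=> [P uP <-] [P' uP' <-]; exists (P *m P'); first by rewrite /= unitmx_mul uP.
have uD := diag_r_unit R r_gt0.
by rewrite map_mxM !mulmxA mulmxKV.
Qed.

Lemma G_r_1 : G_r r (1%:M : 'M[R]_(n + n)).
Proof.
exists 1%:M; first exact: unitmx1.
by rewrite map_mx1 mulmx1 mulmxV// diag_r_unit.
Qed.

Lemma Pi_r_inv (M : 'M[R]_(n + n + 1)) : Pi_r r M -> exists2 N, Pi_r r N & N *m M = 1%:M.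
Proof.
move=> [S [e [GS sS ->]]]; have [uS se _] := sS.
exists (pair_mx (invmx S) e).
  by exists (invmx S), e; split=> //; [exact: G_r_inv | exact: symplectic_inv].
by rewrite pair_mxM mulVmx// sign_sq// pair_mx1.
Qed.

Lemma Pi_r_mul (M M' : 'M[R]_(n + n + 1)) : Pi_r r M -> Pi_r r M' -> Pi_r r (M *m M').
Proof.
move=> [S [e [GS sS ->]]] [S' [e' [GS' sS' ->]]]; rewrite pair_mxM.
exists (S *m S'), (e * e'); split=> //; first exact: G_r_mul.
exact: symplectic_mul.
Qed.

Lemma O_pm_inv (M : 'M[R]_(n + n + 1)) : O_pm M -> exists2 N, O_pm N & M *m N = 1%:M.
Proof.
move=> [Q [e [QQ se ->]]]; have QQ' := mulmx1C QQ.
exists (pair_mx Q^T e); first by exists Q^T, e; rewrite trmxK.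
by rewrite pair_mxM QQ' sign_sq// pair_mx1.
Qed.

Lemma O_pm_mul (M M' : 'M[R]_(n + n + 1)) : O_pm M -> O_pm M' -> O_pm (M *m M').
Proof.
move=> [Q [e [QQ se ->]]] [Q' [e' [QQ' se' ->]]]; rewrite pair_mxM.
exists (Q *m Q'), (e * e'); split=> //; last exact: sign_mul.
by rewrite trmx_mul mulmxA -(mulmxA Q'^T) QQ mulmx1.
Qed.

Lemma dcoset_self (M : 'M[R]_(n + n + 1)) : dcoset r M M.
Proof.
exists 1%:M.
  exists 1%:M, 1; rewrite pair_mx1; split=> //; first exact: G_r_1.
  split; [exact: unitmx1 | by left | by rewrite trmx1 mul1mx mulmx1 scale1r].
exists 1%:M; last by rewrite mul1mx mulmx1.
by exists 1%:M, 1; rewrite pair_mx1 trmx1 mul1mx; split=> //; left.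
Qed.

Lemma dcoset_eq (M N : 'M[R]_(n + n + 1)) : dcoset r M N -> dcoset r M = dcoset r N.
Proof.
move=> [P PP [Q QO <-]].
have [P' PP' PK] := Pi_r_inv PP; have [Q' QO' QK] := O_pm_inv QO.
apply/seteqP; split=> _ [X XP [Y YO <-]].
  exists (X *m P'); first exact: Pi_r_mul.
  exists (Q' *m Y); first exact: O_pm_mul.
  rewrite !mulmxA -(mulmxA X) PK mulmx1 -(mulmxA _ Q) QK mulmx1.
  by [].
exists (X *m P); first exact: Pi_r_mul.
by exists (Q *m Y); [exact: O_pm_mul | rewrite !mulmxA].
Qed.

(* Conjugation by g corrects the last coordinates, so that the automorphism
   pair_mx S e followed by it maps the lattice onto itself. *)
Lemma lattice_conjugate S e : G_r r S -> symplectic_sign S e -> exists g : H,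
  (forall gam, L gam -> L (hmul (hmul g (pair_mx S e *m gam)) (hinv g))) /\
  (forall gam, L gam -> L (pair_mx (invmx S) e *m hmul (hmul (hinv g) gam) g)).
Proof.
move=> [P uP SE] [uS se SJ]; have uD := diag_r_unit R r_gt0.
have om := (symplectic_omega S e).1 SJ.
pose b j : V := D *m delta_mx j ord0.
(* The linear form that agrees with qf at the images S b_j of the lattice basis. Conjugation by g
   adds f to the central coordinate, which brings the images of the generators into the lattice. *)
pose f (v : V) : R := \sum_j (invmx D *m (invmx S *m v)) j ord0 * qf (S *m b j).
have [k kE] : exists k, forall v, omega v k = - f v.
  apply: omega_repr => a v w; rewrite /f mulrN -opprD mulr_sumr -big_split.
  congr (- _); apply: eq_bigr => j _ /=.
  by rewrite !mulmxDr -!scalemxAr [X in X * _]mxE [X in (X + _) * _]mxE; ring.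
have fb j : f (S *m b j) = qf (S *m b j).
  rewrite /f mulKmx// mulKmx// (bigD1 j)//= big1 ?addr0.
    by rewrite mxE !eqxx mul1r.
  by move=> i ij; rewrite mxE (negbTE ij) mul0r.
pose g : H := hmk k 0.
have conjE gam : hmul (hmul g (pair_mx S e *m gam)) (hinv g) =
    hmk (S *m hp gam) (e * zp gam - omega (S *m hp gam) k).
  rewrite pair_mxE; apply: heisP; rewrite ?hpK ?zpK.
    by rewrite !hp_mul hp_inv !hpK addrAC addrN add0r.
  rewrite !zp_mul !hp_mul zp_inv hp_inv !hpK !zpK !omegaE.
  by rewrite (omega_antisym k); field.
have SD (w : 'cV[int]_(n + n)) : S *m (D *m ivec w) = D *m ivec (P *m w).
  by rewrite -SE mulmxA mulmxKV// -mulmxA -map_mxM.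
have fwd gam : L gam -> L (hmul (hmul g (pair_mx S e *m gam)) (hinv g)).
  have [L0 LM LV] := lattice_subgroup R r.
  pose phi gam := hmul (hmul g (pair_mx S e *m gam)) (hinv g).
  have bP : bracket_morphism (pair_mx S e).
    move=> v w; rewrite !bracketE !pair_mxE !hpK om hpZ zpZ hp_hZ zp_hZ.
    by rewrite scaler0 mulmx0 mulr1 hmk0.
  have phiM x y : phi (hmul x y) = hmul (phi x) (phi y).
    by rewrite /phi mulmx_hmul// !hmulA hmulgKV.
  have phi0 : phi 0 = 0 by rewrite /phi mulmx0 hmulg0 hmulgV.
  apply: (@lattice_ind _ _ _ [set x | L (phi x)]).
    split=> /=.
    - by rewrite phi0.
    - by move=> x y hx hy; rewrite phiM; exact: LM.
    - move=> x hx; have -> : phi (hinv x) = hinv (phi x); last exact: LV.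
      by apply: (@hmulI _ _ (phi x)); rewrite -phiM !hmulgV.
  move=> x /lattice_gensP[[j -> _]|->] /=; rewrite /phi conjE latticeE.
    rewrite hpK zpK mulr0 add0r kE opprK fb -/(b j).
    have -> : S *m b j = D *m ivec (P *m delta_mx j ord0).
      by rewrite /b -ivec_delta SD.
    by have := @lat_hmk R n r (P *m delta_mx j ord0) 0; rewrite mulr0z add0r.
  rewrite hp_hZ zp_hZ mulmx0 omega0l subr0 mulr1.
  have [c cE] : exists c : int, e = c%:~R by case: se => ->; [exists 1 | exists (-1)].
  by exists 0, c; rewrite hpK zpK map_mx0 mulmx0 qf0 addr0.
exists g; split=> // gam; rewrite latticeE => -[w [c [gw gz]]].
(* For the inverse, the lattice element g0 is chosen so that its image has the horizontal part of
   gam. The image and gam then differ by an integral central element, and the sign e keeps this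
   difference integral when it is pulled back. *)
pose w1 := invmx P *m w; pose g0 : H := hmk (D *m ivec w1) (0%:~R + qf (D *m ivec w1)).
have Sw1 : S *m (D *m ivec w1) = hp gam by rewrite SD mulKVmx.
have : L g0 by rewrite latticeE; exact: lat_hmk.
move=> /fwd; rewrite conjE latticeE hpK zpK Sw1 => -[w2 [c2 []]].
rewrite hpK zpK => _ z2.
have [c' cE] : exists c : int, e = c%:~R by case: se => ->; [exists 1 | exists (-1)].
exists w1, (c' * (c - c2)); rewrite pair_mxE hpK zpK.
have -> : hp (hmul (hmul (hinv g) gam) g) = hp gam.
  by rewrite !hp_mul hp_inv addrAC addNr add0r.
have -> : zp (hmul (hmul (hinv g) gam) g) = zp gam + omega (hp gam) k.
  rewrite !zp_mul !hp_mul zp_inv hp_inv !hpK !zpK !omegaE.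
  by rewrite (omega_antisym k); field.
split; first by rewrite -Sw1 mulKmx.
have -> : invmx S *m hp gam = D *m ivec w1 by rewrite -Sw1 mulKmx.
rewrite gz rmorphM rmorphB /= -cE; move: z2; rewrite mulr0z add0r => z2.
have ee := sign_sq se.
have : e * (e * qf (D *m ivec w1) - omega (hp gam) k) = e * (c2%:~R + qf (hp gam)).
  by rewrite z2.
rewrite mulrBr mulrA ee mul1r => E; have -> : qf (D *m ivec w1) =
  e * (c2%:~R + qf (hp gam)) + e * omega (hp gam) k by rewrite -E subrK.
by ring.
Qed.

(** Left multiplication by (S, e) is realized by the affine map of [lattice_conjugate]. Right
    multiplication by (Q, e') only changes the orthonormal frame and leaves the norm unchanged. *)
Lemma isometric_of_dcoset A rho A' rho' : A \in unitmx -> A' \in unitmx ->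
  dcoset r (pair_mx A rho) (pair_mx A' rho') ->
  isometric L (metric_of (pair_mx A rho)) (metric_of (pair_mx A' rho')).
Proof.
move=> uA uA' [_ [S [e [GS sS ->]]] [_ [Q [e' [QQ se' ->]]]]].
have [uS se SJ] := sS; have om := (symplectic_omega S e).1 SJ.
rewrite !pair_mxM => E.
have uQ : Q \in unitmx by have [] := mulmx1_unit QQ.
have AE : A' = S *m A *m Q.
  apply: mulmx_ext => v; have := congr1 (fun M => hp (M *m hmk v 0)) E.
  by rewrite !pair_mxE !hpK.
have rE : rho' = e * rho * e'.
  have := congr1 (fun M => zp (M *m hmk 0 1)) E.
  by rewrite !pair_mxE !zpK !mulr1.
have r0 : rho' = 0 <-> rho = 0.
  split=> [|h0]; last by rewrite rE h0 mulr0 mul0r.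
  move=> /eqP; rewrite rE !mulf_eq0 (negbTE (sign_neq0 se)) (negbTE (sign_neq0 se')).
  by rewrite orbF => /eqP.
have [g [g1 g2]] := lattice_conjugate GS sS.
apply: (isometric_affine (lattice_subgroup R r) (M := pair_mx S e) (N := pair_mx (invmx S) e) (g := g)) => //.
- move=> v w; rewrite !bracketE !pair_mxE !hpK om hpZ zpZ hp_hZ zp_hZ.
  by rewrite scaler0 mulmx0 mulr1 hmk0.
- by rewrite pair_mxM mulmxV// sign_sq// pair_mx1.
- move=> v /(mem_pair_mx _ _ uA) hv; apply/(mem_pair_mx _ _ uA') => /r0/hv vz.
  by rewrite pair_mxE zpK vz mulr0.
- move=> v /(mem_pair_mx _ _ uA') hv; apply/(mem_pair_mx _ _ uA) => /r0/hv vz.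
  by rewrite pair_mxE zpK vz mulr0.
move=> v /(mem_pair_mx _ _ uA) hv; rewrite !sr_norm_pair_mx//; last first.
  by move=> /r0/hv vz; rewrite pair_mxE zpK vz mulr0.
rewrite /unorm pair_mxE hpK zpK; congr Num.sqrt; congr (_ + _).
  rewrite /cnorm !enorm_sq !edotE AE.
  have -> : invmx (S *m A *m Q) *m (S *m hp v) = Q^T *m (invmx A *m hp v).
    have uSA : S *m A \in unitmx by rewrite unitmx_mul uS.
    apply: (can_inj (mulKmx uQ)); rewrite [RHS]mulmxA (mulmx1C QQ) mul1mx.
    apply: (can_inj (mulKmx uSA)); rewrite [LHS]mulmxA mulKVmx; last first.
      by rewrite unitmx_mul uSA.
    by rewrite -mulmxA mulKVmx.
  by rewrite trmx_mul trmxK mulmxA -(mulmxA _ Q) (mulmx1C QQ) mulmx1.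
have [h0|rn0] := eqVneq rho 0; first by rewrite rE h0 !(mulr0, mul0r, invr0).
by rewrite rE; case: se => ->; case: se' => ->; field.
Qed.

End DoubleCosets.

(** * Isometric quotients *)

Section Rigidity.
Variables (R : realType) (n : nat) (r : 'I_n -> nat).
Hypotheses (n0 : (0 < n)%N) (r_gt0 : forall i, (0 < r i)%N).
Local Notation H := (heis R n).
Local Notation V := ('cV[R]_(n + n)).
Local Notation D := (diag_r R r).
Local Notation ivec w := (map_mx (intr : int -> R) w).
Local Notation L := (lattice R r).
Implicit Types (A S Q : 'M[R]_(n + n)) (rho e : R) (gam : H).

(* Distances grow at most linearly along powers, with slope given by the
   horizontal part. *)
Lemma stable_norm_le A A' rho (g : H) (v : V) :
  (forall (k : nat) x, reach A rho 0 (k%:R *: g) x -> cnorm A' (k%:R *: v) < x) ->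
  cnorm A' v <= cnorm A (hp g).
Proof.
have [C C0 hC] := reach_upper A rho n0 => h.
rewrite leNgt; apply/negP => lt; pose d := cnorm A' v - cnorm A (hp g).
have d0 : 0 < d by rewrite subr_gt0.
pose z := `|zp g|; have z0 : 0 <= z by exact: normr_ge0.
(* For k > C^2 z / d^2 the linear excess k d exceeds the vertical cost C sqrt (k z). *)
pose X := C ^+ 2 * z / d ^+ 2; have X0 : 0 <= X.
  by rewrite divr_ge0 ?sqr_ge0// mulr_ge0// sqr_ge0.
pose k := (Num.truncn X).+1; have Xk : X < k%:R by exact: truncnS_gt.
have k0 : 0 < k%:R :> R by rewrite ltr0n.
have key x : k%:R * cnorm A (hp g) + C * Num.sqrt (k%:R * z) < x ->
    k%:R * cnorm A' v < x.
  move=> hx; have := h k x; rewrite cnormZ normr_nat; apply; apply: hC.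
  by rewrite hpZ zpZ cnormZ normrM !normr_nat.
have le : k%:R * cnorm A' v <= k%:R * cnorm A (hp g) + C * Num.sqrt (k%:R * z).
  by apply/ler_addgt0Pr => eps eps0; apply/ltW/key; rewrite ltrDl.
have le2 : k%:R * d <= C * Num.sqrt (k%:R * z) by rewrite mulrBr; lra.
have : (k%:R * d) ^+ 2 <= (C * Num.sqrt (k%:R * z)) ^+ 2.
  by rewrite ler_pXn2r ?nnegrE// ?mulr_ge0 ?sqrtr_ge0// ltW.
rewrite !exprMn sqr_sqrtr ?mulr_ge0 ?ler0n// => le3.
have : k%:R * (k%:R * d ^+ 2) <= k%:R * (C ^+ 2 * z).
  have -> : k%:R * (k%:R * d ^+ 2) = k%:R ^+ 2 * d ^+ 2 by ring.
  by have -> : k%:R * (C ^+ 2 * z) = C ^+ 2 * (k%:R * z) by ring.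
rewrite ler_pM2l//; apply/negP; rewrite -ltNge.
by rewrite -ltr_pdivrMr// exprn_gt0.
Qed.

(* Polarization: a norm on R^2n is determined by its values on a basis and on
   the sums of two basis vectors. *)
Lemma gram_ext (X Y : 'M[R]_(n + n)) :
  (forall i, enorm (X *m delta_mx i ord0) = enorm (Y *m delta_mx i ord0)) ->
  (forall i j, enorm (X *m (delta_mx i ord0 + delta_mx j ord0)) =
     enorm (Y *m (delta_mx i ord0 + delta_mx j ord0))) ->
  X^T *m X = Y^T *m Y.
Proof.
move=> h1 h2; pose e (i : 'I_(n + n)) : V := delta_mx i ord0.
have sq1 i : edot (X *m e i) (X *m e i) = edot (Y *m e i) (Y *m e i).
  by rewrite -!enorm_sq h1.
have E i j : edot (X *m e i) (X *m e j) = edot (Y *m e i) (Y *m e j).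
  have : edot (X *m (e i + e j)) (X *m (e i + e j)) = edot (Y *m (e i + e j)) (Y *m (e i + e j)).
    by rewrite -!enorm_sq h2.
  rewrite !mulmxDr !edotDl !edotDr !sq1 (edotC (X *m e j)) (edotC (Y *m e j)); lra.
apply/matrixP => i j; have := E i j; rewrite !edotE !trmx_mul !mulmxA.
by rewrite -(mulmxA (e i)^T X^T) -(mulmxA (e i)^T Y^T) /e !delta_form.
Qed.

Lemma enorm_gram (X Y : 'M[R]_(n + n)) (w : V) :
  X^T *m X = Y^T *m Y -> enorm (X *m w) = enorm (Y *m w).
Proof.
move=> XY; rewrite /enorm !edotE !trmx_mul !mulmxA.
by rewrite -(mulmxA _ X^T) XY !mulmxA.
Qed.

(** The identity o (o^-1 g o)^k = g^k o, powers being scalar multiples in exponential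
    coordinates. *)
Lemma hmul_conjZ (o g : H) (k : R) :
  hmul o (k *: hmul (hmul (hinv o) g) o) = hmul (k *: g) o.
Proof.
apply: heisP; rewrite !(hp_mul, zp_mul, hpZ, zpZ, hp_inv, zp_inv).
  by rewrite addrAC addNr add0r addrC.

by rewrite !omegaE (omega_antisym (hp o)); field.
Qed.

Section Marking.
Variables (A A' : 'M[R]_(n + n)) (rho rho' : R) (F F' : H -> H).
Hypotheses (FK : cancel F F') (F'K : cancel F' F).
Hypothesis Fr : forall g h x, reach A rho g h x <-> reach A' rho' (F g) (F h) x.
Variable phi : H -> H.
Hypotheses (phiL : forall gam, L gam -> L (phi gam)).
Hypothesis phiF : forall gam h, L gam -> F (hmul gam h) = hmul (phi gam) (F h).
Hypothesis F'L : forall gam, L gam -> exists2 gam', L gam' &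
  forall h, F' (hmul gam h) = hmul gam' (F' h).
Let L0 : L 0. Proof. by case: (lattice_subgroup R r). Qed.
Let LM g h : L g -> L h -> L (hmul g h).
Proof. by case: (lattice_subgroup R r) => _ + _; apply. Qed.
Let LV g : L g -> L (hinv g). Proof. by case: (lattice_subgroup R r) => _ _; apply. Qed.

Let FE gam : L gam -> F gam = hmul (phi gam) (F 0).
Proof. by move=> Lg; rewrite -phiF// hmulg0. Qed.

Lemma phiM gam gam' : L gam -> L gam' -> phi (hmul gam gam') = hmul (phi gam) (phi gam').
Proof.
move=> Lg Lg'; apply: (@hmulIr _ _ (F 0)).
by rewrite -hmulA -(FE Lg') -(FE (LM Lg Lg')) phiF.
Qed.

Lemma phi0 : phi 0 = 0.
Proof. by apply: (@hmulIr _ _ (F 0)); rewrite -FE// hmul0g. Qed.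

Lemma phiV gam : L gam -> phi (hinv gam) = hinv (phi gam).
Proof.
move=> Lg; apply: (@hmulI _ _ (phi gam)); rewrite -phiM ?hmulgV ?phi0//.
exact: LV.
Qed.

Lemma phi_inj gam gam' : L gam -> L gam' -> phi gam = phi gam' -> gam = gam'.
Proof. by move=> Lg Lg' E; apply: (can_inj FK); rewrite (FE Lg) (FE Lg') E. Qed.

Lemma phi_surj gam : L gam -> exists2 gam', L gam' & phi gam' = gam.
Proof.
move=> Lg; have [gam' Lg' E] := F'L Lg; exists gam' => //.
apply: (@hmulIr _ _ (F 0)); rewrite -FE//.
by rewrite -[RHS]F'K E FK hmulg0.
Qed.

Definition gen (j : 'I_(n + n)) : H := hmk (D *m delta_mx j ord0) (qf (D *m delta_mx j ord0)).

Lemma L_gen j : L (gen j).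
Proof.
by rewrite latticeE; have := @lat_hmk R n r (delta_mx j ord0) 0; rewrite mulr0z add0r ivec_delta.
Qed.

Lemma L_center (c : int) : L (hmk 0 c%:~R).
Proof.
by rewrite latticeE; have := @lat_hmk R n r 0 c; rewrite map_mx0 mulmx0 qf0 addr0.
Qed.

Lemma lattice_hp gam : L gam -> exists w : 'cV[int]_(n + n), hp gam = D *m ivec w.
Proof. by rewrite latticeE => -[w [c [-> _]]]; exists w. Qed.

Lemma center_commutes (z : R) (h : H) : hmul (hmk 0 z) h = hmul h (hmk 0 z).
Proof.
by apply: heisP; rewrite ?hp_mul ?zp_mul !hpK ?zpK ?omegaE; [rewrite addrC | ring].
Qed.

Lemma delta_coord (j x : 'I_(n + n)) : (delta_mx j ord0 : V) x ord0 = (x == j)%:R.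
Proof. by rewrite mxE andbT. Qed.

(** Commuting with the lattice makes the horizontal part omega-orthogonal to a basis of R^2n, hence
    0. *)
Lemma lattice_central gam : L gam -> (forall h, L h -> hmul gam h = hmul h gam) ->
  exists c : int, gam = hmk 0 c%:~R.
Proof.
move=> Lg cg; have om h : L h -> omega (hp gam) (hp h) = 0.
  move=> /cg/(congr1 (@zp R n)); rewrite !zp_mul (omega_antisym (hp h)); lra.
have hp0' : hp gam = 0.
  have uD := diag_r_unit R r_gt0.
  have o1 v : omega (hp gam) (D *m v) = 0.
    have {1}-> : v = \sum_j v j ord0 *: delta_mx j ord0.
      by rewrite {1}(matrix_sum_delta v); apply: eq_bigr => j _; rewrite big_ord1.
    rewrite mulmx_sumr; elim/big_rec: _ => [|j x _ IH]; first by rewrite omega0r.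
    rewrite omegaDr IH -scalemxAr omegaZr addr0.
    by have := om _ (L_gen j); rewrite hpK => ->; rewrite mulr0.
  have o2 v : omega (hp gam) v = 0 by rewrite -(mulKVmx uD v) o1.
  apply/matrixP => i j; have -> : j = ord0 by exact: ord1.
  rewrite [RHS]mxE; case: (splitP i) => k ik.
    have -> : i = lshift n k by apply: val_inj.
    have := o2 (hp (hY R k)); rewrite /omega hp_hY (bigD1 k)//= big1 => [|l lk].
      by rewrite !delta_coord eqxx eq_lrshift mulr1 mulr0 subr0 addr0.
    by rewrite !delta_coord eq_lrshift eq_rshift (negbTE lk) !mulr0 subrr.
  have -> : i = rshift n k by apply: val_inj.
  have := o2 (hp (hX R k)); rewrite /omega hp_hX (bigD1 k)//= big1 => [|l lk].
    rewrite !delta_coord eqxx eq_rlshift mulr1 mulr0 sub0r addr0 => /eqP.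
    by rewrite oppr_eq0 => /eqP.
  by rewrite !delta_coord eq_rlshift eq_lshift (negbTE lk) !mulr0 subrr.
move: Lg; rewrite latticeE => -[w [c [_ zg]]]; exists c.
by apply: heisP; rewrite ?hpK ?zpK// zg hp0' qf0 addr0.
Qed.

(** phi is an automorphism, so it preserves the center of the lattice, an infinite cyclic group. It
    acts there as multiplication by an integer e; surjectivity gives an integer m with m e = 1. *)
Lemma phi_center : exists2 e : int, (e = 1 \/ e = -1) &
  forall c : int, phi (hmk 0 c%:~R) = hmk 0 (c * e)%:~R.
Proof.
have [e eE] : exists e : int, phi (hmk 0 1%:~R) = hmk 0 e%:~R.
  have L1 := L_center 1; apply: lattice_central; first exact: phiL.
  by move=> _ /phi_surj[h Lh <-]; rewrite -!phiM// center_commutes.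
have cM (x y : R) : hmul (hmk 0 x) (hmk 0 y) = hmk 0 (x + y) :> H.
  by apply: heisP; rewrite ?hp_mul ?zp_mul !hpK ?zpK ?omegaE ?addr0//; field.
have nat_case (k : nat) : phi (hmk 0 k%:~R) = hmk 0 (k%:Z * e)%:~R.
  elim: k => [|k IH].
    by rewrite mul0r (_ : hmk 0 _ = 0) ?phi0//; apply: heisP; rewrite ?hpK ?zpK ?hp0 ?zp0.
  have kE : k.+1%:Z = 1 + k%:Z by lia.
  rewrite kE mulrDl mul1r !intrD -!cM phiM ?eE ?IH//; exact: L_center.
have cV (x : R) : hmk 0 (- x) = hinv (hmk 0 x) :> H.
  by apply: heisP; rewrite ?hp_inv ?zp_inv ?hpK ?zpK ?oppr0.
have int_case (c : int) : phi (hmk 0 c%:~R) = hmk 0 (c * e)%:~R.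
  case: c => k; first exact: nat_case.
  rewrite NegzE mulNr !mulrNz !cV phiV ?nat_case//; exact: L_center.
exists e => //.
have [z Lz zE] := phi_surj (L_center 1).
have [m mE] : exists m : int, z = hmk 0 m%:~R.
  apply: lattice_central => // h Lh; apply: phi_inj; [exact: LM | exact: LM |].
  by rewrite !phiM// zE center_commutes.
have : m * e = 1.
  have := zE; rewrite mE int_case => /(congr1 (@zp R n)); rewrite !zpK.
  by move=> /intr_inj.
by move=> /(congr1 absz); rewrite abszM => /eqP; rewrite muln_eq1 => /andP[_ /eqP]; lia.
Qed.

(** Both sides are additive along products, so it suffices to compare generators. At Z both vanish
    because phi preserves the center. *)
Lemma phi_horizontal : exists S, forall gam, L gam -> hp (phi gam) = S *m hp gam.
Proof.
have uD := diag_r_unit R r_gt0.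
pose T := \matrix_(i, j) hp (phi (hmk (D *m delta_mx j ord0) 0)) i ord0.
have TE j : T *m delta_mx j ord0 = hp (phi (hmk (D *m delta_mx j ord0) 0)).
  apply/matrixP => i k; have -> : k = ord0 by exact: ord1.
  by rewrite -colE mxE [LHS]mxE.
exists (T *m invmx D).
have [e _ ce] := phi_center.
move=> gam Lg; suff [] : L gam /\ hp (phi gam) = T *m invmx D *m hp gam by [].
apply: (@lattice_ind _ _ r [set gam | L gam /\ hp (phi gam) = T *m invmx D *m hp gam]) Lg.
  split=> /=.
  - by rewrite phi0 hp0 mulmx0.
  - move=> g h [Lg Eg] [Lh Eh]; split; first exact: LM.
    by rewrite phiM// (hp_mul (phi g)) (hp_mul g) mulmxDr Eg Eh.
  - move=> g [Lg Eg]; split; first exact: LV.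
    by rewrite phiV// (hp_inv (phi g)) (hp_inv g) mulmxN Eg.
move=> g gg; have Lg : L g by move=> K [_ /(_ _ gg)].
split=> //; have [[j -> _]|->] := lattice_gensP gg.
  by rewrite hpK -mulmxA mulKmx// TE.
rewrite hp_hZ mulmx0; have := ce 1; rewrite hmk0 scale1r => ->.
by rewrite hpK.
Qed.

Lemma marking : exists S (e : int), [/\ e = 1 \/ e = -1, G_r r S,
  symplectic_sign S e%:~R,
  forall gam, L gam -> hp (phi gam) = S *m hp gam &
  forall c : int, phi (hmk 0 c%:~R) = hmk 0 (c * e)%:~R].
Proof.
have uD := diag_r_unit R r_gt0.
have [e se ce] := phi_center; have [S SE] := phi_horizontal.
exists S, e.
have om : S^T *m @Jmx R n *m S = e%:~R *: @Jmx R n.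
  apply: (omega_basis_ext uD) => i j.
  have Li := L_gen i; have Lj := L_gen j.
  (* phi is known on integral central elements, so the commutator of two generators has to be
     recognized as one of them. *)
  have [c cE] : exists c : int, omega (hp (gen i)) (hp (gen j)) = c%:~R.
    rewrite !hpK /omega.
    pose d (j : 'I_(n + n)) : 'cV[int]_(n + n) := delta_mx j ord0.
    exists (\sum_(k < n) ((r k)%:Z * d i (lshift n k) ord0 * d j (rshift n k) ord0)
      - \sum_(k < n) ((r k)%:Z * d j (lshift n k) ord0 * d i (rshift n k) ord0)).
    rewrite sumrB rmorphB /= -!lat_cross !ivec_delta; congr (_ - _).
    by apply: eq_bigr => k _; rewrite mulrC.
  have comm (g h : H) : hmul g h = hmul (hmk 0 (omega (hp g) (hp h))) (hmul h g).
    apply: heisP; rewrite ?hp_mul ?zp_mul ?hp_mul !hpK ?zpK ?omegaE.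
      by rewrite add0r addrC.
    by rewrite (omega_antisym (hp h)); field.
  have := congr1 phi (comm (gen i) (gen j)).
  rewrite cE !phiM//; [|exact: L_center|exact: LM].
  rewrite ce (comm (phi (gen i))) => /hmulIr/(congr1 (@zp R n)); rewrite !zpK !SE// /gen !hpK => ->.
  by rewrite intrM mulrC -cE /gen !hpK.
have Lw j : exists w : 'cV[int]_(n + n), S *m (D *m delta_mx j ord0) = D *m ivec w.
  have [w wE] := lattice_hp (phiL (L_gen j)); exists w.
  by rewrite -wE SE ?hpK//; exact: L_gen.
have /choice[w wP] := Lw.
pose P := \matrix_(i, j) w j i ord0.
have SDP : S *m D = D *m map_mx intr P.
  apply: mulmx_ext => v; rewrite (matrix_sum_delta v) !mulmx_sumr.
  apply: eq_bigr => j _; rewrite big_ord1 -!scalemxAr; congr (_ *: _).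
  rewrite -!mulmxA wP; congr (D *m _); apply/matrixP => k l.
  have -> : l = ord0 by exact: ord1.
  by rewrite -colE !mxE.
(* Determinants in S^T J S = e J, of even order 2n. Since P is S in the coordinates of D, the
   integer det P has square 1 and P is invertible over the integers. *)
have dS : \det S ^+ 2 = 1.
  have := congr1 determinant om; rewrite !det_mulmx det_tr detZ.
  have e2 : (e%:~R : R) ^+ (n + n) = 1.
    by rewrite exprD; case: se => ->; rewrite ?expr1n ?mulr1// -exprMn mulrNN mulr1 expr1n.
  rewrite e2 mul1r => E.
  have J0 : \det (@Jmx R n) != 0.
    rewrite -unitfE -[_ \is a _]/(@Jmx R n \in unitmx).
    have : @Jmx R n *m - @Jmx R n = 1%:M.
      rewrite mulmxN /Jmx mulmx_block !mulmx0 !mul0mx !add0r !addr0 mulmx1 mul1mx.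
      by rewrite opp_block_mx oppr0 opprK -scalar_mx_block.
    by move=> /mulmx1_unit[].
  by apply: (mulIf J0); rewrite mul1r -[RHS]E expr2; ring.
have uS : S \in unitmx.
  rewrite unitmxE unitfE; apply/eqP => d0; move: dS; rewrite d0 expr0n => /eqP.
  by rewrite eq_sym oner_eq0.
have uP : P \in unitmx.
  have : (\det P ^+ 2)%:~R = 1 :> R.
    rewrite rmorphXn /= -det_map_mx -dS; congr (_ ^+ 2).
    have dD : \det D != 0 by rewrite -unitfE -[_ \is a _]/(D \in unitmx).
    by apply: (mulfI dD); rewrite -det_mulmx -SDP det_mulmx mulrC.
  move=> /(@intr_inj R (_ : int) 1) dP; rewrite unitmxE; apply/unitrPr; exists (\det P).
  by rewrite -expr2.
split=> //.
- exists P => //=; rewrite -SDP mulmxK//.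
- by split=> //; case: se => ->; [left | right].
Qed.

(** F sends gam^k to phi(gam)^k F 0. One inequality comes from powers of gam; for the other,
    phi(gam) is first conjugated by F 0, which does not change its horizontal part, so that its
    powers start at 0 after a left translation. *)
Lemma marking_cnorm_le S : (forall gam, L gam -> hp (phi gam) = S *m hp gam) ->
  forall gam, L gam -> cnorm A' (S *m hp gam) = cnorm A (hp gam).
Proof.
move=> SE gam Lg; have nK (k : nat) : L (k%:R *: gam).
  have := subgroup_zmul k%:Z (lattice_subgroup R r) Lg.
  by rewrite -pmulrn.
pose o := F 0; apply/eqP; rewrite eq_le; apply/andP; split.
  apply: (@stable_norm_le _ _ rho) => k x /Fr r1.
  have := reach_hp r1; rewrite FE// hp_mul SE// addrK hpZ -scalemxAr.
  by [].
pose g' := hmul (hmul (hinv o) (phi gam)) o.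
have hg' : hp g' = S *m hp gam by rewrite /g' !hp_mul hp_inv SE// addrAC addNr add0r.
rewrite -hg'; apply: (@stable_norm_le _ _ rho') => k x r1.
have phik : phi (k%:R *: gam) = k%:R *: phi gam.
  elim: k {r1} => [|k IH]; first by rewrite !scale0r phi0.
  have sM (g : H) : k.+1%:R *: g = hmul (k%:R *: g) g.
    apply: heisP; rewrite ?hp_mul ?zp_mul !hpZ ?zpZ ?omegaE -natr1; last by field.
    by rewrite scalerDl scale1r.
  by rewrite !sM phiM// IH.
have := reach_left o r1; rewrite hmul_conjZ -phik -FE// hmulg0 => /Fr/reach_hp.
by rewrite hp0 subr0 hpZ.
Qed.

End Marking.

Lemma dcoset_of_isometric A A' rho rho' : A \in unitmx -> A' \in unitmx ->
  isometric L (metric_of (pair_mx A rho)) (metric_of (pair_mx A' rho')) ->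
  dcoset r (pair_mx A rho) (pair_mx A' rho').
Proof.
move=> uA uA' [f [[fq fi fs] fd]].
have subL := lattice_subgroup R r.
have /choice[p pP] : forall h, exists k, f (hcoset L h) = hcoset L k.
  move=> h; have : hquotient L (f (hcoset L h)) by apply: fq; exists h.
  by move=> [k _ <-]; exists k.
have /choice[q qP] : forall k, exists h, f (hcoset L h) = hcoset L k.
  move=> k; have : hquotient L (hcoset L k) by exists k.
  by move=> /fs[_ [h _ <-] E]; exists h.
have inj h k : f (hcoset L h) = f (hcoset L k) -> hcoset L h = hcoset L k.
  by move=> E; apply: fi => //; rewrite inE; [exists h | exists k].
have cosetM gam h : L gam -> hcoset L (hmul gam h) = hcoset L h.
  by move=> Lg; apply/(hcoset_eqP subL); exists gam.
have [eps1 e10 sep1] := lat_separated r_gt0 rho uA.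
have [eps2 e20 sep2] := lat_separated r_gt0 rho' uA'.
rewrite -latticeE in sep1 sep2.
pose eps := Num.min eps1 eps2.
have eps0 : 0 < eps by rewrite lt_min e10.
have s1 : reach_separated A rho L eps.
  by move=> gam h Lg rr; apply: (sep1 gam h Lg); apply: reach_mono rr; rewrite ge_min lexx.
have s2 : reach_separated A' rho' L eps.
  by move=> gam h Lg rr; apply: (sep2 gam h Lg); apply: reach_mono rr; rewrite ge_min lexx orbT.
have [||||||F [F' [FK F'K Fr FL F'L]]] :=
    @isometry_lift R n A A' rho rho' L eps p q n0 subL eps0 s1 s2.
- move=> g h x rr; apply/(quotient_dist_reach _ _ _ _ subL uA').
  rewrite -!pP fd; [|by exists g|by exists h].
  apply/(quotient_dist_reach _ _ _ _ subL uA).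
  by exists 0; [case: subL | rewrite hmul0g].
- move=> g h x rr; apply/(quotient_dist_reach _ _ _ _ subL uA).
  rewrite -fd; [|by exists (q g)|by exists (q h)].
  rewrite !qP; apply/(quotient_dist_reach _ _ _ _ subL uA').
  by exists 0; [case: subL | rewrite hmul0g].
- move=> gam h Lg; apply/(hcoset_eqP subL); rewrite -!pP; congr f; exact: cosetM.
- move=> gam h Lg; apply/(hcoset_eqP subL); apply: inj; rewrite !qP; exact: cosetM.
- by move=> h; apply/(hcoset_eqP subL); apply: inj; rewrite qP pP.
- by move=> h; apply/(hcoset_eqP subL); rewrite -pP qP.
pose phi gam := hmul (F gam) (hinv (F 0)).
have phiP gam : L gam -> L (phi gam) /\ forall h, F (hmul gam h) = hmul (phi gam) (F h).
  move=> Lg; have [gam' Lg' E] := FL gam Lg.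
  by have -> : phi gam = gam' by rewrite /phi -[gam]hmulg0 E hmulgK.
have phiL gam (Lg : L gam) := (phiP gam Lg).1.
have phiF gam h (Lg : L gam) := (phiP gam Lg).2 h.
have [S [e [se GS sS hpS ce]]] := marking FK F'K phiL phiF F'L.
have [uS se' SJ] := sS; have om := (symplectic_omega S e%:~R).1 SJ.
have uD := diag_r_unit R r_gt0.
have nrm := marking_cnorm_le Fr phiF hpS.
(* X and Y express the two norms in the lattice basis; [nrm] gives their equality on basis vectors
   and on sums of two, which is what the polarization requires. *)
pose X := invmx A' *m S *m D; pose Y := invmx A *m D.
have XY : X^T *m X = Y^T *m Y.
  apply: gram_ext => [i|i j].
    by have := nrm _ (L_gen i); rewrite hpK /cnorm /X /Y !mulmxA.
  have Lij : L (hmul (gen i) (gen j)).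
    by case: subL => _ + _; apply; exact: L_gen.
  by have := nrm _ Lij; rewrite hp_mul !hpK -mulmxDr /cnorm /X /Y !mulmxA.
have uX : X \in unitmx by rewrite !unitmx_mul unitmx_inv uA' uS.
pose Q := Y *m invmx X.
have QQ : Q^T *m Q = 1%:M.
  rewrite /Q trmx_mul mulmxA -(mulmxA _ Y^T) -XY mulmxA -mulmxA mulmxV// mulmx1.
  by rewrite trmx_inv mulVmx// unitmx_tr.
have A'E : A' = S *m A *m Q.
  have QX : Q *m X = Y by rewrite /Q mulmxKV.
  have A'X : A' *m X = S *m D by rewrite /X !mulmxA mulmxV// mul1mx.
  have SAQX : S *m A *m Q *m X = S *m D.
    by rewrite -(mulmxA _ Q) QX /Y !mulmxA mulmxK.
  by rewrite -[LHS](mulmxK uX) A'X -SAQX mulmxK.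
have cnS v : cnorm A' (S *m v) = cnorm A v.
  rewrite /cnorm; have -> : invmx A' *m (S *m v) = X *m (invmx D *m v).
    by rewrite /X !mulmxA mulmxK.
  by rewrite (enorm_gram _ XY) /Y !mulmxA mulmxK.
have ee : (e%:~R : R) ^+ 2 = 1 by case: se => ->; rewrite ?expr1n// sqrrN expr1n.
(* S and its inverse transport distances between A and A' with the same weight rho'. The comparison
   of rho with rho' thus takes place over the single matrix A. *)
have rmap (B B' T : 'M[R]_(n + n)) : symplectic_sign T e%:~R -> (forall v, cnorm B' (T *m v) = cnorm B v) ->
    forall z x, reach B rho' 0 (hmk 0 z) x -> reach B' rho' 0 (hmk 0 (e%:~R * z)) x.
  move=> sT cT z x rz; have [_ _ TJ] := sT; have omT := (symplectic_omega T e%:~R).1 TJ.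
  have := @reach_map R n B B' rho' rho' T e%:~R 1 1 0 (hmk 0 z) x ltr01 omT.
  rewrite hpK zpK hp0 zp0 !mulmx0 mulr0 mul1r (_ : hmk 0 0 = 0) => [key|].
    apply: key => //.
      by move=> v; rewrite mul1r.
    by move=> u _; rewrite mul1r /unorm hpK zpK cT !exprMn ee mul1r.
  by rewrite hmk0 scale0r.
have cnS' v : cnorm A (invmx S *m v) = cnorm A' v by rewrite -cnS mulKVmx.
have rr : rho ^+ 2 = rho' ^+ 2.
  apply: (rho_determined n0 uA) => k x.
  have Fk : F (hmk 0 k%:R) = hmul (F 0) (hmk 0 (e%:~R * k%:R)).
    rewrite -{1}[hmk 0 _]hmulg0 phiF; last exact: (L_center k).
    by rewrite {1}[k%:R]pmulrn ce intrM -pmulrn mulrC center_commutes.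
  have st : reach A rho 0 (hmk 0 k%:R) x <-> reach A' rho' 0 (hmk 0 (e%:~R * k%:R)) x.
    by rewrite Fr Fk -[X in reach A' rho' X]hmulg0 reach_leftE.
  rewrite st; split=> [/(rmap _ _ _ (symplectic_inv sS) cnS')|/(rmap _ _ _ sS cnS)] //.
  by rewrite mulrA -expr2 ee mul1r.
(* rho' is rho or its opposite; e' takes up this sign together with the sign e. *)
have [e' se'' rE] : exists2 e' : R, (e' = 1 \/ e' = -1) & rho' = e%:~R * rho * e'.
  have /orP[/eqP ->|/eqP ->] : (rho' == rho) || (rho' == - rho) by rewrite -eqf_sqr rr.
    by exists e%:~R => //; rewrite mulrAC -expr2 ee mul1r.
  exists (- e%:~R); last by rewrite mulrN mulrAC -expr2 ee mul1r.
  by case: se' => ->; [right | left; rewrite opprK].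
exists (pair_mx S e%:~R); first by exists S, e%:~R.
exists (pair_mx Q e'); first by exists Q, e'.
by rewrite !pair_mxM -A'E -rE.
Qed.

End Rigidity.

(** * Double cosets and isometry classes *)

Section Correspondence.
Variables (R : realType) (n : nat) (r : 'I_n -> nat).
Hypotheses (n0 : (0 < n)%N) (r_gt0 : forall i, (0 < r i)%N).
Local Notation L := (lattice R r).
Local Notation met A rho := (metric_of (pair_mx A rho)).

(* The union over all representatives, so that no choice is needed. *)
Definition metric_class (D : set 'M[R]_(n + n + 1)) : set (sr_metric R n) :=
  [set m | exists A rho, [/\ A \in unitmx, D = dcoset r (pair_mx A rho) &
    isometry_class L (met A rho) m]].

Lemma metric_classE A rho : A \in unitmx ->
  metric_class (dcoset r (pair_mx A rho)) = isometry_class L (met A rho).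
Proof.
move=> uA; apply/seteqP; split=> m; last by exists A, rho.
move=> [A' [rho' [uA' E]]]; rewrite -(isometry_class_eq (m1 := met A rho))//.
by apply: isometric_of_dcoset => //; rewrite E; exact: dcoset_self.
Qed.

Lemma admissible_pair_mx (A : 'M[R]_(n + n)) rho : A \in unitmx -> admissible (met A rho).
Proof.
move=> uA; split; first exact: bracket_generating_pair_mx.
by rewrite corank_pair_mx//; case: (rho == 0).
Qed.

(** One map serves all three correspondences; only the range I of rho and the class C of metrics
    vary. The first hypothesis puts the block metrics into C, and the second, the normal form, gives
    surjectivity. *)
Lemma metric_class_bij (I : set R) (C : set (sr_metric R n)) :
  (forall (A : 'M[R]_(n + n)) rho, A \in unitmx -> I rho -> C (met A rho)) ->
  (forall m, C m -> exists A rho, [/\ A \in unitmx, I rho & isometric L m (met A rho)]) ->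
  set_bij (dcosets r I) (isometry_classes L C) metric_class.
Proof.
move=> IC CI; split.
- move=> _ [_ [A [rho [uA Ir ->]]] <-]; rewrite metric_classE//.
  by exists (met A rho) => //; exact: IC.
- move=> _ _ /set_mem[_ [A [rho [uA Ir ->]]] <-] /set_mem[_ [A' [rho' [uA' Ir' ->]]] <-].
  rewrite (metric_classE _ uA) (metric_classE _ uA') => E.
  have iso := isometry_class_isometric (admissible_pair_mx rho' uA') E.
  exact: (dcoset_eq r_gt0 (dcoset_of_isometric n0 r_gt0 uA uA' iso)).
- move=> _ [m Cm <-]; have [A [rho [uA Ir mA]]] := CI m Cm.
  exists (dcoset r (pair_mx A rho)).
    by exists (pair_mx A rho) => //; exists A, rho.
  by rewrite metric_classE// (isometry_class_eq mA).
Qed.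

End Correspondence.

Theorem theorem3p4 (R : realType) (n : nat) (r : 'I_n -> nat)
    (hn : (1 <= n)%N) (hr : in_D r) :
  exists Psi : set 'M[R]_(n + n + 1) -> set (sr_metric R n),
    [/\ set_bij (dcosets r [set: R])
          (isometry_classes (lattice R r) [set m | admissible m]) Psi,
        forall (A : 'M[R]_(n + n)) (rho : R), A \in unitmx ->
          Psi (dcoset r (pair_mx A rho)) =
          isometry_class (lattice R r) (metric_of (pair_mx A rho)),
        set_bij (dcosets r [set rho : R | rho != 0])
          (isometry_classes (lattice R r) [set m | admissible_corank 0 m]) Psi
      & set_bij (dcosets r [set 0 : R])
          (isometry_classes (lattice R r) [set m | admissible_corank 1 m]) Psi].
Proof.
have r_gt0 := hr.1; have subL := lattice_subgroup R r.
exists (metric_class r); split.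
- apply: metric_class_bij => //= [A rho uA _|m /(admissible_normal_form subL)].
    exact: admissible_pair_mx.
  by move=> [A [rho [uA mA _ _]]]; exists A, rho.
- by move=> A rho; exact: metric_classE.
- apply: metric_class_bij => //= [A rho uA rho0|m [bm cm]].
    by split; [exact: bracket_generating_pair_mx | rewrite corank_pair_mx// (negbTE rho0)].
  have [|A [rho [uA mA c0 _]]] := @admissible_normal_form R n _ m subL.
    by split=> //; rewrite cm.
  by exists A, rho; split=> //; exact: c0.
- apply: metric_class_bij => //= [A _ uA ->|m [bm cm]].
    by split; [exact: bracket_generating_pair_mx | rewrite corank_pair_mx// eqxx].
  have [|A [rho [uA mA _ c1]]] := @admissible_normal_form R n _ m subL.
    by split=> //; rewrite cm.
  by exists A, rho; split=> //; exact: c1.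
Qed.
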